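(* Let $k\ge1$ be an integer, $\lambda,\mu>0$, $\theta>0$, $\alpha\in(0,1)$. The inter-phase times $\mathcal{P}^{\theta,\alpha}$ of the tempered Erlang queue are independent and identically distributed with \begin{equation*} \Pr(\mathcal{P}^{\theta,\alpha}>t)=e^{-\theta t}\sum_{q=0}^{\infty}(\theta t)^q\sum_{r=0}^{\infty}(-k\mu t^\alpha)^rE_{\alpha, r\alpha+q+1}^r(\theta^\alpha t^\alpha),\qquad t\ge0. \end{equation*}
   Context: Erlang queue: $\{Q(t)\}_{t\ge0}$, $Q(t)=(N(t),S(t))$, with $N(t)$ the number of customers and $S(t)$ the phase of the customer in service, where customers arrive according to a Poisson process of rate $\lambda$ and the service of each customer consists of $k$ successive phases, each with exponential duration of rate $k\mu$. Let $D_{\theta,\alpha}$ be the subordinator with $\mathbb{E}e^{-sD_{\theta,\alpha}(t)}=e^{-t((s+\theta)^\alpha-\theta^\alpha)}$ and $Y_{\theta,\alpha}(t)=\inf\{x>0:D_{\theta,\alpha}(x)>t\}$, independent of $Q$; the tempered Erlang queue is $Q^{\theta,\alpha}(t)=Q(Y_{\theta,\alpha}(t))$. An inter-phase time of $Q^{\theta,\alpha}$ is the time, measured on the clock $t$ of $Q^{\theta,\alpha}$, between the start and the completion of a service phase (i.e. if a phase occupies the interval $[\sigma,\sigma+E)$ of the time of $Q$, the corresponding inter-phase time is the length of $\{t\ge0: Y_{\theta,\alpha}(t)\in[\sigma,\sigma+E)\}$). Three-parameter Mittag-Leffler function: $E_{\alpha,b}^{\gamma}(x)=\sum_{j\ge0}\frac{(\gamma)_j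 x^j}{j!\Gamma(\alpha j+b)}$ with Pochhammer symbol $(\gamma)_j$, $(\gamma)_0=1$ (so $E^0_{\alpha,b}(x)=1/\Gamma(b)$). *)

(* Defs.v *)
From HB Require Import structures.
From mathcomp Require Import all_boot all_order all_algebra.
From mathcomp Require Import all_classical all_reals all_analysis measurable_realfun.
Set Implicit Arguments. Unset Strict Implicit. Unset Printing Implicit Defensive.
Import Order.TTheory GRing.Theory Num.Theory.
Import numFieldNormedType.Exports.
Local Open Scope classical_set_scope.
Local Open Scope ring_scope.

Definition Gamma_integrand (R : realType) (x u : R) : R :=
  powR u (x - 1) * expR (- u).
Definition Gamma (R : realType) (x : R) : R :=
  fine (\int[@lebesgue_measure R]_(u in [set u : R | (0 < u)%R])
          (Gamma_integrand x u)%:E)%E.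

Definition poch (R : realType) (g : R) (j : nat) : R :=
  \prod_(i < j) (g + i%:R).

Definition ML3 (R : realType) (a b g x : R) : R :=
  limn (series (fun j : nat =>
     poch g j * x ^+ j / ((j`!)%:R * Gamma (a * j%:R + b)))).

Definition indep_events (d : measure_display) (Omega : measurableType d)
  (R : realType) (P : probability Omega R) (I : eqType)
  (F : I -> set (set Omega)) : Prop :=
  forall (J : seq I) (A : I -> set Omega), uniq J ->
    (forall i, i \in J -> F i (A i)) ->
    P (\bigcap_(i in [set i | i \in J]) A i) = (\prod_(i <- J) P (A i))%E.

Definition rv_events (d : measure_display) (Omega : measurableType d)
  (d' : measure_display) (T : measurableType d') (X : Omega -> T)
  : set (set Omega) :=
  [set X @^-1` B | B in measurable].

Definition proc_events (d : measure_display) (Omega : measurableType d)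
  (R : realType) (D : R -> Omega -> R) : set (set Omega) :=
  smallest (@sigma_algebra Omega setT)
    (\bigcup_(x in [set x : R | 0 <= x]) rv_events (D x)).

Definition exp_distributed (d : measure_display) (Omega : measurableType d)
  (R : realType) (P : probability Omega R) (c : R) (X : Omega -> R) : Prop :=
  measurable_fun setT X /\
  forall t : R, 0 <= t -> P [set w | t < X w] = (expR (- (c * t)))%:E.

Definition tempered_subordinator (d : measure_display) (Omega : measurableType d)
  (R : realType) (P : probability Omega R) (theta alpha : R)
  (D : R -> Omega -> R) : Prop :=
  (forall x, 0 <= x -> measurable_fun setT (D x)) /\
  (forall w, D 0 w = 0) /\
  (forall w x y, 0 <= x -> x <= y -> D x w <= D y w) /\
  (forall w x, 0 <= x -> (fun y => D y w) @ at_right x --> D x w) /\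
  (forall x : nat -> R, 0 <= x 0%N -> (forall n, x n < x n.+1) ->
     indep_events P (fun n : nat =>
       rv_events (fun w => D (x n.+1) w - D (x n) w))) /\
  (forall x h B, 0 <= x -> 0 <= h -> measurable B ->
     P [set w | B (D (x + h) w - D x w)] = P [set w | B (D h w)]) /\
  (forall s t, 0 <= s -> 0 <= t ->
     (\int[P]_w (expR (- (s * D t w)))%:E)%E =
       (expR (- (t * ((s + theta) `^ alpha - theta `^ alpha))))%:E).

Definition inv_sub (R : realType) (Omega : Type) (D : R -> Omega -> R)
  (t : R) (w : Omega) : R :=
  inf [set x : R | 0 < x /\ t < D x w].

(* Erlang queue primitives (FIFO single server, n0 customers present at
   time 0 with the first one starting phase 1 at time 0).
   Arr j = j-th interarrival time after time 0, Ph n = duration of the n-th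
   service phase overall (phase n mod k of customer n %/ k). *)
Definition arrival_time (R : realType) (Omega : Type) (n0 : nat)
  (Arr : nat -> Omega -> R) (j : nat) (w : Omega) : R :=
  if (j < n0)%N then 0 else \sum_(i < (j - n0).+1) Arr i w.

(* start time (in the clock of Q) of the n-th service phase *)
Fixpoint phase_start (R : realType) (Omega : Type) (k n0 : nat)
  (Arr Ph : nat -> Omega -> R) (n : nat) (w : Omega) : R :=
  match n with
  | 0 => arrival_time n0 Arr 0 w
  | m.+1 =>
      let c := phase_start k n0 Arr Ph m w + Ph m w in
      if (n %% k == 0)%N then Num.max (arrival_time n0 Arr (n %/ k) w) c
      else c
  end.

(* n-th inter-phase time of the tempered queue Q(Y(t)) *)
Definition inter_phase (R : realType) (Omega : Type) (k n0 : nat)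
  (Arr Ph : nat -> Omega -> R) (D : R -> Omega -> R) (n : nat) (w : Omega)
  : \bar R :=
  let s := phase_start k n0 Arr Ph n w in
  (@lebesgue_measure R)
    [set t : R | 0 <= t /\ s <= inv_sub D t w < s + Ph n w].

Inductive src := SArr of nat | SPh of nat | SSub.
Definition src_eq (a b : src) : bool :=
  match a, b with
  | SArr i, SArr j => (i == j)%N
  | SPh i, SPh j => (i == j)%N
  | SSub, SSub => true
  | _, _ => false end.
Lemma src_eqP : Equality.axiom src_eq.
Proof. by case=> [i|i|] [j|j|] /=; try (by constructor);
  apply: (iffP eqP) => [->|[]]. Qed.
HB.instance Definition _ := hasDecEq.Build src src_eqP.

(* Main.v *)
Require Import Defs.
From HB Require Import structures.
From mathcomp Require Import all_boot all_order all_algebra.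
From mathcomp Require Import all_classical all_reals all_analysis measurable_realfun.
From mathcomp Require Import ring lra zify.
Import Order.TTheory GRing.Theory Num.Theory.
Import numFieldNormedType.Exports.
Local Open Scope classical_set_scope.
Local Open Scope ring_scope.

(* With phi s = (s + theta)^alpha - theta^alpha, the inter-phase time of a phase
   occupying [sigma, sigma + E) is the increment D((sigma+E)-) - D(sigma-). The
   start times and durations are approximated strictly from below on the grid
   of mesh 1/m, where conditioning on the (countably many) values of the queue
   makes the increments of D independent; letting m tend to infinity produces
   exactly these left limits, and the joint Laplace transform of the inter-phase
   times is the product of the factors E[e^(-phi(u_i) E_i)] = c / (c + phi u_i),
   c = k mu. Uniqueness of Laplace transforms gives independence. For the tail,
   (1 - c / (c + phi s)) / s is expanded, after the shift s -> s - theta, in powers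
   of c / (s^alpha - theta^alpha), each of which is expanded by the negative
   binomial series and is termwise the transform of the Mittag-Leffler terms; to
   stay with nonnegative terms (Tonelli), even and odd powers are kept on
   opposite sides of the identity. *)

Set Implicit Arguments.
Unset Strict Implicit.
Unset Printing Implicit Defensive.

(** * Laplace transforms and independence *)

Section density.
Import HBNNSimple.

(** Independence is given for events only, while [D] is evaluated at random times, so no joint law
    of path and queue is at hand. On a cell where finitely many rounded sources are fixed, the
    sampled product is a function of [D] at deterministic times, and the event form of independence
    suffices. The transform identity for the tail is derived for rates [s > theta] with
    [c < s^alpha - theta^alpha], where the geometric series in [c / (s^alpha - theta^alpha)]
    converges. This is why uniqueness is proved from transforms at integer arguments alone: after a
    factor [e^(- s0 x)] is absorbed into both densities, the admissible rates [s0 + n] become the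
    integers [n]. Uniqueness gives equality almost everywhere, and right continuity of the tail and
    of the series lifts it to every [t >= 0]. For the series, right continuity rests on terms that
    are nonnegative and nondecreasing in [t], a second reason to separate even from odd powers. *)

Lemma density_measure d (T : measurableType d) (R : realType)
  (mu : {measure set T -> \bar R}) (W : T -> R) :
  measurable_fun setT W -> (forall x, 0 <= W x) ->
  exists nu : {measure set T -> \bar R},
    (forall A, measurable A -> nu A = (\int[mu]_(x in A) (W x)%:E)%E) /\
    (forall f : T -> R, measurable_fun setT f -> (forall x, 0 <= f x) ->
      (\int[nu]_x (f x)%:E = \int[mu]_x (f x * W x)%R%:E)%E).
Proof.
move=> mW W0.
pose m A := (\int[mu]_(x in A) (W x)%:E)%E.
have m0 : m set0 = 0%E by rewrite /m integral_set0.
have mge0 A : (0 <= m A)%E by apply: integral_ge0 => x _; rewrite lee_fin.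
have msig : semi_sigma_additive m.
  move=> F mF tF mUF; rewrite /m ge0_integral_bigcup//.
  - apply: is_cvg_ereal_nneg_natsum_cond => n _ _.
    by apply: integral_ge0 => x _; rewrite lee_fin.
  - exact/measurable_funTS/measurable_EFinP.
  - by move=> x _; rewrite lee_fin.
pose b := isMeasure.Build _ _ _ m m0 mge0 msig.
pose nu : {measure set T -> \bar R} := HB.pack m b.
exists nu; split => // f mf f0.
have mf' : measurable_fun setT (EFin \o f) by apply/measurable_EFinP.
pose h : nat -> {nnsfun T >-> R} := nnsfun_approx measurableT mf'.
have hcvg x : (h n x)%:E @[n --> \oo] --> (f x)%:E.
  by apply: cvg_nnsfun_approx => // *; rewrite lee_fin.
have hnd x : {homo (fun n => h n x) : a b / (a <= b)%N >-> (a <= b)%R}.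
  by move=> a b' ab; exact/lefP/nd_nnsfun_approx.
(* Monotone convergence on both sides reduces the claim to the simple functions [h n], for which it
   unfolds to the definition of [nu] on level sets. *)
transitivity (limn (fun n => \int[nu]_x (h n x)%:E)%E).
  rewrite -monotone_convergence//.
  - by apply: eq_integral => y _; apply/esym/cvg_lim => //; exact: hcvg.
  - by move=> n; exact/measurable_EFinP.
  - by move=> n y _; rewrite lee_fin.
  - by move=> y _ a b' ab; rewrite lee_fin; exact: hnd.
transitivity (limn (fun n => \int[mu]_x (h n x * W x)%R%:E)%E); last first.
  rewrite -monotone_convergence//.
  - apply: eq_integral => y _; apply/cvg_lim => //.
    under eq_fun do rewrite EFinM.
    rewrite EFinM; apply: cvgeZr => //; exact: hcvg.
  - by move=> n; apply/measurable_EFinP/measurable_funM.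
  - by move=> n y _; rewrite lee_fin mulr_ge0.
  - by move=> y _ a b' ab; rewrite lee_fin ler_wpM2r//; exact: hnd.
congr (limn _); apply/funext => n.
rewrite integralT_nnsfun sintegralE.
transitivity (\int[mu]_x (\sum_(y \in range (h n))
   (y * \1_(h n @^-1` [set y]) x * W x)%R%:E))%E; last first.
  apply: eq_integral => t _.
  transitivity ((\sum_(y \in range (h n))
      (y * \1_(h n @^-1` [set y]) t)%:E) * (W t)%:E)%E.
    rewrite ge0_mule_fsuml//.
    by move=> i; exact: nnfun_muleindic_ge0.
  by rewrite fsumEFin// -fimfunE EFinM.
rewrite ge0_integral_fsum//.
- apply: eq_fsbigr => y; rewrite inE => -[x _ yx].
  have y0 : 0 <= y by rewrite -yx.
  under eq_integral do rewrite -mulrA EFinM.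
  rewrite ge0_integralZl//.
  + congr (_ * _)%E; rewrite /nu /= /m integral_mkcond.
    apply: eq_integral => z _; rewrite patchE indicE.
    by case: ifPn => ?; rewrite ?mul1r ?mul0r.
  + by apply/measurable_EFinP/measurable_funM.
  + by move=> z _; rewrite lee_fin mulr_ge0.
- by move=> y; apply/measurable_EFinP; apply: measurable_funM => //; apply: measurable_funM.
- move=> y x _; rewrite EFinM mule_ge0 ?lee_fin//; exact: nnfun_muleindic_ge0.
Qed.

End density.

Lemma integral_indic_weight d (T : measurableType d) (R : realType)
  (mu : {measure set T -> \bar R}) (A : set T) (V : T -> R) :
  (\int[mu]_(x in A) (V x)%:E = \int[mu]_x (\1_A x * V x)%R%:E)%E.
Proof.
rewrite integral_mkcond; apply: eq_integral => z _; rewrite patchE indicE.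
by case: ifPn => ?; rewrite ?mul1r ?mul0r.
Qed.

(** Both sides integrate [f] against pushforwards by [X]: of the measure with density [V], and of
    [K] times [mu]. The hypothesis on the sets [C] says that these two measures are equal. *)
Lemma integral_comp_factor d d' (T : measurableType d) (T' : measurableType d')
  (R : realType) (mu : {measure set T -> \bar R}) (X : T -> T') (V : T -> R)
  (K : R) (f : T' -> R) :
  measurable_fun setT X -> measurable_fun setT V -> (forall x, 0 <= V x) ->
  0 <= K ->
  (forall C, measurable C ->
    (\int[mu]_(x in X @^-1` C) (V x)%:E = K%:E * mu (X @^-1` C))%E) ->
  measurable_fun setT f -> (forall x, 0 <= f x) ->
  (\int[mu]_x (f (X x) * V x)%R%:E = K%:E * \int[mu]_x (f (X x))%:E)%E.
Proof.
move=> mX mV V0 K0 h mf f0.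
have mfX : measurable_fun setT (fun x => f (X x)) by exact: measurableT_comp.
have mE : measurable_fun setT (EFin \o f) by apply/measurable_EFinP.
have fE0 : {in setT, forall y, (0 <= (EFin \o f) y)%E}.
  by move=> y _; rewrite /= lee_fin.
have [nu [nuE nuI]] := density_measure mu mV V0.
rewrite -(nuI (fun x => f (X x)))//.
rewrite -[LHS](ge0_integral_pushforward mX nu measurableT mE fE0).
rewrite -[in RHS](ge0_integral_pushforward mX mu measurableT mE fE0).
rewrite -[RHS](ge0_integral_mscale _ measurableT (NngNum K0))//; last first.
  by move=> x _; rewrite /= lee_fin.
apply: eq_measure_integral => A mA _.
change (nu (X @^-1` A) = K%:E * mu (X @^-1` A))%E.
by rewrite nuE ?h// -[X in measurable X]setTI; exact: mX.
Qed.

Lemma bounded_cvg_integral d (T : measurableType d) (R : realType)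
  (mu : {measure set T -> \bar R}) (f_ : nat -> T -> R) (f : T -> R) (M : R) :
  (mu setT < +oo)%E ->
  (forall n, measurable_fun setT (f_ n)) -> measurable_fun setT f ->
  {ae mu, forall x, f_ n x @[n --> \oo] --> f x} ->
  (forall n x, `|f_ n x| <= M) ->
  (\int[mu]_x (f_ n x)%:E)%E @[n --> \oo] --> (\int[mu]_x (f x)%:E)%E.
Proof.
move=> fin mf_ mf fae fM.
have [//|||||_ _] := @dominated_convergence _ _ _ mu setT measurableT
  (fun n x => (f_ n x)%:E) (EFin \o f) (EFin \o cst M).
- by move=> n; exact/measurable_EFinP.
- exact/measurable_EFinP.
- apply: filterS fae => x hx _; apply: cvg_EFin => //; exact: nearW.
- apply: measurable_bounded_integrable => //.
  exact: bounded_cst.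
- by apply: aeW => x n _ /=; rewrite lee_fin.
- by [].
Qed.

Lemma integral_EFin_sum d (T : measurableType d) (R : realType)
  (mu : {measure set T -> \bar R}) (N : nat) (a : nat -> R) (h : nat -> T -> R) :
  (forall n, mu.-integrable setT (EFin \o h n)) ->
  (\int[mu]_x (\sum_(j < N) a j * h j x)%R%:E =
   \sum_(j < N) (a j)%:E * \int[mu]_x (h j x)%:E)%E.
Proof.
move=> ih.
transitivity (\int[mu]_x (\sum_(j < N) (a j)%:E * (h j x)%:E)%E)%E.
  by apply: eq_integral => x _; rewrite sumEFin.
rewrite (@integral_sum _ _ _ mu setT measurableT _
  (fun (j : 'I_N) x => ((a j)%:E * (h j x)%:E)%E)); last first.
  by move=> n; apply: integrableZl => //; exact: ih.
by apply: eq_bigr => j _; rewrite integralZl//; exact: ih.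
Qed.

(** The outer exponent is [- n e^(n (t - x))] with [n] shifted by one. The factor [n] in front
    decides the case [x = t]: it sends the value there to 0, where without it the constant [e^(-1)]
    would remain. *)
Lemma cvg_expR_expR_indic (R : realType) (t x : R) :
  expR (- (n.+1%:R * expR (n.+1%:R * t) * expR (- (n.+1%:R * x)))) @[n --> \oo]
    --> (\1_`]t, +oo[ x : R).
Proof.
have E n : n.+1%:R * expR (n.+1%:R * t) * expR (- (n.+1%:R * x)) =
  n.+1%:R * expR (n.+1%:R * (t - x)) :> R.
  by rewrite -mulrA -expRD mulrBr.
under eq_fun do rewrite E.
rewrite indicE mem_setE in_itv/= andbT.
have [tx|xt] := ltP t x.
- pose e := x - t; have e0 : 0 < e by rewrite subr_gt0.
  (* With [y = n + 1], the bound [(y e / 2)^2 <= e^(y e)] gives [y e^(- y e) <= (4 / e^2) / y]; then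
     [1 - a <= e^(- a)] applies. *)
  apply: (@squeeze_cvgr _ _ _ _ (fun n => 1 - (4 / e ^+ 2) * harmonic n) (cst 1)).
  + near=> n; apply/andP; split; last first.
      by rewrite /= -expR0 ler_expR oppr_le0 mulr_ge0// expR_ge0.
    apply: le_trans (expR_ge1Dx _); rewrite lerD2l lerN2.
    have -> : t - x = - e by rewrite opprB.
    set y : R := n.+1%:R; have y0 : 0 < y by rewrite ltr0n.
    have h1 : (y * e / 2) ^+ 2 <= expR (y * e).
      have -> : y * e = y * e / 2 + y * e / 2 by lra.
      rewrite expRD -expr2; set z := _ + _; have -> : z / 2 = y * e / 2 by rewrite /z; lra.
      have h0 : 0 <= y * e / 2 by rewrite divr_ge0// mulr_ge0// ltW.
      rewrite lerXn2r ?nnegrE ?expR_ge0//.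
      by apply: le_trans (expR_ge1Dx _); lra.
    rewrite mulrN expRN; change (harmonic n : R) with (y^-1).
    rewrite ler_pdivrMr ?expR_gt0//.
    apply: le_trans (ler_wpM2l _ h1); last first.
      by rewrite mulr_ge0 ?divr_ge0 ?sqr_ge0// invr_ge0 ltW.
    rewrite le_eqVlt; apply/orP; left; apply/eqP; field.
    by rewrite !gt_eqF.
  + rewrite -[X in _ --> X]subr0 -[X in _ - X](mulr0 (4 / e ^+ 2)).
    apply: cvgB; first exact: cvg_cst.
    apply: cvgMr; exact: cvg_harmonic.
  + exact: cvg_cst.
- apply: (@squeeze_cvgr _ _ _ _ (cst 0) harmonic).
  + near=> n; rewrite /= expR_ge0/= expRN /harmonic lef_pV2 ?posrE ?expR_gt0//.
    apply: le_trans (expR_ge1Dx _).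
    rewrite -[X in X <= _]add0r lerD// ler_peMr// -expR0 ler_expR mulr_ge0//.
    by rewrite subr_ge0.
  + exact: cvg_cst.
  + exact: cvg_harmonic.
Unshelve. all: by end_near. Qed.

(** * Uniqueness from Laplace transforms at integer arguments *)

Section laplace_uniqueness.
Context d (T : measurableType d) (R : realType).
Variables (m1 m2 : {measure set T -> \bar R}) (X : T -> R).
Hypotheses (fin1 : (m1 setT < +oo)%E) (fin2 : (m2 setT < +oo)%E).
Hypotheses (mX : measurable_fun setT X) (X0 : forall x, 0 <= X x).
Hypothesis laplaceE : forall n : nat,
  (\int[m1]_x (expR (- (n%:R * X x)))%:E =
   \int[m2]_x (expR (- (n%:R * X x)))%:E)%E.

Let mexp (c : R) : measurable_fun setT (fun x => expR (- (c * X x))).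
Proof.
apply: measurableT_comp; first exact: measurable_expR.
by apply: measurableT_comp => //; exact: measurable_funM.
Qed.

Let exp01 (n : nat) x : 0 <= expR (- (n%:R * X x)) <= 1.
Proof. by rewrite expR_ge0/= -expR0 ler_expR oppr_le0 mulr_ge0. Qed.

Let exp_integrable (m : {measure set T -> \bar R}) (n : nat) :
  (m setT < +oo)%E ->
  m.-integrable setT (EFin \o (fun x => expR (- (n%:R * X x)))).
Proof.
move=> fin; apply: measurable_bounded_integrable => //.
exists 1; split; first exact: num_real.
move=> M M1 x _; have /andP[h0 h1] := exp01 n x.
by rewrite /= ger0_norm// (le_trans h1)// ltW.
Qed.

(** Taylor polynomial of [expR (- (c * y))] at [y = expR (- (n%:R * X x))]; the power [y ^+ j] is an
    exponential with the integer rate [n * j], so its integral is one of the given transforms. *)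
Let partial (c : R) (n N : nat) x :=
  \sum_(j < N) ((- c) ^+ j / j`!%:R) * expR (- ((n * j)%:R * X x)).

Let partialE c n N x : partial c n N x =
  series (exp_coeff (- c * expR (- (n%:R * X x)))) N.
Proof.
rewrite /series/= /partial big_mkord; apply: eq_bigr => j _.
rewrite /exp_coeff/= exprMn -expRM_natl mulrAC; congr (_ * expR _ / _).
by rewrite -mulr_natl natrM; ring.
Qed.

(** A bound independent of [N] and [x], available because [y] lies in [[0, 1]]; it licenses bounded
    convergence as [N] grows. *)
Let partial_bound c n N x : `|partial c n N x| <= expR `|c|.
Proof.
rewrite partialE; apply: (@le_trans _ _ (series (exp_coeff `|c|) N)).
  rewrite /series/=; apply: le_trans (ler_norm_sum _ _ _) _.
  apply: ler_sum => j _.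
  rewrite normrM normfV !normrX normrM normrN (ger0_norm (expR_ge0 _)).
  rewrite [`|_%:R|]ger0_norm//.
  rewrite ler_wpM2r ?invr_ge0// lerXn2r ?nnegrE ?mulr_ge0 ?expR_ge0//.
  by rewrite ler_piMr//; have /andP[] := exp01 n x.
rewrite /expR; apply: nondecreasing_cvgn_le; last exact: is_cvg_series_exp_coeff.
by apply/nondecreasing_series => k _ _; exact: exp_coeff_ge0.
Qed.

Let mpartial c n N : measurable_fun setT (partial c n N).
Proof.
apply: measurable_sum => j; apply: measurable_funM => //; exact: mexp.
Qed.

Let expR_expE (c : R) (n : nat) :
  (\int[m1]_x (expR (- (c * expR (- (n%:R * X x)))))%:E =
   \int[m2]_x (expR (- (c * expR (- (n%:R * X x)))))%:E)%E.
Proof.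
have cv (m : {measure set T -> \bar R}) : (m setT < +oo)%E ->
  (\int[m]_x (partial c n N x)%:E)%E @[N --> \oo] -->
  (\int[m]_x (expR (- (c * expR (- (n%:R * X x)))))%:E)%E.
  move=> fin; apply: (@bounded_cvg_integral _ _ _ _ _ _ (expR `|c|)) => //.
  - apply: measurableT_comp; first exact: measurable_expR.
    apply: measurableT_comp => //; apply: measurable_funM => //; exact: mexp.
  - apply: aeW => x; under eq_fun do rewrite partialE.
    rewrite -mulNr; exact: is_cvg_series_exp_coeff.
have := cv _ fin1; have := cv _ fin2.
suff -> : (fun N => \int[m1]_x (partial c n N x)%:E)%E =
          (fun N => \int[m2]_x (partial c n N x)%:E)%E.
  by move=> h2 h1; exact: (cvg_unique _ h1 h2).
apply/funext => N; rewrite /partial.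
rewrite (@integral_EFin_sum _ _ _ m1 N (fun j => (- c) ^+ j / j`!%:R)
  (fun j x => expR (- ((n * j)%:R * X x)))); last by move=> j; exact: exp_integrable.
rewrite (@integral_EFin_sum _ _ _ m2 N (fun j => (- c) ^+ j / j`!%:R)
  (fun j x => expR (- ((n * j)%:R * X x)))); last by move=> j; exact: exp_integrable.
by apply: eq_bigr => j _; rewrite laplaceE.
Qed.

(* As n tends to infinity, [exp (- n e^(n (t - x)))] tends to [1{x > t}]; its power
   series in [e^(- n x)] only involves the given transforms. *)
Lemma laplace_measure_unique (B : set R) :
  measurable B -> m1 (X @^-1` B) = m2 (X @^-1` B).
Proof.
have mpre C : measurable C -> measurable (X @^-1` C).
  by move=> mC; rewrite -[X in measurable X]setTI; exact: mX.
have ray t : m1 (X @^-1` `]t, +oo[) = m2 (X @^-1` `]t, +oo[).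
  have cv (m : {measure set T -> \bar R}) : (m setT < +oo)%E ->
    (\int[m]_x (expR (- (n.+1%:R * expR (n.+1%:R * t) *
      expR (- (n.+1%:R * X x)))))%:E)%E @[n --> \oo] -->
    m (X @^-1` `]t, +oo[).
    move=> fin.
    have -> : m (X @^-1` `]t, +oo[) = (\int[m]_x (\1_`]t, +oo[ (X x))%:E)%E.
      change (m (X @^-1` `]t, +oo[) = \int[m]_x (\1_(X @^-1` `]t, +oo[) x)%:E)%E.
      by rewrite integral_indic ?setIT//; exact: mpre.
    apply: (@bounded_cvg_integral _ _ _ _ _ _ 1) => //.
    - move=> n; apply: measurableT_comp; first exact: measurable_expR.
      apply: measurableT_comp => //; apply: measurable_funM => //; exact: mexp.
    - apply: measurableT_comp => //; exact: measurable_indic.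
    - by apply: aeW => x; exact: cvg_expR_expR_indic.
    - by move=> n x; rewrite ger0_norm ?expR_ge0.
  move: (cv _ fin1) (cv _ fin2).
  rewrite (_ : (fun n : nat => \int[m1]_x (expR (- (n.+1%:R * expR (n.+1%:R * t) *
      expR (- (n.+1%:R * X x)))))%:E)%E =
    (fun n : nat => \int[m2]_x (expR (- (n.+1%:R * expR (n.+1%:R * t) *
      expR (- (n.+1%:R * X x)))))%:E)%E); last first.
    by apply/funext => n; exact: expR_expE.
  by move=> h1 h2; exact: (cvg_unique _ h1 h2).
move=> mB.
change (pushforward m1 X B = pushforward m2 X B).
(* Open right rays are stable under intersection and generate the Borel sets; the rays starting at
   [- n] exhaust the line and have finite mass. *)
apply: (@measure_unique _ R _ (@RGenOInfty.G R)
  (fun n => `](- n%:R), +oo[%classic) (RGenOInfty.measurableE R) _ _ _ _ _ _ _ B mB).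
- move=> _ _ [x ->] [y ->]; exists (Num.max x y).
  apply/seteqP; split=> z /=; rewrite !in_itv/= !andbT gt_max.
    by move=> [-> ->].
  by move=> /andP[].
- by move=> n; exists (- n%:R).
- apply/seteqP; split=> // x _; exists (Num.bound `|x|) => //=.
  rewrite in_itv/= andbT ltrNl; apply: le_lt_trans (archi_boundP (normr_ge0 x)).
  by rewrite -normrN ler_norm.
- by move=> _ [t ->]; exact: ray.
- move=> n; change (m1 (X @^-1` `](- n%:R)%R, +oo[) < +oo)%E.
  by apply: (le_lt_trans _ fin1); apply: le_measure; rewrite ?inE//; exact: mpre.
Qed.

End laplace_uniqueness.

(** * Product rules for expectations and independence *)

Section expectation.
Context d (Omega : measurableType d) (R : realType) (P : probability Omega R).

(** The default value of [fine] at infinity does not arise for integrands with values in [[0, 1]],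
    by [Ex_EFin]. *)
Definition Ex (f : Omega -> R) : R := fine (\int[P]_w (f w)%:E)%E.

Lemma Ex_EFin (f : Omega -> R) : measurable_fun setT f ->
  (forall w, 0 <= f w <= 1) -> (\int[P]_w (f w)%:E)%E = (Ex f)%:E.
Proof.
move=> mf f01; rewrite /Ex fineK// ge0_fin_numE; last first.
  by apply: integral_ge0 => x _; rewrite lee_fin; have /andP[] := f01 x.
apply: (@le_lt_trans _ _ (\int[P]_w (cst 1%E w))%E).
  apply: ge0_le_integral => //.
  - by move=> x _; rewrite lee_fin; have /andP[] := f01 x.
  - exact/measurable_EFinP.
  - by move=> x _; rewrite lee_fin; have /andP[] := f01 x.
by rewrite integral_cst// mul1e; apply: le_lt_trans (probability_le1 _ _) (ltry _).
Qed.

Lemma Ex_ge0 (f : Omega -> R) : (forall w, 0 <= f w) -> 0 <= Ex f.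
Proof.
by move=> f0; apply: fine_ge0; apply: integral_ge0 => x _; rewrite lee_fin.
Qed.

Lemma Ex_indic (A : set Omega) : measurable A -> Ex \1_A = fine (P A).
Proof. by move=> mA; rewrite /Ex integral_indic// setIT. Qed.

Lemma prod01 (I : Type) (J : seq I) (h : I -> R) :
  (forall i, 0 <= h i <= 1) -> 0 <= \prod_(i <- J) h i <= 1.
Proof.
move=> h01; elim: J => [|x J IH]; first by rewrite big_nil ler01 lexx.
rewrite big_cons; have /andP[a b] := h01 x; have /andP[c e] := IH.
by rewrite mulr_ge0//= mulr_ile1.
Qed.

Lemma measurable_bigcap_seq (I : eqType) (J : seq I) (A : I -> set Omega) :
  (forall i, measurable (A i)) ->
  measurable (\bigcap_(i in [set i | i \in J]) A i).
Proof.
move=> mA; elim: J => [|x J IH].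
  by rewrite (_ : \bigcap_(i in _) _ = setT)//; apply/seteqP; split.
rewrite (_ : \bigcap_(i in _) _ = A x `&` \bigcap_(i in [set i | i \in J]) A i).
  exact: measurableI.
apply/seteqP; split=> w h.
  split; first by apply: h; rewrite /= mem_head.
  by move=> i iJ; apply: h; rewrite /= inE iJ orbT.
move=> i /=; rewrite inE => /orP[/eqP ->|iJ]; first exact: h.1.
exact: h.2.
Qed.

Lemma prod_fin (I : Type) (J : seq I) (A : I -> set Omega) :
  (forall i, measurable (A i)) ->
  fine (\prod_(i <- J) P (A i))%E = \prod_(i <- J) fine (P (A i)).
Proof.
move=> mA; elim: J => [|i J IH]; first by rewrite !big_nil.
rewrite !big_cons fineM ?IH// ?fin_num_measure//.
by apply: prode_fin_num => j _; rewrite fin_num_measure.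
Qed.

Lemma indic_bigcap (I : eqType) (J : seq I) (A : I -> set Omega) w :
  \1_(\bigcap_(i in [set i | i \in J]) A i) w = \prod_(i <- J) \1_(A i) w :> R.
Proof.
rewrite indicE; have [h|h] := boolP (w \in _).
  rewrite big_seq big1// => i iJ; rewrite indicE mem_set//.
  by move: h; rewrite inE => /(_ _ iJ).
move/negP: h; rewrite inE => /existsNP[i /not_implyP[iJ nA]].
by rewrite (big_rem i)//= indicE memNset// mul0r.
Qed.

(* The factors are moved one at a time from [Phi] to [Psi], so the hypothesis is
   only ever needed for one coordinate against a fixed weight [V]. *)
Lemma product_rule_extend (I : eqType) (X : I -> Omega -> R)
  (Phi Psi : set (R -> R)) (f0 : R -> R) : Phi f0 ->
  (forall i, measurable_fun setT (X i)) ->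
  (forall f, Phi f \/ Psi f -> measurable_fun setT f /\
    forall i w, 0 <= f (X i w) <= 1) ->
  (forall i (V : Omega -> R) K, measurable_fun setT V ->
    (forall w, 0 <= V w <= 1) -> 0 <= K ->
    (forall f, Phi f -> Ex (fun w => f (X i w) * V w) = K * Ex (f \o X i)) ->
    forall f, Psi f -> Ex (fun w => f (X i w) * V w) = K * Ex (f \o X i)) ->
  (forall J (g : I -> R -> R), uniq J -> (forall i, Phi (g i)) ->
    Ex (fun w => \prod_(i <- J) g i (X i w)) = \prod_(i <- J) Ex (g i \o X i)) ->
  forall J (g : I -> R -> R), uniq J -> (forall i, Psi (g i)) ->
    Ex (fun w => \prod_(i <- J) g i (X i w)) = \prod_(i <- J) Ex (g i \o X i).
Proof.
move=> Pf0 mX cl step rule J g uJ Pg.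
suff main : forall J2 J1 (h : I -> R -> R), uniq (J1 ++ J2) ->
    (forall i, Phi (h i)) ->
    Ex (fun w => (\prod_(i <- J1) h i (X i w)) * \prod_(i <- J2) g i (X i w)) =
    (\prod_(i <- J1) Ex (h i \o X i)) * \prod_(i <- J2) Ex (g i \o X i).
  have := main J [::] (fun=> f0) uJ (fun=> Pf0).
  rewrite big_nil mul1r => <-; congr Ex; apply/funext => w.
  by rewrite big_nil mul1r.
elim=> [|x J2 IH] J1 h; rewrite ?cats0.
  move=> u Ph; rewrite big_nil mulr1 -rule//; congr Ex; apply/funext => w.
  by rewrite big_nil mulr1.
move=> u Ph.
have bh i w : 0 <= h i (X i w) <= 1 by apply: (cl (h i) _).2; left.
have bg i w : 0 <= g i (X i w) <= 1 by apply: (cl (g i) _).2; right.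
have mh i : measurable_fun setT (fun w => h i (X i w)).
  by apply: measurableT_comp => //; apply: (cl (h i) _).1; left.
have mg i : measurable_fun setT (fun w => g i (X i w)).
  by apply: measurableT_comp => //; apply: (cl (g i) _).1; right.
pose V w := (\prod_(i <- J1) h i (X i w)) * \prod_(i <- J2) g i (X i w).
pose K := (\prod_(i <- J1) Ex (h i \o X i)) * \prod_(i <- J2) Ex (g i \o X i).
transitivity (Ex (fun w => g x (X x w) * V w)).
  by congr Ex; apply/funext => w; rewrite /V big_cons mulrCA.
rewrite [in RHS]big_cons [RHS]mulrCA [RHS]mulrC.
apply: step => //.
- apply: measurable_funM; exact: measurable_prod.
- move=> w; have /andP[a b] := prod01 J1 (bh ^~ w).
  have /andP[a' b'] := prod01 J2 (bg ^~ w).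
  by rewrite mulr_ge0//= mulr_ile1.
- rewrite mulr_ge0//; apply: prodr_ge0 => i _; apply: Ex_ge0 => w /=.
  + by have /andP[] := bh i w.
  + by have /andP[] := bg i w.
move=> f Pf.
(* Coordinate [x] joins the [Phi] side with the test function [f], so the induction hypothesis for
   [x :: J1] is exactly the premise of [step] with weight [V] and constant [K]. *)
pose h' i := if i == x then f else h i.
have xJ1 : x \notin J1.
  by move: u; rewrite cat_uniq/= negb_or => /and3P[_ /andP[]].
have h'E (F : (R -> R) -> I -> R) :
    \prod_(i <- J1) F (h' i) i = \prod_(i <- J1) F (h i) i.
  apply: eq_big_seq => i iJ; rewrite /h'; case: eqP => // E.
  by move: xJ1; rewrite -E iJ.
have := IH (x :: J1) h'.
rewrite /= mem_cat negb_or xJ1/=.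
have -> : (x \notin J2) && uniq (J1 ++ J2).
  have : uniq ([:: x] ++ J1 ++ J2) by rewrite uniq_catCA.
  by rewrite /= mem_cat negb_or => /andP[/andP[_ ->] ->].
have Ph' i : Phi (h' i) by rewrite /h'; case: eqP.
move=> /(_ isT Ph') E.
transitivity (Ex (fun w =>
    \prod_(i <- x :: J1) h' i (X i w) * \prod_(i <- J2) g i (X i w))).
  congr Ex; apply/funext => w.
  by rewrite big_cons {1}/h' eqxx (h'E (fun f i => f (X i w))) mulrA.
rewrite E big_cons {1}/h' eqxx (h'E (fun f i => Ex (f \o X i))).
by rewrite -mulrA mulrC.
Qed.

(** For indicators the product rule is the independence of events; [integral_comp_factor] then
    replaces one indicator at a time by a bounded function. The bound is asked for along every [X j]
    because the class [Psi] does not depend on the coordinate. *)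
Lemma indep_product_rule (I : eqType) (X : I -> Omega -> R) (f : I -> R -> R)
  (J : seq I) :
  (forall i, measurable_fun setT (X i)) ->
  indep_events P (fun i => rv_events (X i)) ->
  (forall i, measurable_fun setT (f i)) ->
  (forall i x, 0 <= f i x) -> (forall i j w, f i (X j w) <= 1) ->
  uniq J ->
  Ex (fun w => \prod_(i <- J) f i (X i w)) = \prod_(i <- J) Ex (f i \o X i).
Proof.
move=> mX ind mf f0 f1 uJ.
have mpre i C : measurable C -> measurable (X i @^-1` C).
  by move=> mC; rewrite -[X in measurable X]setTI; exact: mX.
pose Psi (g : R -> R) := [/\ measurable_fun setT g, forall x, 0 <= g x &
  forall j w, g (X j w) <= 1].
pose Phi (g : R -> R) := exists2 C, measurable C & g = \1_C.
apply: (@product_rule_extend I X Phi Psi \1_setT) => //.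
- by exists setT.
- move=> g [[C mC ->]|[mg g0 g1]]; split => //.
  + by move=> i w; rewrite indicE; case: (_ \in _); rewrite ?lexx ?ler01.
  + by move=> i w; rewrite g0 g1.
- move=> i V K mV V01 K0 h g [mg g0 g1].
  have V0 w : 0 <= V w by have /andP[] := V01 w.
  have := @integral_comp_factor _ _ _ _ R P (X i) V K g (mX i) mV V0 K0 _ mg g0.
  rewrite !Ex_EFin.
  + rewrite -EFinM => H; apply: EFin_inj; apply: H => C mC.
    rewrite integral_indic_weight.
    have := h _ (ex_intro2 _ _ C mC erefl).
    rewrite [X in K * X](_ : _ = fine (P (X i @^-1` C))); last first.
      by rewrite -Ex_indic//; exact: mpre.
    move=> hC; have := congr1 EFin hC; rewrite -Ex_EFin.
    * by rewrite EFinM fineK// fin_num_measure//; exact: mpre.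
    * apply: measurable_funM => //; apply: measurableT_comp => //.
    * move=> w; rewrite indicE; case: (_ \in _); rewrite ?mul1r//.
      by rewrite mul0r lexx ler01.
  + by apply: measurableT_comp.
  + by move=> w /=; rewrite g0 g1.
  + by apply: measurable_funM => //; apply: measurableT_comp.
  + move=> w /=; have /andP[a b] := V01 w.
    by rewrite mulr_ge0//= mulr_ile1.
- move=> J' g uJ' PhiG.
  have /choice[C hC] : forall i, exists C, measurable C /\ g i = \1_C.
    by move=> i; have [C mC e] := PhiG i; exists C.
  have mC i : measurable (C i) by have [] := hC i.
  have gE i : g i = \1_(C i) by have [] := hC i.
  under eq_bigr do rewrite gE.
  rewrite (_ : (fun w => _) =
    \1_(\bigcap_(i in [set i | i \in J']) (X i @^-1` C i))); last first.
    by apply/funext => w; rewrite indic_bigcap; apply: eq_bigr => i _; rewrite gE.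
  rewrite Ex_indic; last first.
    apply: measurable_bigcap_seq => i; exact: mpre.
  rewrite ind//; last by move=> i _; exists (C i).
  rewrite prod_fin; last by move=> i; exact: mpre.
  by apply: eq_bigr => i _; rewrite -Ex_indic//; exact: mpre.
Qed.

Lemma indep_of_product_rule (I : eqType) (X : I -> Omega -> R) :
  (forall i, measurable_fun setT (X i)) ->
  (forall J (C : I -> set R), uniq J -> (forall i, measurable (C i)) ->
    Ex (fun w => \prod_(i <- J) \1_(C i) (X i w)) =
    \prod_(i <- J) Ex (\1_(C i) \o X i)) ->
  indep_events P (fun i => rv_events (X i)).
Proof.
move=> mX h J A uJ FA.
have mpre i C : measurable C -> measurable (X i @^-1` C).
  by move=> mC; rewrite -[X in measurable X]setTI; exact: mX.
have /choice[C hC] : forall i, exists C, measurable C /\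
    (i \in J -> X i @^-1` C = A i).
  move=> i; have [iJ|nJ] := boolP (i \in J).
    by have [C mC <-] := FA i iJ; exists C.
  by exists set0; split.
have mC i : measurable (C i) by have [] := hC i.
have CA i : i \in J -> X i @^-1` C i = A i by have [] := hC i.
rewrite (eq_bigcapr (G := fun i => X i @^-1` C i)); last by move=> i /CA.
rewrite (eq_big_seq (fun i => P (X i @^-1` C i))); last by move=> i /CA ->.
have mB : measurable (\bigcap_(i in [set i | i \in J]) (X i @^-1` C i)).
  apply: measurable_bigcap_seq => i; exact: mpre.
rewrite -[LHS]fineK ?fin_num_measure// -[RHS]fineK; last first.
  by apply: prode_fin_num => i _; rewrite fin_num_measure//; exact: mpre.
congr EFin; rewrite prod_fin -?Ex_indic//; last by move=> i; exact: mpre.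
have := h J C uJ mC.
rewrite (_ : (fun w => _) =
  \1_(\bigcap_(i in [set i | i \in J]) (X i @^-1` C i))); last first.
  by apply/funext => w; rewrite indic_bigcap; apply: eq_bigr => i _.
by move=> ->; apply: eq_bigr => i _; rewrite -Ex_indic//; exact: mpre.
Qed.

(** Here [Phi] holds the exponentials of integer rate and [Psi] the indicators. Against a weight
    [V], the measure with density [V] and the multiple [K] of [P] have the same transforms along
    [X i], hence agree on all preimages under [X i]. *)
Lemma laplace_indep (I : eqType) (X : I -> Omega -> R) :
  (forall i, measurable_fun setT (X i)) -> (forall i w, 0 <= X i w) ->
  (forall J (u : I -> nat), uniq J ->
    Ex (fun w => \prod_(i <- J) expR (- ((u i)%:R * X i w))) =
    \prod_(i <- J) Ex (fun w => expR (- ((u i)%:R * X i w)))) ->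
  indep_events P (fun i => rv_events (X i)).
Proof.
move=> mX X0 h; apply: indep_of_product_rule => // J C uJ mC.
pose Phi (g : R -> R) := exists u : nat, g = fun x => expR (- (u%:R * x)).
pose Psi (g : R -> R) := exists2 C, measurable C & g = \1_C.
have exp01 (u : nat) i w : 0 <= expR (- (u%:R * X i w)) <= 1.
  by rewrite expR_ge0/= -[leRHS]expR0 ler_expR oppr_le0 mulr_ge0.
have mexp (u : nat) : measurable_fun setT (fun x : R => expR (- (u%:R * x))).
  apply: measurableT_comp; first exact: measurable_expR.
  by apply: measurableT_comp => //; exact: measurable_funM.
have ind01 (D : set R) x : 0 <= (\1_D x : R) <= 1.
  by rewrite indicE; case: (_ \in _); rewrite ?lexx ?ler01.
apply: (@product_rule_extend I X Phi Psi (fun x => expR (- (0%:R * x)))) => //.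
- by exists 0%N.
- move=> g [[u ->]|[D mD ->]]; split => //.
- move=> i V K mV V01 K0 hV _ [D mD ->].
  have V0 w : 0 <= V w by have /andP[] := V01 w.
  have [nu [nuE nuI]] := density_measure P mV V0.
  have mD' : measurable (X i @^-1` D) by rewrite -[X in measurable X]setTI; exact: mX.
  have E : (nu (X i @^-1` D) = K%:E * P (X i @^-1` D))%E.
    apply: (@laplace_measure_unique _ _ R nu (mscale (NngNum K0) P) (X i)
      _ _ (mX i) (X0 i) _ D mD).
    + rewrite nuE//; apply: (@le_lt_trans _ _ 1%E); last exact: ltry.
      rewrite -[leRHS](probability_setT P) -[leRHS]mul1e -integral_cst//.
      apply: ge0_le_integral => //; first by move=> x _; rewrite lee_fin.
        exact/measurable_EFinP.
      by move=> x _; rewrite lee_fin; have /andP[] := V01 x.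
    + change (K%:E * P setT < +oo)%E.
      by rewrite probability_setT mule1 ltry.
    + move=> n; rewrite nuI//; last by apply: measurableT_comp (mexp n) (mX i).
      rewrite ge0_integral_mscale//; last first.
        by apply/measurable_EFinP; apply: measurableT_comp (mexp n) (mX i).
      rewrite Ex_EFin.
      * rewrite (hV (fun x => expR (- (n%:R * x)))); last by exists n.
        rewrite EFinM -Ex_EFin//; last by move=> w; exact: exp01.
        by apply: measurableT_comp (mexp n) (mX i).
      * by apply: measurable_funM => //; apply: measurableT_comp (mexp n) (mX i).
      * move=> w; have /andP[a b] := V01 w; have /andP[a' b'] := exp01 n i w.
        by rewrite mulr_ge0//= mulr_ile1.
  apply: EFin_inj; rewrite -[LHS]Ex_EFin.
  + rewrite -integral_indic_weight -nuE// E.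
    by rewrite EFinM Ex_indic// fineK// fin_num_measure.
  + apply: measurable_funM => //; apply: measurableT_comp => //.
  + move=> w; have /andP[a b] := V01 w; have /andP[a' b'] := ind01 D (X i w).
    by rewrite mulr_ge0//= mulr_ile1.
- move=> J' g uJ' /choice[u gE].
  have E i : g i \o X i = fun w => expR (- ((u i)%:R * X i w)).
    by apply/funext => w /=; rewrite gE.
  rewrite (eq_bigr (fun i => Ex (fun w => expR (- ((u i)%:R * X i w)))))//.
    by rewrite -h//; congr Ex; apply/funext => w; apply: eq_bigr => i _; rewrite gE.
  by move=> i _; rewrite E.
- by move=> i; exists (C i).
Qed.
End expectation.

(** * Discretisation from below and first passage *)

Section below.
Context (R : realType).
Implicit Types (u v : nat -> R) (x y : R).

(* Strictness is what makes [f (u m)] tend to the left limit of [f] at [x]; the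
   second alternative accounts for phases starting exactly at time 0. *)
Definition below u x := [/\ forall m, 0 <= u m,
  forall m, u m < x \/ (u m = 0 /\ x = 0) & u m @[m --> \oo] --> x].

Lemma below0 : below (fun=> 0) 0.
Proof. by split=> //; [right|exact: cvg_cst]. Qed.

Lemma belowD u v x y : below u x -> below v y -> below (fun m => u m + v m) (x + y).
Proof.
move=> [u0 ux cu] [v0 vy cv]; split; last exact: cvgD.
  by move=> m; rewrite addr_ge0.
move=> m; have [a|[-> ->]] := ux m; last by rewrite !add0r.
left; have [b|[-> ->]] := vy m; first exact: ltrD.
by rewrite !addr0.
Qed.

(** Serves the first phase of a customer, which starts at the maximum of an arrival time and the
    previous completion. *)
Lemma below_max u v x y : below u x -> below v y ->
  below (fun m => Num.max (u m) (v m)) (Num.max x y).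
Proof.
move=> [u0 ux cu] [v0 vy cv]; split.
- by move=> m; rewrite le_max u0.
- move=> m; have := u0 m; have := v0 m.
have [a|[-> ->]] := ux m; have [b|[-> ->]] := vy m => h1 h2.
  + by left; rewrite gt_max !lt_max a b/= orbT.
  + left; rewrite gt_max !lt_max a/=; apply/orP; left.
    exact: le_lt_trans a.
  + left; rewrite gt_max !lt_max b/= orbT andbT; apply/orP; right.
    exact: le_lt_trans b.
  + by right; rewrite maxxx.
- rewrite maxr_absE; under eq_fun do rewrite maxr_absE.
  apply: cvgMl; apply: cvgD; first exact: cvgD.
  by apply: cvg_norm; apply: cvgB.
Qed.

Lemma below_sum N (u : nat -> nat -> R) (x : nat -> R) :
  (forall i, below (u i) (x i)) ->
  below (fun m => \sum_(i < N) u i m) (\sum_(i < N) x i).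
Proof.
move=> h; elim: N => [|N IH].
  rewrite big_ord0 (_ : (fun m => _) = fun=> 0); first exact: below0.
  by apply/funext => m; rewrite big_ord0.
rewrite big_ord_recr (_ : (fun m => _) =
  fun m => \sum_(i < N) u i m + u N m); first exact: belowD.
by apply/funext => m; rewrite big_ord_recr.
Qed.

(* The largest grid index [n] with [n / m.+1 < x], for [x > 0]. *)
Definition grid_below (m : nat) (x : R) : nat :=
  `|Num.ceil (x * m.+1%:R)|%N.-1.

Lemma below_grid x : 0 < x -> below (fun m => (grid_below m x)%:R / m.+1%:R) x.
Proof.
move=> x0.
(* A ceiling [n] of [y] satisfies [n - 1 < y <= n], so its predecessor is strictly below [y], also
   when [y] is an integer; a floor would lose strictness there. *)
have key m : (grid_below m x)%:R < x * m.+1%:R <= (grid_below m x)%:R + 1.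
  have y0 : 0 < x * m.+1%:R by rewrite mulr_gt0.
  have /andP[c1 c2] := ceil_itv (x * m.+1%:R).
  have c0 : (0 < Num.ceil (x * m.+1%:R))%R by rewrite -(ltr_int R) (lt_le_trans y0).
  rewrite /grid_below; case: (Num.ceil _) c0 c1 c2 => [[|n]|n]//= _.
  move=> h1 h2.
  have e1 : ((n.+1%:Z - 1)%:~R : R) = n%:R by rewrite -addn1 PoszD addrK.
  have e2 : (n.+1%:Z%:~R : R) = n%:R + 1 by rewrite natr1.
  by rewrite -e2 h2 andbT -e1.
have lt m : (grid_below m x)%:R / m.+1%:R < x.
  by have /andP[h _] := key m; rewrite ltr_pdivrMr.
split=> [m|m|]; first by rewrite divr_ge0.
  by left.
apply: (@squeeze_cvgr _ _ _ _ (fun m => x - harmonic m) (cst x)).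
- near=> m; rewrite (ltW (lt m)) andbT lerBlDr.
  have /andP[_ h] := key m.
  by rewrite /harmonic/= -[X in _ + X]mul1r -mulrDl ler_pdivlMr.
- rewrite -[X in _ --> X]subr0; apply: cvgB; first exact: cvg_cst.
  exact: cvg_harmonic.
- exact: cvg_cst.
Unshelve. all: by end_near. Qed.

End below.

(** * The queue recursion in units of the mesh *)

Section grid_phases.
Variables (k n0 : nat).

Definition grid_arrival (a : nat -> nat) (j : nat) : nat :=
  if (j < n0)%N then 0%N else (\sum_(i < (j - n0).+1) a i)%N.

(** The recursion of [phase_start] rerun on rounded sources, rather than a rounding of [phase_start]
    itself: consecutive phases then remain disjoint on the grid. *)
Fixpoint grid_start (a p : nat -> nat) (n : nat) : nat :=
  match n with
  | 0 => grid_arrival a 0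
  | m.+1 => let c := (grid_start a p m + p m)%N in
      if (n %% k == 0)%N then maxn (grid_arrival a (n %/ k)) c else c
  end.

Lemma grid_startS a p n : (grid_start a p n + p n <= grid_start a p n.+1)%N.
Proof. by rewrite [grid_start a p n.+1]/=; case: ifP => // _; exact: leq_maxr. Qed.

(** Source of the disjointness of the sampled time intervals, on which the increments of [D] are
    independent. *)
Lemma grid_start_le a p i j : (i < j)%N ->
  (grid_start a p i + p i <= grid_start a p j)%N.
Proof.
elim: j => // j IH; rewrite ltnS leq_eqVlt => /orP[/eqP ->|/IH h].
  exact: grid_startS.
by apply: leq_trans h _; apply: leq_trans (grid_startS _ _ _); exact: leq_addr.
Qed.

(** Start [n] involves only arrivals of index at most [n %/ k <= n] and earlier phases, so finitely
    many rounded sources determine the first [N] starts. *)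
Lemma grid_start_eq a p a' p' n N : (n < N)%N ->
  (forall i, (i < N)%N -> a i = a' i) -> (forall i, (i < N)%N -> p i = p' i) ->
  grid_start a p n = grid_start a' p' n.
Proof.
move=> nN ea ep.
have arr j : (j <= n)%N -> grid_arrival a j = grid_arrival a' j.
  move=> jn; rewrite /grid_arrival; case: ifP => // _.
  apply: eq_bigr => i _; apply: ea; apply: leq_ltn_trans nN.
  by apply: leq_trans jn; apply: leq_trans (leq_subr n0 j); rewrite -ltnS.
elim: n nN arr => [|n IH] nN arr; first exact: arr.
rewrite /= IH//; last 2 first.
- exact: ltnW.
- by move=> j jn; apply: arr; exact: leqW.
rewrite ep ?arr//; last exact: ltnW.
exact: leq_div.
Qed.

Lemma below_start (R : realType) (Omega : Type) (Arr Ph : nat -> Omega -> R) n w :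
  (forall j, 0 < Arr j w) -> (forall j, 0 < Ph j w) ->
  below (fun m => (grid_start (fun i => grid_below m (Arr i w))
    (fun i => grid_below m (Ph i w)) n)%:R / m.+1%:R)
    (phase_start k n0 Arr Ph n w).
Proof.
move=> A0 P0.
have arr j : below (fun m => (grid_arrival (fun i => grid_below m (Arr i w)) j)%:R /
    m.+1%:R) (arrival_time n0 Arr j w).
  rewrite /grid_arrival /arrival_time; case: ifP => _.
    by under eq_fun do rewrite mul0r; exact: below0.
  under eq_fun do rewrite natr_sum mulr_suml.
  exact: (@below_sum R (j - n0).+1
    (fun i m => (grid_below m (Arr i w))%:R / m.+1%:R) (fun i => Arr i w)
    (fun i => below_grid (A0 i))).
elim: n => [|n IH]; first exact: arr.
have step : below (fun m => (grid_start (fun i => grid_below m (Arr i w))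
    (fun i => grid_below m (Ph i w)) n + grid_below m (Ph n w))%N%:R / m.+1%:R)
    (phase_start k n0 Arr Ph n w + Ph n w).
  under eq_fun do rewrite natrD mulrDl.
  by apply: belowD => //; exact: below_grid.
rewrite /=; case: ifP => // _.
have -> : (fun m => (maxn (grid_arrival (fun i => grid_below m (Arr i w)) (n.+1 %/ k))
   (grid_start (fun i => grid_below m (Arr i w))
    (fun i => grid_below m (Ph i w)) n + grid_below m (Ph n w)))%:R / m.+1%:R) =
  (fun m => Num.max ((grid_arrival (fun i => grid_below m (Arr i w)) (n.+1 %/ k))%:R / m.+1%:R)
    ((grid_start (fun i => grid_below m (Arr i w))
    (fun i => grid_below m (Ph i w)) n + grid_below m (Ph n w))%N%:R / m.+1%:R)) :> (nat -> R).
  apply/funext => m; rewrite -maxr_pMl ?invr_ge0//; congr (_ / _).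
  by rewrite natr_max.
exact: below_max.
Qed.

End grid_phases.

(** * Left limits and first passage of a nondecreasing function *)

Section left_limit.
Context (R : realType).
Variable f : R -> R.
Hypotheses (f0 : f 0 = 0) (fnd : forall x y, 0 <= x -> x <= y -> f x <= f y).

(** The alternative [y = 0] keeps the set nonempty at [a = 0], where the value becomes [f 0] instead
    of the supremum of the empty set. *)
Definition left_lim (a : R) : R := sup [set f y | y in [set y | 0 <= y /\ (y < a \/ y = 0)]].

Let has_sup_left a : 0 <= a ->
  has_sup [set f y | y in [set y | 0 <= y /\ (y < a \/ y = 0)]].
Proof.
move=> a0; split; first by exists (f 0); exists 0 => //; split => //; right.
by exists (f a) => _ [y [y0 ya] <-]; apply: fnd => //; case: ya => [/ltW|->].
Qed.

Lemma left_lim_ub a y : 0 <= a -> 0 <= y -> y < a \/ y = 0 -> f y <= left_lim a.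
Proof. by move=> a0 y0 ya; apply: (ub_le_sup (has_sup_left a0).2); exists y. Qed.

Lemma left_lim_cvg (u : nat -> R) a : 0 <= a -> below u a ->
  f (u m) @[m --> \oo] --> left_lim a.
Proof.
move=> a0 [u0 ua cu]; apply/cvgrPdist_lt => e e0.
have [_ [y [y0 ya] <-] hy] := sup_adherent e0 (has_sup_left a0).
have : \forall m \near \oo, y <= u m.
  case: ya => [ya|->]; last by apply: nearW => m; exact: u0.
  near=> m; apply: ltW; near: m; exact: (cvgr_gt a cu).
apply: filterS => m yu; rewrite ger0_norm ?subr_ge0; last first.
  apply: left_lim_ub => //; have [|[-> _]] := ua m; [by left|by right].
by rewrite ltrBlDr addrC -ltrBlDr; apply: lt_le_trans hy _; exact: fnd.
Unshelve. all: by end_near. Qed.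

Lemma left_lim_le a b : 0 <= a -> a <= b -> left_lim a <= left_lim b.
Proof.
move=> a0 ab; apply: ge_sup; first exact: (has_sup_left a0).1.
move=> _ [y [y0 ya] <-]; apply: left_lim_ub => //; first exact: le_trans ab.
by case: ya => [h|->]; [left; exact: lt_le_trans ab|right].
Qed.

Lemma left_lim_ge0 a : 0 <= a -> 0 <= left_lim a.
Proof. by move=> a0; rewrite -f0; apply: left_lim_ub => //; right. Qed.

Hypothesis funb : forall M, exists x, M < f x /\ 0 <= x.

(** Both sides assert some [x < a] with [t < f x]. The left limit enters because a jump of [f] at
    [a] itself cannot bring the passage time below [a]. *)
Lemma first_passage_lt t a : 0 <= t -> 0 <= a ->
  (inf [set x | 0 < x /\ t < f x] < a) = (t < left_lim a).
Proof.
move=> t0 a0.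
have pos x : 0 <= x -> t < f x -> 0 < x.
  move=> x0 tx; rewrite lt_neqAle x0 andbT; apply/eqP => e.
  by move: tx; rewrite -e f0 ltNge t0.
have hinf : has_inf [set x | 0 < x /\ t < f x].
  split; last by exists 0 => x [/ltW].
  by have [x [tx x0]] := funb t; exists x; split => //; exact: pos.
apply/idP/idP => [|h].
  move=> /(inf_lt hinf.1)[x [x0 tx] xa]; apply: lt_le_trans tx _.
  by apply: left_lim_ub => //; [exact: ltW|left].
have := h; rewrite /left_lim => /(sup_gt (has_sup_left a0).1)[_ [y [y0 ya] <-] ty].
have py := pos _ y0 ty.
apply: (@le_lt_trans _ _ y); first by apply: (ge_inf hinf.2); split.
by case: ya => // e; rewrite e ltxx in py.
Qed.

Lemma first_passage_measure s p : 0 <= s -> 0 < p ->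
  lebesgue_measure [set t : R | 0 <= t /\
    s <= inf [set x | 0 < x /\ t < f x] < s + p] =
  (left_lim (s + p) - left_lim s)%:E.
Proof.
move=> s0 p0.
have sp0 : 0 <= s + p by rewrite addr_ge0// ltW.
(* By [first_passage_lt] the two conditions on the passage time read
   [left_lim s <= t < left_lim (s + p)], and [0 <= t] follows from [0 <= left_lim s]. *)
rewrite (_ : [set t | _] = `[left_lim s, left_lim (s + p)[%classic).
  rewrite lebesgue_measure_itv/= lte_fin; case: ltP => [//|h].
  rewrite (_ : left_lim (s + p) = left_lim s) ?subrr//.
  by apply/eqP; rewrite eq_le h/= left_lim_le// lerDl ltW.
apply/seteqP; split=> t /=; rewrite in_itv/=.
  move=> [t0]; rewrite first_passage_lt// => /andP[h ->].
  by rewrite leNgt -first_passage_lt// -leNgt h.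
move=> /andP[h1 h2].
have t0 : 0 <= t by apply: le_trans h1; exact: left_lim_ge0.
by split=> //; rewrite first_passage_lt// h2 andbT leNgt first_passage_lt// -leNgt.
Qed.

End left_limit.

(** * The tempered subordinator *)

Lemma measurable_ceil_eq (R : realType) (m : nat) (z : int) :
  measurable [set x : R | Num.ceil (x * m.+1%:R) = z].
Proof.
rewrite (_ : [set x | _] = `](z - 1)%:~R / m.+1%:R, z%:~R / m.+1%:R]%classic).
  exact: measurable_itv.
apply/seteqP; split=> x /=; rewrite in_itv/= ltr_pdivrMr// ler_pdivlMr//.
  by move=> /eqP; rewrite ceil_eq.
by rewrite -ceil_eq => /eqP.
Qed.

Lemma measurable_grid_below (R : realType) (m c : nat) :
  measurable [set x : R | grid_below m x = c].
Proof.
pose C (z : int) := [set x : R | Num.ceil (x * m.+1%:R) = z].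
have mC z : measurable (C z) by exact: measurable_ceil_eq.
(* The equation [|z|.-1 = c] has the solutions [c + 1] and [- (c + 1)], and for [c = 0] also
   [z = 0], since the predecessor of 0 is 0. *)
rewrite (_ : [set x | _] = C c.+1%:Z `|` C (- c.+1%:Z) `|`
    (if c == 0%N then C 0 else set0)); last first.
  apply/seteqP; split=> x; rewrite /C /grid_below /=.
    have [z zE] : exists z, z = Num.ceil (x * m.+1%:R) by eexists.
    rewrite -zE; case: z zE => [[|n]|n] zE /= <- /=.
    - by right; exact/esym.
    - by left; left.
    - by left; right; rewrite NegzE.
  move=> [[->|->]//|]; by case: eqP => [-> /= ->|].
apply: measurableU; first exact: measurableU.
by case: eqP.
Qed.

Lemma eq_law_integral d (Omega : measurableType d) (R : realType)
  (P : {measure set Omega -> \bar R}) (X Y : Omega -> R) (f : R -> R) :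
  measurable_fun setT X -> measurable_fun setT Y ->
  (forall B, measurable B -> P (X @^-1` B) = P (Y @^-1` B)) ->
  measurable_fun setT f -> (forall x, 0 <= f x) ->
  (\int[P]_w (f (X w))%:E = \int[P]_w (f (Y w))%:E)%E.
Proof.
move=> mX mY XY mf f0.
have mE : measurable_fun setT (EFin \o f) by apply/measurable_EFinP.
have fE0 : {in setT, forall y, (0 <= (EFin \o f) y)%E}.
  by move=> y _; rewrite /= lee_fin.
rewrite -[LHS](ge0_integral_pushforward mX P measurableT mE fE0).
rewrite -[RHS](ge0_integral_pushforward mY P measurableT mE fE0).
by apply: eq_measure_integral => A mA _; exact: XY.
Qed.

Section subordinator.
Context d (Omega : measurableType d) (R : realType) (P : probability Omega R).
Variables (theta alpha : R) (D : R -> Omega -> R).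
Hypotheses (theta0 : 0 < theta) (alpha01 : 0 < alpha < 1).
Hypothesis hD : tempered_subordinator P theta alpha D.

Definition laplace_exponent (s : R) : R := (s + theta) `^ alpha - theta `^ alpha.
Local Notation phi := laplace_exponent.

Lemma laplace_exponent0 : phi 0 = 0.
Proof. by rewrite /phi add0r subrr. Qed.

Lemma laplace_exponent_ge0 s : 0 <= s -> 0 <= phi s.
Proof.
have /andP[a0 _] := alpha01.
by move=> s0; rewrite subr_ge0 ge0_ler_powR ?nnegrE ?lerDr ?addr_ge0// ltW.
Qed.

Lemma laplace_exponent_gt0 s : 0 < s -> 0 < phi s.
Proof.
have /andP[a0 _] := alpha01.
move=> s0; rewrite subr_gt0 gt0_ltr_powR ?nnegrE ?ltrDr ?addr_ge0//; exact: ltW.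
Qed.

Let mD x : 0 <= x -> measurable_fun setT (D x).
Proof. by have [h _] := hD; exact: h. Qed.

Lemma subordinator0 w : D 0 w = 0.
Proof. by have [_ [h _]] := hD. Qed.

Lemma subordinator_nd w x y : 0 <= x -> x <= y -> D x w <= D y w.
Proof. by have [_ [_ [h _]]] := hD; exact: h. Qed.

Section grid.
Variable m : nat.
Local Notation M := (m.+1%:R : R).

Definition grid_incr (n : nat) (w : Omega) : R := D (n.+1%:R / M) w - D (n%:R / M) w.

Lemma measurable_grid_incr n : measurable_fun setT (grid_incr n).
Proof. by apply: measurable_funB; apply: mD; rewrite divr_ge0. Qed.

Lemma grid_incr_ge0 n w : 0 <= grid_incr n w.
Proof.
by rewrite subr_ge0 subordinator_nd// ?divr_ge0// ler_pM2r ?invr_gt0// ler_nat.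
Qed.

Lemma indep_grid_incr : indep_events P (fun n => rv_events (grid_incr n)).
Proof.
have [_ [_ [_ [_ [h _]]]]] := hD.
apply: (h (fun n => n%:R / M)); first by rewrite mul0r.
by move=> n; rewrite ltr_pM2r ?invr_gt0// ltr_nat.
Qed.

Lemma laplace_grid_incr v n : 0 <= v ->
  Ex P (fun w => expR (- (v * grid_incr n w))) = expR (- (M^-1 * phi v)).
Proof.
move=> v0; have [_ [_ [_ [_ [_ [stat lap]]]]]] := hD.
rewrite /Ex; set I := (X in fine X); suff -> : I = (expR (- (M^-1 * phi v)))%:E by [].
have M0 : 0 <= M^-1 by rewrite invr_ge0.
rewrite /phi -lap// /I.
apply: (@eq_law_integral _ _ _ P (grid_incr n) (D M^-1) (fun x => expR (- (v * x)))).
- exact: measurable_grid_incr.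
- exact: mD.
- move=> B mB; rewrite -[RHS](stat (n%:R / M))//.
  congr (P _); apply/funext => w; rewrite /grid_incr /= -natr1 mulrDl mul1r//.
- apply: measurableT_comp; first exact: measurable_expR.
  by apply: measurableT_comp => //; exact: measurable_funM.
- by move=> x; exact: expR_ge0.
Qed.

Lemma grid_incr_sum (a p : nat) w :
  D ((a + p)%:R / M) w - D (a%:R / M) w = \sum_(a <= n < a + p) grid_incr n w.
Proof. by rewrite (telescope_sumr (fun n => D (n%:R / M) w))// leq_addr. Qed.

Lemma sum_indic_nat (L a b : nat) (g : nat -> R) : (b <= L)%N ->
  \sum_(n < L) ((a <= n < b)%N%:R * g n) = \sum_(a <= n < b) g n.
Proof.
move=> bL; rewrite (big_nat_widen _ _ _ _ _ bL) big_geq_mkord/= [RHS]big_mkcond/=.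
apply: eq_bigr => i _; rewrite andbC; case: (_ && _); by rewrite ?mul1r ?mul0r.
Qed.

(** The exponent is regrouped by grid cell: cell [n] carries the rate [v n], equal to [u i] if the
    cell lies in interval [i] and to 0 if it lies in none. Independence of the cell increments then
    gives one factor per cell. *)
Lemma laplace_grid_intervals (N : nat) (s p : nat -> nat) (u : nat -> R) :
  (forall i j, (i < j)%N -> (s i + p i <= s j)%N) -> (forall i, 0 <= u i) ->
  Ex P (fun w => \prod_(i < N)
    expR (- (u i * (D ((s i + p i)%:R / M) w - D ((s i)%:R / M) w)))) =
  \prod_(i < N) expR (- (phi (u i) * ((p i)%:R / M))).
Proof.
move=> disj u0.
pose L := (\sum_(i < N) (s i + p i))%N.
have iL (i : 'I_N) : (s i + p i <= L)%N by rewrite /L (bigD1 i)//= leq_addr.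
pose I i n := (s i <= n < s i + p i)%N.
pose v n := \sum_(i < N) ((I i n)%:R * u i).
have v0 n : 0 <= v n by apply: sumr_ge0 => i _; rewrite mulr_ge0.
(* Disjointness leaves at most one nonzero summand in [v n], so [phi], although not additive, passes
   through the sum; the empty case uses [phi 0 = 0]. *)
have phiv n : phi (v n) = \sum_(i < N) ((I i n)%:R * phi (u i)).
  have [/existsP[i0 Ii0]|/existsPn no] := boolP [exists i : 'I_N, I i n].
    have other (i : 'I_N) : i != i0 -> I i n = false.
      move=> ne; apply/negbTE/negP => /andP[a b]; case/andP: Ii0 => a' b'.
      have [lt|gt|e] := ltngtP i i0.
      - by have := leq_trans (disj _ _ lt) a'; rewrite leqNgt b.
      - by have := leq_trans (disj _ _ gt) a; rewrite leqNgt b'.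
      - by rewrite (val_inj e) eqxx in ne.
    rewrite /v (bigD1 i0)//= Ii0 mul1r big1 ?addr0; last first.
      by move=> i /other ->; rewrite mul0r.
    rewrite [RHS](bigD1 i0)//= Ii0 mul1r big1 ?addr0//.
    by move=> i /other ->; rewrite mul0r.
  rewrite /v !big1 ?laplace_exponent0// => i _; by rewrite (negbTE (no i)) mul0r.
(* The truncation [Num.max 0 x] changes nothing on the nonnegative increments and bounds each test
   function by 1 on the whole line. *)
transitivity (Ex P (fun w => \prod_(n <- iota 0 L)
    (fun x => expR (- (v n * Num.max 0 x))) (grid_incr n w))).
  congr Ex; apply/funext => w.
  rewrite -!expR_sum; congr expR; rewrite !sumrN; congr (- _).
  under eq_bigr => i _.
    rewrite grid_incr_sum -(@sum_indic_nat L _ _ _ (iL i)) mulr_sumr.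
  over.
  rewrite exchange_big/=.
  rewrite -[in RHS](subn0 L) -/(index_iota 0 L) big_mkord.
  apply: eq_bigr => n _; rewrite max_r ?grid_incr_ge0// /v mulr_suml.
  by apply: eq_bigr => i _; rewrite mulrCA mulrA.
rewrite (@indep_product_rule _ _ _ P _ grid_incr
  (fun n x => expR (- (v n * Num.max 0 x)))).
- rewrite -[X in iota 0 X](subn0 L) -/(index_iota 0 L) big_mkord.
  transitivity (\prod_(n < L) expR (- (M^-1 * phi (v n)))).
    apply: eq_bigr => n _; rewrite -(laplace_grid_incr n)//; congr Ex.
    by apply/funext => w /=; rewrite max_r ?grid_incr_ge0.
  rewrite -!expR_sum; congr expR; rewrite !sumrN; congr (- _).
  rewrite -mulr_sumr; under eq_bigr do rewrite phiv.
  rewrite exchange_big/= mulr_sumr; apply: eq_bigr => i _.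
  rewrite (@sum_indic_nat L _ _ (fun=> phi (u i)) (iL i)).
  by rewrite big_const_nat iter_addr_0 addKn -[_ *+ p i]mulr_natr mulrC -mulrA.
- exact: measurable_grid_incr.
- exact: indep_grid_incr.
- move=> n; apply: measurableT_comp; first exact: measurable_expR.
  apply: measurableT_comp => //; apply: measurable_funM => //.
  exact: measurable_maxr.
- by move=> n x; exact: expR_ge0.
- move=> n j w; rewrite -[leRHS]expR0 ler_expR oppr_le0 mulr_ge0//.
  by rewrite le_max lexx.
- exact: iota_uniq.
Qed.

End grid.

(** Exponential Markov inequality at rate 1: [P (D n <= M) <= e^M e^(- n phi 1)], which tends to 0
    as [phi 1 > 0]. So the path stays below [M] with probability 0, for each natural [M]. *)
Lemma subordinator_unbounded :
  {ae P, forall w, forall M, exists x, M < D x w /\ 0 <= x}.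
Proof.
have bnd (M n : nat) : (P [set w | (D n%:R w <= M%:R)%R] <=
    (expR M%:R * expR (- (n%:R * phi 1)))%R%:E)%E.
  have [_ [_ [_ [_ [_ [_ lap]]]]]] := hD.
  have mA : measurable [set w | D n%:R w <= M%:R].
    rewrite -[X in measurable X]setTI.
    by apply: (mD (ler0n _ n) measurableT (measurable_itv `]-oo, M%:R])).
  rewrite EFinM -(lap 1)// -ge0_integralZl//; last first.
    apply/measurable_EFinP; apply: measurableT_comp; first exact: measurable_expR.
    by apply: measurableT_comp => //; apply: measurable_funM => //; exact: mD.
  rewrite -[leLHS]mul1e -integral_cst// integral_mkcond.
  apply: ge0_le_integral => //.
  - by move=> w _; rewrite patchE; case: ifP.
  - by apply/(measurable_restrictT _ mA); exact: measurable_cst.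
  - apply/measurable_EFinP; apply: measurable_funM => //.
    apply: measurableT_comp; first exact: measurable_expR.
    by apply: measurableT_comp => //; apply: measurable_funM => //; exact: mD.
  - move=> w _; rewrite patchE; case: ifPn => [|_]; last first.
      by rewrite lee_fin mulr_ge0// expR_ge0.
    rewrite inE /= => h; rewrite lee_fin -expRD -[leLHS]expR0 ler_expR.
    by rewrite mul1r subr_ge0.
have main (M : nat) : {ae P, forall w, exists n : nat, M%:R < D n%:R w}.
  pose A := \bigcap_n [set w | D n%:R w <= M%:R].
  have mA : measurable A.
    apply: bigcapT_measurable => n; rewrite -[X in measurable X]setTI.
    by apply: (mD (ler0n _ n) measurableT (measurable_itv `]-oo, M%:R])).
  exists A; split => //; last first.
    move=> w /= h n _ /=; rewrite leNgt; apply/negP => h'; apply: h; by exists n.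
  apply/eqP; rewrite eq_le measure_ge0 andbT.
  apply/lee_addgt0Pr => e e0; rewrite add0e.
  have phi1 := laplace_exponent_gt0 (ltr01 : 0 < 1 :> R).
  have [n hn] : exists n : nat, expR M%:R * expR (- (n%:R * phi 1)) <= e.
    (* From [e^(n phi 1) >= 1 + n phi 1], any [n] above [e^M / (e phi 1)] brings the bound under
       [e]. *)
    exists (Num.bound (expR M%:R / (e * phi 1))).
    set n := Num.bound _.
    have hb : expR M%:R / (e * phi 1) < n%:R.
      by apply: archi_boundP; rewrite divr_ge0 ?expR_ge0// mulr_ge0// ltW.
    rewrite expRN ler_pdivrMr ?expR_gt0//.
    rewrite ltr_pdivrMr ?mulr_gt0// in hb.
    apply: le_trans (ltW hb) _; rewrite mulrCA ler_wpM2l ?ltW//.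
    by apply: lt_le_trans (expR_ge1Dx _); rewrite ltrDr.
  apply: (@le_trans _ _ (P [set w | D n%:R w <= M%:R])).
    apply: le_measure; rewrite ?inE//; last by move=> w /(_ n I).
    rewrite -[X in measurable X]setTI.
    by apply: (mD (ler0n _ n) measurableT (measurable_itv `]-oo, M%:R])).
  by apply: le_trans (bnd M n) _; rewrite lee_fin.
have : {ae P, forall w, forall M : nat, exists n : nat, M%:R < D n%:R w}.
  by apply: ae_foralln.
apply: filterS => w h M; have [n hn] := h (Num.bound `|M|).
exists n%:R; split => //; apply: le_lt_trans hn; apply: ltW.
by apply: le_lt_trans (archi_boundP (normr_ge0 M)); exact: ler_norm.
Qed.

End subordinator.

(** * Joint Laplace transform of the inter-phase times *)

Section independence_from_sources.
Context d (Omega : measurableType d) (R : realType) (P : probability Omega R).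

(** Instance of [integral_comp_factor] with weight the indicator of [A] and [K = P A]. The test
    function is the absolute value, nonnegative on the whole line and equal to the identity on the
    values of [W]. *)
Lemma Ex_indic_indep (A : set Omega) (W : Omega -> R) :
  measurable A -> measurable_fun setT W -> (forall w, 0 <= W w <= 1) ->
  (forall C, measurable C -> P (A `&` W @^-1` C) = (P A * P (W @^-1` C))%E) ->
  (\int[P]_(w in A) (W w)%:E = P A * \int[P]_w (W w)%:E)%E.
Proof.
move=> mA mW W01 h.
have normW w : `|W w| = W w by rewrite ger0_norm//; have /andP[] := W01 w.
have PA : P A = (fine (P A))%:E by rewrite fineK// fin_num_measure.
have E : (\int[P]_w (`|W w| * \1_A w)%R%:E =
    (fine (P A))%:E * \int[P]_w (`|W w|)%R%:E)%E.
  apply: (integral_comp_factor mW _ _ _ _ _ (fun x => normr_ge0 x)) => //.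
  - exact: fine_ge0.
  - move=> C mC; rewrite -PA integral_indic//; first exact: h.
    by rewrite -[X in measurable X]setTI; exact: mW.
rewrite [LHS]integral_indic_weight PA.
rewrite (_ : (\int[P]_w (W w)%:E = \int[P]_w (`|W w|)%R%:E)%E).
  by rewrite -E; apply: eq_integral => w _; rewrite normW mulrC.
by apply: eq_integral => w _; rewrite normW.
Qed.

Lemma indep_events_sub (I I' : eqType) (h : I' -> I)
  (F : I -> set (set Omega)) : injective h ->
  indep_events P F -> indep_events P (F \o h).
Proof.
move=> hi ind J A uJ FA.
have [inv invK] : exists inv : I -> option I', forall i, inv (h i) = Some i.
  have /choice[inv hinv] : forall i, exists o : option I', forall j, h j = i -> o = Some j.
    move=> i; have [[j ji]|no] := pselect (exists j, h j = i).
      by exists (Some j) => j' ji'; congr Some; apply: hi; rewrite ji.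
    by exists None => j ji; exfalso; apply: no; exists j.
  by exists inv => i; exact: hinv.
pose A' i := if inv i is Some j then A j else setT.
have A'h i : A' (h i) = A i by rewrite /A' invK.
have := ind [seq h i | i <- J] A'.
rewrite big_map (eq_bigr (fun i => P (A i))); last by move=> i _; rewrite A'h.
move=> <-; last 2 first.
- by rewrite map_inj_uniq.
- by move=> _ /mapP[j jJ ->]; rewrite A'h; exact: FA.
congr (P _); apply/seteqP; split=> w hw i /=.
  by move=> /mapP[j jJ ->]; rewrite A'h; exact: hw.
by move=> iJ; rewrite -A'h; apply: hw; apply/mapP; exists i.
Qed.

End independence_from_sources.

Section tempered_queue.
Context d (Omega : measurableType d) (R : realType) (P : probability Omega R).
Variables (k n0 : nat) (theta alpha : R).
Variables (Arr Ph : nat -> Omega -> R) (D : R -> Omega -> R).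
Hypotheses (theta0 : 0 < theta) (alpha01 : 0 < alpha < 1).
Hypotheses (mArr : forall j, measurable_fun setT (Arr j))
  (mPh : forall n, measurable_fun setT (Ph n)).
Hypothesis hD : tempered_subordinator P theta alpha D.
Hypothesis ind : indep_events P (fun i : src =>
  match i with
  | SArr j => rv_events (Arr j)
  | SPh n => rv_events (Ph n)
  | SSub => proc_events D
  end).
Local Notation phi := (laplace_exponent theta alpha).

Let mD x : 0 <= x -> measurable_fun setT (D x).
Proof. by have [h _] := hD; exact: h. Qed.

(** The value at [SSub] is a placeholder: a whole process is no real variable, and [SSub] does not
    occur in [queue_sources]. *)
Definition source (i : src) : Omega -> R :=
  match i with SArr j => Arr j | SPh n => Ph n | SSub => fun=> 0 end.

Let msource i : measurable_fun setT (source i).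
Proof. by case: i => [j|n|] /=. Qed.

Section discretized.
Variables (m N : nat) (u : nat -> R).
Hypothesis u0 : forall i, 0 <= u i.
Local Notation M := (m.+1%:R : R).

Definition queue_sources : seq src :=
  [seq SArr i | i <- iota 0 N] ++ [seq SPh i | i <- iota 0 N].

Definition same_cell (w0 : Omega) : set Omega :=
  \bigcap_(i in [set i | i \in queue_sources])
    [set w | grid_below m (source i w) = grid_below m (source i w0)].

Let gstart (w : Omega) (n : nat) : nat :=
  grid_start k n0 (fun i => grid_below m (Arr i w))
    (fun i => grid_below m (Ph i w)) n.
Let gph (w : Omega) (n : nat) : nat := grid_below m (Ph n w).

(** The point [w0] supplies the grid positions and [w] the path of [D]. For fixed [w0] the sampling
    times are deterministic; the diagonal [w0 = w] is the quantity of interest. *)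
Definition laplace_sample (w0 w : Omega) : R := \prod_(i < N)
  expR (- (u i * (D ((gstart w0 i + gph w0 i)%:R / M) w - D ((gstart w0 i)%:R / M) w))).

Let mcell i w0 :
  measurable [set w | grid_below m (source i w) = grid_below m (source i w0)].
Proof.
have := msource i measurableT (@measurable_grid_below R m (grid_below m (source i w0))).
by rewrite setTI.
Qed.

Let m_same_cell w0 : measurable (same_cell w0).
Proof. by apply: measurable_bigcap_seq => i; exact: mcell. Qed.

Let same_cellP w0 w : same_cell w0 w ->
  forall i, (i < N)%N -> grid_below m (Arr i w) = grid_below m (Arr i w0) /\
    grid_below m (Ph i w) = grid_below m (Ph i w0).
Proof.
move=> h i iN; split.
  apply: (h (SArr i)); rewrite /= mem_cat; apply/orP; left.
  by apply/mapP; exists i; rewrite ?mem_iota.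
apply: (h (SPh i)); rewrite /= mem_cat; apply/orP; right.
by apply/mapP; exists i; rewrite ?mem_iota.
Qed.

(** Independence at [SSub] covers only events generated by [D], so measurability is shown for that
    smaller sigma-algebra, by regarding [Omega] as equipped with it. *)
Lemma measurable_laplace_sample_proc w0 (C : set R) : measurable C ->
  proc_events D (laplace_sample w0 @^-1` C).
Proof.
move=> mC.
pose G := \bigcup_(x in [set x : R | 0 <= x]) rv_events (D x).
have mDG x : 0 <= x ->
    measurable_fun (setT : set (g_sigma_algebraType G)) (D x : g_sigma_algebraType G -> R).
  move=> x0 _ B mB; rewrite setTI; apply: sub_sigma_algebra.
  by exists x => //; exists B.
have : measurable_fun (setT : set (g_sigma_algebraType G))
    (laplace_sample w0 : g_sigma_algebraType G -> R).
  apply: measurable_prod => i _.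
  apply: measurableT_comp; first exact: measurable_expR.
  apply: measurableT_comp => //; apply: measurable_funM => //.
  by apply: measurable_funB; apply: mDG; rewrite divr_ge0.
by move=> /(_ measurableT _ mC); rewrite setTI.
Qed.

Let m_laplace_sample w0 : measurable_fun setT (laplace_sample w0).
Proof.
apply: measurable_prod => i _.
apply: measurableT_comp; first exact: measurable_expR.
apply: measurableT_comp => //; apply: measurable_funM => //.
by apply: measurable_funB; apply: mD; rewrite divr_ge0.
Qed.

Let laplace_sample01 w0 w : 0 <= laplace_sample w0 w <= 1.
Proof.
apply: prod01 => i; rewrite expR_ge0/= -[leRHS]expR0 ler_expR oppr_le0 mulr_ge0//.
rewrite subr_ge0 (subordinator_nd hD)// ?divr_ge0//.
by rewrite ler_pM2r ?invr_gt0// ler_nat leq_addr.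
Qed.

Lemma same_cell_indep w0 (C : set R) : measurable C ->
  P (same_cell w0 `&` laplace_sample w0 @^-1` C) =
  (P (same_cell w0) * P (laplace_sample w0 @^-1` C))%E.
Proof.
move=> mC.
pose B : src -> set Omega := fun i => if i is SSub then laplace_sample w0 @^-1` C
  else [set w | grid_below m (source i w) = grid_below m (source i w0)].
have uJ : uniq queue_sources.
  rewrite cat_uniq !map_inj_uniq ?iota_uniq/=; last 2 first.
  - by move=> a b [].
  - by move=> a b [].
  by rewrite andbT; apply/hasPn => _ /mapP[j _ ->]; apply/negP => /mapP[].
have subJ : SSub \notin queue_sources.
  by rewrite mem_cat; apply/negP => /orP[] /mapP[].
have BJ i : i \in queue_sources ->
    B i = [set w | grid_below m (source i w) = grid_below m (source i w0)].
  by case: i subJ => // /negP.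
have FB i : match i with
    | SArr j => rv_events (Arr j)
    | SPh n => rv_events (Ph n)
    | SSub => proc_events D end (B i).
  case: i => [j|n|].
  - exists [set x | grid_below m x = grid_below m (Arr j w0)] => //.
    exact: measurable_grid_below.
  - exists [set x | grid_below m x = grid_below m (Ph n w0)] => //.
    exact: measurable_grid_below.
  - exact: measurable_laplace_sample_proc.
have e1 : same_cell w0 = \bigcap_(i in [set i | i \in queue_sources]) B i.
  by apply: eq_bigcapr => i /BJ.
have e2 : same_cell w0 `&` laplace_sample w0 @^-1` C =
    \bigcap_(i in [set i | i \in SSub :: queue_sources]) B i.
  rewrite e1; apply/seteqP; split=> w.
    by move=> [h1 h2] i /=; rewrite inE => /orP[/eqP ->//|]; exact: h1.
  move=> h; split=> [i iJ|]; first by apply: h; rewrite /= inE iJ orbT.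
  by apply: (h SSub); rewrite /= mem_head.
have r1 : P (same_cell w0) = (\prod_(i <- queue_sources) P (B i))%E.
  by rewrite e1; apply: ind => // i _; exact: FB.
rewrite e2 r1 muleC -[RHS](big_cons _ _ SSub queue_sources xpredT (fun i => P (B i))).
by apply: ind => [|i _]; [rewrite /= subJ uJ|exact: FB].
Qed.

(* On each cell of sample paths with the same discretised sources, the sampled
   product is independent of the cell and has the transform of a product of
   independent increments. *)
Lemma laplace_discretized :
  [/\ measurable_fun setT (fun w => laplace_sample w w),
    measurable_fun setT
      (fun w => \prod_(i < N) expR (- (phi (u i) * ((gph w i)%:R / M)))) &
    Ex P (fun w => laplace_sample w w) =
    Ex P (fun w => \prod_(i < N) expR (- (phi (u i) * ((gph w i)%:R / M))))].
Proof.
(* The rounded sources form a finite word of naturals, so their codes split [Omega] into countably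
   many cells and the integral becomes a series. *)
pose Z w : seq nat := [seq grid_below m (source i w) | i <- queue_sources].
pose F n := [set w | pickle (Z w) = n].
have FE w0 : F (pickle (Z w0)) = same_cell w0.
  apply/seteqP; split=> w; rewrite /F /=.
    move=> /(pcan_inj pickleK) e i iJ.
    by move/eq_in_map : e => /(_ i iJ).
  by move=> h; congr pickle; apply/eq_in_map => i /h.
have Fcase n : F n = set0 \/ exists2 w0, F n w0 & F n = same_cell w0.
  have [e|/set0P[w0 Fw0]] := eqVneq (F n) set0; first by left.
  by right; exists w0 => //; rewrite -Fw0 FE.
have mF n : measurable (F n) by case: (Fcase n) => [->|[w0 _ ->]].
have FU : \bigcup_n F n = setT.
  by apply/seteqP; split=> // w _; exists (pickle (Z w)).
pose h1 w := laplace_sample w w.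
pose h2 w := \prod_(i < N) expR (- (phi (u i) * ((gph w i)%:R / M))).
have h1E w0 w : same_cell w0 w -> h1 w = laplace_sample w0 w.
  move=> /same_cellP e; apply: eq_bigr => i _.
  have [_ ep] := e i (ltn_ord i).
  rewrite /gph ep /gstart (@grid_start_eq k n0 _ _ (fun i => grid_below m (Arr i w0))
    (fun i => grid_below m (Ph i w0)) i N)// => j /e[].
    by move=> ->.
  by move=> _ ->.
have h2E w0 w : same_cell w0 w -> h2 w = h2 w0.
  move=> /same_cellP e; apply: eq_bigr => i _.
  by have [_ ep] := e i (ltn_ord i); rewrite /gph ep.
have h10 w : 0 <= h1 w by have /andP[] := laplace_sample01 w w.
have h20 w : 0 <= h2 w by apply: prodr_ge0 => i _; exact: expR_ge0.
have mh1 : measurable_fun setT h1.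
  rewrite -FU; apply/(measurable_fun_bigcup _ mF) => n.
  case: (Fcase n) => [->|[w0 _ ->]]; first exact: measurable_fun_set0.
  apply: (@eq_measurable_fun _ _ _ _ _ (laplace_sample w0)).
    by move=> w /[!inE] /h1E.
  exact/measurable_funTS.
have mh2 : measurable_fun setT h2.
  rewrite -FU; apply/(measurable_fun_bigcup _ mF) => n.
  case: (Fcase n) => [->|[w0 _ ->]]; first exact: measurable_fun_set0.
  apply: (@eq_measurable_fun _ _ _ _ _ (cst (h2 w0))).
    by move=> w /[!inE] /h2E.
  exact: measurable_cst.
have part (h : Omega -> R) : measurable_fun setT h -> (forall w, 0 <= h w) ->
    (\int[P]_w (h w)%:E = \sum_(n <oo) \int[P]_(w in F n) (h w)%:E)%E.
  move=> mh h0; rewrite -FU ge0_integral_bigcup//.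
  - by rewrite FU; exact/measurable_EFinP.
  - by move=> w _; rewrite lee_fin.
  - by apply/trivIsetP => i j _ _ ij; apply/seteqP; split=> // w [ei ej]; rewrite -ei -ej eqxx in ij.
have IE : (\int[P]_w (h1 w)%:E = \int[P]_w (h2 w)%:E)%E.
  rewrite (part _ mh1 h10) (part _ mh2 h20); apply: eq_eseriesr => n _.
  case: (Fcase n) => [->|[w0 _ ->]]; first by rewrite !integral_set0.
  rewrite (eq_integral (fun w => (laplace_sample w0 w)%:E)); last first.
    by move=> w /[!inE] /h1E ->.
  rewrite (Ex_indic_indep (m_same_cell w0) (m_laplace_sample w0))//; last first.
    exact: same_cell_indep.
  rewrite Ex_EFin// /laplace_sample (laplace_grid_intervals hD)//; last first.
    by move=> i j ij; exact: grid_start_le.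
  rewrite (eq_integral (fun w => (cst (h2 w0)%:E) w)); last first.
    by move=> w /[!inE] /h2E ->.
  by rewrite integral_cst// muleC.
split; [exact: mh1|exact: mh2|exact: (congr1 fine IE)].
Qed.

End discretized.

Lemma measurable_arrival_time j : measurable_fun setT (arrival_time n0 Arr j).
Proof.
have [h|h] := boolP (j < n0)%N.
  rewrite (_ : arrival_time n0 Arr j = cst 0); first exact: measurable_cst.
  by apply/funext => w; rewrite /arrival_time h.
rewrite (_ : arrival_time n0 Arr j = fun w => \sum_(i < (j - n0).+1) Arr i w).
  by apply: measurable_sum => i; exact: mArr.
by apply/funext => w; rewrite /arrival_time (negbTE h).
Qed.

Lemma measurable_phase_start n : measurable_fun setT (phase_start k n0 Arr Ph n).
Proof.
elim: n => [|n IH]; first exact: measurable_arrival_time.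
have mS : measurable_fun setT (fun w => phase_start k n0 Arr Ph n w + Ph n w).
  exact: measurable_funD.
have [h|h] := boolP (n.+1 %% k == 0)%N.
  rewrite (_ : phase_start k n0 Arr Ph n.+1 = fun w => Num.max
    (arrival_time n0 Arr (n.+1 %/ k) w) (phase_start k n0 Arr Ph n w + Ph n w)).
    by apply: measurable_maxr => //; exact: measurable_arrival_time.
  by apply/funext => w /=; rewrite h.
rewrite (_ : phase_start k n0 Arr Ph n.+1 =
  fun w => phase_start k n0 Arr Ph n w + Ph n w)//.
by apply/funext => w /=; rewrite (negbTE h).
Qed.

Lemma inv_sub_ge0 t w : 0 <= inv_sub D t w.
Proof.
rewrite /inv_sub; set S := [set x | _].
have [->|/set0P S0] := eqVneq S set0; first by rewrite inf0.
by apply: lb_le_inf => // x [/ltW].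
Qed.

(* The second alternative is the junk value [inf set0 = 0] on the null event
   where the subordinator stays below [t]. *)
Lemma inv_sub_ltP t w a : 0 < a ->
  inv_sub D t w < a <->
  (exists q : rat, (0 < (ratr q : R) < a) /\ t < D (ratr q) w) \/
  (forall n : nat, D n%:R w <= t).
Proof.
move=> a0; rewrite /inv_sub; set S := [set x | _].
have Slb : has_lbound S by exists 0 => x [/ltW].
split=> [|[[q [/andP[q0 qa] tq]]|h]].
- have [S0 _|/set0P S0] := eqVneq S set0.
    right=> n; rewrite leNgt; apply/negP => tn.
    have : S n.+1%:R.
      split => //; apply: lt_le_trans tn _; apply: (subordinator_nd hD) => //.
      by rewrite ler_nat.
    by rewrite S0.
  move=> /(inf_lt S0)[x [x0 tx] xa]; left.
  have [q] := rat_in_itvoo xa; rewrite in_itv/= => /andP[xq qa].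
  exists q; rewrite qa (lt_trans x0 xq); split => //.
  by apply: lt_le_trans tx _; apply: (subordinator_nd hD); exact: ltW.
- by apply: le_lt_trans qa; apply: (ge_inf Slb).
- rewrite (_ : S = set0) ?inf0//; apply/seteqP; split=> // x [x0 tx].
  have := h (Num.bound x); rewrite leNgt => /negP; apply.
  apply: lt_le_trans tx _; apply: (subordinator_nd hD); first exact: ltW.
  by apply: ltW; apply: archi_boundP; exact: ltW.
Qed.

(** Joint measurability in path and time is what the measure of a section requires. Monotonicity of
    [D] lets rational levels decide whether the infimum is below [a], so countable unions and
    intersections suffice. *)
Lemma measurable_inv_sub :
  measurable_fun setT (fun z : Omega * R => inv_sub D z.2 z.1).
Proof.
have mlt (q : R) : 0 <= q -> measurable [set z : Omega * R | z.2 < D q z.1].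
  move=> q0.
  have mf : measurable_fun setT (fun z : Omega * R => D q z.1 - z.2).
    apply: measurable_funB; last exact: measurable_snd.
    exact: (measurableT_comp (mD q0) measurable_fst).
  have := mf measurableT _ (measurable_itv `]0, +oo[); rewrite setTI.
  congr measurable; apply/seteqP; split=> z; rewrite /= in_itv/= andbT subr_gt0//.
move=> mT; apply: (measurability _ (RGenInftyO.measurableE R)) => //.
move=> /= _ [_ [a ->] <-]; apply: measurableI => //.
have [a0|a0] := leP a 0.
  rewrite (_ : _ @^-1` _ = set0)//; apply/seteqP; split=> // z.
  by rewrite /= in_itv/= => /lt_le_trans/(_ a0); rewrite ltNge inv_sub_ge0.
pose A (q : rat) : set (Omega * R) := if 0 < (ratr q : R) < a
  then [set z | z.2 < D (ratr q) z.1] else set0.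
rewrite (_ : _ @^-1` _ = (\bigcup_q A q) `|`
    \bigcap_n [set z : Omega * R | D n%:R z.1 <= z.2]); last first.
  apply/seteqP; split=> z.
    rewrite /= in_itv/= => /(inv_sub_ltP _ _ a0)[[q [q0 h]]|h].
      by left; exists q => //; rewrite /A q0.
    by right=> n _; exact: h.
  move=> h; rewrite /= in_itv/=; apply/(inv_sub_ltP _ _ a0); case: h => [[q _]|h].
    by rewrite /A; case: ifP => // q0 h; left; exists q.
  by right=> n; exact: h.
apply: measurableU.
  apply: countable_bigcupT_measurable; first exact: countableP.
  move=> q; rewrite /A; case: ifP => // /andP[q0 _]; apply: mlt; exact: ltW.
apply: bigcapT_measurable => n.
rewrite (_ : [set z | _] = ~` [set z : Omega * R | z.2 < D n%:R z.1]).
  by apply: measurableC; exact: mlt.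
apply/seteqP; split=> z /=; first by rewrite leNgt => /negP.
by move=> /negP; rewrite -leNgt.
Qed.

(** The inter-phase time is the Lebesgue measure of the section at [w] of a measurable subset of
    [Omega * R]. *)
Lemma measurable_inter_phase n :
  measurable_fun setT (inter_phase k n0 Arr Ph D n).
Proof.
pose s (z : Omega * R) := phase_start k n0 Arr Ph n z.1.
pose Y (z : Omega * R) := inv_sub D z.2 z.1.
have ms : measurable_fun setT s.
  exact: (measurableT_comp (measurable_phase_start n) measurable_fst).
have mp : measurable_fun setT (fun z : Omega * R => Ph n z.1).
  exact: (measurableT_comp (mPh n) measurable_fst).
have mY : measurable_fun setT Y by exact: measurable_inv_sub.
pose A := [set z : Omega * R | [/\ 0 <= z.2, s z <= Y z & Y z < s z + Ph n z.1]].
have mA : measurable A.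
  rewrite (_ : A = (snd @^-1` `[0, +oo[) `&`
      (((fun z => Y z - s z) @^-1` `[0, +oo[) `&`
      ((fun z => s z + Ph n z.1 - Y z) @^-1` `]0, +oo[))).
    apply: measurableI; last apply: measurableI.
    - rewrite -[X in measurable X]setTI.
      exact: (measurable_snd measurableT _ (measurable_itv `[0, +oo[)).
    - rewrite -[X in measurable X]setTI.
      exact: ((measurable_funB mY ms) measurableT _ (measurable_itv `[0, +oo[)).
    - rewrite -[X in measurable X]setTI.
      exact: ((measurable_funB (measurable_funD ms mp) mY) measurableT _
        (measurable_itv `]0, +oo[)).
  apply/seteqP; split=> z; rewrite /A /= !in_itv/= !andbT subr_ge0 subr_gt0.
    by move=> [].
  by move=> [h1 [h2 h3]].
have := measurable_fun_xsection (@lebesgue_measure R) mA.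
congr measurable_fun; apply/funext => w /=; congr (lebesgue_measure _).
apply/seteqP; split=> t; rewrite /xsection /= inE /A /s /Y /=.
  by move=> [h1 h2 h3]; split => //; rewrite h2 h3.
by move=> [h1 /andP[h2 h3]].
Qed.

(** Excludes the paths on which [grid_below] meets a nonpositive argument or [inv_sub] takes the
    infimum of an empty set. *)
Definition regular_path (w : Omega) : Prop :=
  [/\ forall j, 0 < Arr j w, forall n, 0 < Ph n w &
      forall M, exists x, M < D x w /\ 0 <= x].

Lemma phase_start_ge0 w n : regular_path w -> 0 <= phase_start k n0 Arr Ph n w.
Proof.
move=> [A0 P0 _].
have arr j : 0 <= arrival_time n0 Arr j w.
  by rewrite /arrival_time; case: ifP => // _; apply: sumr_ge0 => i _; exact: ltW.
elim: n => [|n IH]; first exact: arr.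
rewrite /=; case: ifP => _; last by rewrite addr_ge0// ltW.
by rewrite le_max arr.
Qed.

Lemma inter_phase_regular w n : regular_path w ->
  inter_phase k n0 Arr Ph D n w =
  (left_lim (D^~ w) (phase_start k n0 Arr Ph n w + Ph n w) -
   left_lim (D^~ w) (phase_start k n0 Arr Ph n w))%:E.
Proof.
move=> reg; have [A0 P0 unb] := reg.
apply: first_passage_measure => //.
- exact: (subordinator0 hD).
- by move=> x y; exact: (subordinator_nd hD).
- exact: phase_start_ge0.
Qed.

Definition inter_phase_real (n : nat) (w : Omega) : R :=
  fine (inter_phase k n0 Arr Ph D n w).

Lemma cvg_prod_ord (N : nat) (F : nat -> nat -> R) (G : nat -> R) :
  (forall i, F i m @[m --> \oo] --> G i) ->
  \prod_(i < N) F i m @[m --> \oo] --> \prod_(i < N) G i.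
Proof.
move=> FG; elim: N => [|N IH].
  rewrite big_ord0; under eq_fun do rewrite big_ord0; exact: cvg_cst.
rewrite big_ord_recr; under eq_fun do rewrite big_ord_recr.
exact: cvgM.
Qed.

Lemma laplace_sample_cvg N (u : nat -> R) w : regular_path w ->
  laplace_sample m N u w w @[m --> \oo] -->
  \prod_(i < N) expR (- (u i * inter_phase_real i w)).
Proof.
move=> reg; have [A0 P0 unb] := reg.
apply: (@cvg_prod_ord N (fun i m => expR (- (u i *
    (D ((grid_start k n0 (fun i => grid_below m (Arr i w))
      (fun i => grid_below m (Ph i w)) i + grid_below m (Ph i w))%:R / m.+1%:R) w -
     D ((grid_start k n0 (fun i => grid_below m (Arr i w))
      (fun i => grid_below m (Ph i w)) i)%:R / m.+1%:R) w))))
  (fun i => expR (- (u i * inter_phase_real i w)))) => i.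
apply: continuous_cvg; first exact: continuous_expR.
apply: cvgN; apply: cvgMr; rewrite /inter_phase_real inter_phase_regular//=.
have s0 := phase_start_ge0 i reg.
have bs := below_start k n0 (Arr := Arr) (Ph := Ph) i A0 P0.
have f0 := subordinator0 hD w.
have fnd := @subordinator_nd _ _ _ _ _ _ _ hD w.
apply: cvgB; last exact: (left_lim_cvg fnd s0 bs).
under eq_fun do rewrite natrD mulrDl.
apply: (left_lim_cvg fnd (u := fun m => _ + _)); first by rewrite addr_ge0// ltW.
by apply: belowD => //; exact: below_grid.
Qed.

Hypothesis reg_ae : {ae P, forall w, regular_path w}.

Lemma inter_phase_real_ge0 n w : 0 <= inter_phase_real n w.
Proof. exact: fine_ge0. Qed.

Lemma measurable_inter_phase_real n : measurable_fun setT (inter_phase_real n).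
Proof.
by apply: measurableT_comp (measurable_inter_phase n); exact: fine_measurable.
Qed.

(** Both sides of [laplace_discretized] pass to the limit in [m] by bounded convergence. The
    truncation is invisible on regular paths and keeps the right-hand integrand at most 1 where some
    [Ph i] is negative. *)
Lemma laplace_inter_phase N (u : nat -> R) : (forall i, 0 <= u i) ->
  Ex P (fun w => \prod_(i < N) expR (- (u i * inter_phase_real i w))) =
  Ex P (fun w => \prod_(i < N) expR (- (phi (u i) * Num.max 0 (Ph i w)))).
Proof.
move=> u0.
have disc m := laplace_discretized m N u0.
pose f m w := laplace_sample m N u w w.
pose g m w := \prod_(i < N)
  expR (- (phi (u i) * ((grid_below m (Ph i w))%:R / m.+1%:R))).
have finP : (P setT < +oo)%E by rewrite probability_setT ltry.
have exp1 a b : 0 <= a -> 0 <= b -> 0 <= (expR (- (a * b)) : R) <= 1.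
  by move=> a0 b0; rewrite expR_ge0/= -[leRHS]expR0 ler_expR oppr_le0 mulr_ge0.
have norm1 (h : 'I_N -> R) : (forall i, 0 <= h i <= 1) ->
    `|\prod_(i < N) h i| <= 1.
  by move=> h01; have /andP[a b] := prod01 (index_enum _) h01; rewrite ger0_norm.
have cf : (\int[P]_w (f m w)%:E)%E @[m --> \oo] -->
    (\int[P]_w (\prod_(i < N) expR (- (u i * inter_phase_real i w)))%:E)%E.
  apply: (@bounded_cvg_integral _ _ _ _ _ _ 1) => //.
  - by move=> m; have [] := disc m.
  - apply: measurable_prod => i _.
    apply: measurableT_comp; first exact: measurable_expR.
    apply: measurableT_comp => //; apply: measurable_funM => //.
    exact: measurable_inter_phase_real.
  - by apply: filterS reg_ae => w; exact: laplace_sample_cvg.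
  - move=> m w; apply: norm1 => i; apply: exp1 => //.
    rewrite subr_ge0 (subordinator_nd hD)// ?divr_ge0//.
    by rewrite ler_pM2r ?invr_gt0// ler_nat leq_addr.
have cg : (\int[P]_w (g m w)%:E)%E @[m --> \oo] -->
    (\int[P]_w (\prod_(i < N) expR (- (phi (u i) * Num.max 0 (Ph i w))))%:E)%E.
  apply: (@bounded_cvg_integral _ _ _ _ _ _ 1) => //.
  - by move=> m; have [] := disc m.
  - apply: measurable_prod => i _.
    apply: measurableT_comp; first exact: measurable_expR.
    apply: measurableT_comp => //; apply: measurable_funM => //.
    by apply: measurable_maxr => //; exact: mPh.
  - apply: filterS reg_ae => w [_ P0 _].
    apply: (@cvg_prod_ord N
      (fun i m => expR (- (phi (u i) * ((grid_below m (Ph i w))%:R / m.+1%:R))))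
      (fun i => expR (- (phi (u i) * Num.max 0 (Ph i w))))) => i.
    apply: continuous_cvg; first exact: continuous_expR.
    apply: cvgN; apply: cvgMr; rewrite max_r; last exact: ltW.
    by have [] := below_grid (P0 i).
  - move=> m w; apply: norm1 => i; apply: exp1.
      exact: laplace_exponent_ge0.
    by rewrite divr_ge0.
rewrite /Ex; congr fine; apply: cvg_unique cf _ => //.
move: cg; rewrite (_ : (fun m => _) = (fun m => \int[P]_w (f m w)%:E)%E)//.
apply/funext => m; have [mf mg e] := disc m.
rewrite [LHS]Ex_EFin; [|exact: mg|].
  rewrite [RHS]Ex_EFin; [by congr EFin; rewrite -e|exact: mf|].
  move=> w; apply: prod01 => i; apply: exp1 => //.
  rewrite subr_ge0 (subordinator_nd hD)// ?divr_ge0//.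
  by rewrite ler_pM2r ?invr_gt0// ler_nat leq_addr.
move=> w; apply: prod01 => i; apply: exp1; first exact: laplace_exponent_ge0.
by rewrite divr_ge0.
Qed.

End tempered_queue.

(** * Laplace transforms of tail probabilities *)

Lemma eq_indic (R : pzRingType) (T T' : Type) (A : set T) (B : set T') x y :
  (A x <-> B y) -> \1_A x = \1_B y :> R.
Proof.
move=> [AB BA]; rewrite !indicE; have [xA|xA] := boolP (x \in A).
  by rewrite mem_set//; apply: AB; rewrite inE in xA.
by rewrite memNset//; move: xA; rewrite notin_setE => xA /BA.
Qed.

Lemma integral_expR_itv0y (R : realType) (s : R) : 0 < s ->
  (\int[@lebesgue_measure R]_(t in `[0%R, +oo[) (expR (- (s * t)))%:E = (s^-1)%:E)%E.
Proof.
move=> s0; have := integral_exponential_pdf s0.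
rewrite (_ : (fun x => (exponential_pdf s x)%:E) =
  ((fun x => (s * expR (- s * x))%R%:E) \_ `[0, +oo[)); last first.
  by apply/funext => x; rewrite /exponential_pdf !patchE; case: ifP.
rewrite -integral_mkcond.
under eq_integral do rewrite EFinM mulNr.
have mE : measurable_fun (`[0, +oo[%classic : set R)
    (fun t : R => (expR (- (s * t)))%:E).
  apply/measurable_funTS/measurable_EFinP.
  apply: measurableT_comp; first exact: measurable_expR.
  by apply: measurableT_comp => //; exact: measurable_funM.
rewrite ge0_integralZl//; last by rewrite lee_fin ltW.
move=> /(congr1 (fun x => (s^-1)%:E * x)%E).
by rewrite muleA -EFinM mulVf ?gt_eqF// mul1e mule1.
Qed.

Lemma integral_expR_itv0o (R : realType) (s x : R) : 0 < s -> 0 <= x ->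
  (\int[@lebesgue_measure R]_(t in `[0%R, x[) (expR (- (s * t)))%:E =
   ((1 - expR (- (s * x))) / s)%R%:E)%E.
Proof.
move=> s0; rewrite le_eqVlt => /orP[/eqP <-|x0].
  by rewrite mulr0 oppr0 expR0 subrr mul0r set_itvco0 integral_set0.
have e1 : (\int[@lebesgue_measure R]_(t in `[0%R, x[)
    (s%:E * (expR (- (s * t)))%:E) = 1 - (expR (- s * x))%:E)%E.
  rewrite -(exponential_prob_itv0c s x0) /exponential_prob.
  rewrite -integral_itv_bndo_bndc; last first.
    apply/measurable_funTS/measurable_EFinP; exact: measurable_exponential_pdf.
  apply: eq_integral => t; rewrite inE/= in_itv/= => /andP[t0 _].
  by rewrite exponential_pdfE// EFinM mulNr.
have mE : measurable_fun (`[0, x[%classic : set R)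
    (fun t : R => (expR (- (s * t)))%:E).
  apply/measurable_funTS/measurable_EFinP.
  apply: measurableT_comp; first exact: measurable_expR.
  by apply: measurableT_comp => //; exact: measurable_funM.
move: e1; rewrite ge0_integralZl//; last by rewrite lee_fin ltW.
move=> /(congr1 (fun y => (s^-1)%:E * y)%E).
by rewrite muleA -EFinM mulVf ?gt_eqF// mul1e => ->; rewrite mulNr -EFinB -EFinM mulrC.
Qed.

Section tail_transform.
Context d (Omega : measurableType d) (R : realType) (P : probability Omega R).

Lemma measurable_gt_event (X : Omega -> R) t : measurable_fun setT X ->
  measurable [set w | t < X w].
Proof.
move=> mX; have := mX measurableT _ (measurable_itv `]t, +oo[); rewrite setTI.
by congr measurable; apply/seteqP; split=> w; rewrite /= in_itv/= andbT.
Qed.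

(* Tonelli on [e^(-s t) 1{t < X}]. *)
Lemma laplace_tail (X : Omega -> R) s : measurable_fun setT X ->
  (forall w, 0 <= X w) -> 0 < s ->
  (\int[@lebesgue_measure R]_(t in `[0%R, +oo[)
     ((expR (- (s * t)))%:E * P [set w | (t < X w)%R]) =
   ((1 - Ex P (fun w => expR (- (s * X w)))) / s)%R%:E)%E.
Proof.
move=> mX X0 s0.
pose A := [set z : R * Omega | 0 <= z.1 < X z.2].
have mXs : measurable_fun setT (fun z : R * Omega => X z.2).
  exact: (measurableT_comp mX measurable_snd).
have mA : measurable A.
  rewrite (_ : A = (fst @^-1` `[0, +oo[) `&`
      ((fun z => X z.2 - z.1) @^-1` `]0, +oo[)).
    apply: measurableI.
    - rewrite -[X in measurable X]setTI.
      exact: (measurable_fst measurableT _ (measurable_itv `[0, +oo[)).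
    - rewrite -[X in measurable X]setTI.
      exact: ((measurable_funB mXs measurable_fst) measurableT _
        (measurable_itv `]0, +oo[)).
  apply/seteqP; split=> z; rewrite /A /= !in_itv/= !andbT subr_gt0.
    by move=> /andP[].
  by move=> [-> ->].
pose f (z : R * Omega) : \bar R := (expR (- (s * z.1)) * \1_A z)%:E.
have mf : measurable_fun setT f.
  apply/measurable_EFinP; apply: measurable_funM => //.
  apply: measurableT_comp; first exact: measurable_expR.
  by apply: measurableT_comp => //; apply: measurable_funM => //; exact: measurable_fst.
have f0 z : (0 <= f z)%E by rewrite lee_fin mulr_ge0 ?expR_ge0.
have := @fubini_tonelli _ _ _ _ _ (@lebesgue_measure R) P f mf f0.
rewrite [X in X = _ -> _](_ : _ = \int[@lebesgue_measure R]_(t in `[0%R, +oo[)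
     ((expR (- (s * t)))%:E * P [set w | (t < X w)%R]))%E; last first.
  rewrite [RHS]integral_mkcond; apply: eq_integral => t _.
  rewrite patchE; case: ifPn => [|].
    rewrite inE/= in_itv/= andbT => t0.
    rewrite [LHS](_ : _ = \int[P]_w ((expR (- (s * t)))%:E * (\1_A (t, w))%:E))%E;
      last by apply: eq_integral => w _; rewrite -EFinM.
    rewrite ge0_integralZl//.
    - congr (_ * _)%E.
      rewrite -[X in P X]setIT -integral_indic//; last exact: measurable_gt_event.
      apply: eq_integral => w _; congr EFin; apply: eq_indic.
      by rewrite /A /= t0.
    - apply/measurable_EFinP.
      rewrite (_ : (fun w => _) = \1_[set w | t < X w] :> (Omega -> R)).
        by apply: measurable_indic; exact: measurable_gt_event.
      by apply/funext => w; apply: eq_indic; rewrite /A /= t0.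
  rewrite notin_setE/= in_itv/= andbT => /negP/negbTE t0.
  rewrite integral0_eq// => w _; rewrite /f indicE memNset ?mulr0//.
  by rewrite /A /= t0.
move=> ->.
transitivity (\int[P]_w ((s^-1)%:E * (1 - expR (- (s * X w)))%R%:E))%E.
  apply: eq_integral => w _.
  rewrite -EFinM mulrC -integral_expR_itv0o// [RHS]integral_mkcond.
  apply: eq_integral => t _; rewrite patchE /f indicE.
  have [h|h] := boolP (t \in _); [rewrite mem_set|rewrite memNset].
  - by rewrite mulr1.
  - by move: h; rewrite inE/= in_itv.
  - by rewrite mulr0.
  - by move: h; rewrite notin_setE/= in_itv.
have e01 w : 0 <= expR (- (s * X w)) <= 1.
  by rewrite expR_ge0/= -[leRHS]expR0 ler_expR oppr_le0 mulr_ge0// ltW.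
have me : measurable_fun setT (fun w => expR (- (s * X w))).
  apply: measurableT_comp; first exact: measurable_expR.
  by apply: measurableT_comp => //; exact: measurable_funM.
have m1e : measurable_fun setT (fun w => 1 - expR (- (s * X w))).
  by apply: measurable_funB.
rewrite ge0_integralZl//; last 3 first.
- exact/measurable_EFinP.
- by move=> w _; rewrite lee_fin subr_ge0; have /andP[] := e01 w.
- by rewrite lee_fin invr_ge0 ltW.
have sum1 : (\int[P]_w (1 - expR (- (s * X w)))%R%:E +
    \int[P]_w (expR (- (s * X w)))%:E = 1)%E.
  rewrite -ge0_integralD//.
  - under eq_integral do rewrite -EFinD subrK.
    rewrite -[LHS]/(\int[P]_w (cst 1%E w))%E integral_cst// mul1e.
    exact: probability_setT.
  - by move=> w _; rewrite lee_fin subr_ge0; have /andP[] := e01 w.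
  - exact/measurable_EFinP.
  - exact/measurable_EFinP.
rewrite (Ex_EFin P me e01) in sum1.
rewrite mulrC EFinM; congr (_ * _)%E.
by rewrite EFinB -sum1 addeK.
Qed.

Lemma ae_eq_event (A B : set Omega) : measurable A -> measurable B ->
  {ae P, forall w, A w <-> B w} -> P A = P B.
Proof.
move=> mA mB AB.
rewrite -[A]setIT -[B]setIT -!integral_indic//.
apply: ge0_ae_eq_integral => //.
- by apply/measurable_EFinP.
- by apply/measurable_EFinP.
- apply: filterS AB => w h _; congr EFin; exact: eq_indic.
Qed.

Lemma exp_distributed_pos c (X : Omega -> R) : exp_distributed P c X ->
  {ae P, forall w, 0 < X w}.
Proof.
move=> [mX h]; exists (~` [set w | 0 < X w]); split => //.
  by apply: measurableC; exact: measurable_gt_event.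
rewrite probability_setC; last exact: measurable_gt_event.
by rewrite (h 0)// mulr0 oppr0 expR0 subee.
Qed.

(** The law is given through its tail, so the transform [E] is read off [laplace_tail], which yields
    [(1 - E) / s = 1 / (s + c)]; the division by [s] sets [s = 0] apart. *)
Lemma laplace_exp_distributed c (X : Omega -> R) s : 0 < c -> 0 <= s ->
  exp_distributed P c X ->
  Ex P (fun w => expR (- (s * Num.max 0 (X w)))) = c / (c + s).
Proof.
move=> c0; rewrite le_eqVlt => /orP[/eqP <-|s0] [mX h].
  rewrite addr0 divff ?gt_eqF// /Ex.
  under eq_integral do rewrite mul0r oppr0 expR0.
  rewrite -[X in fine X]/(\int[P]_w (cst 1%E w))%E integral_cst// mul1e.
  exact: (congr1 fine (probability_setT P)).
have mY : measurable_fun setT (fun w => Num.max 0 (X w)) by exact: measurable_maxr.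
have Y0 w : 0 <= Num.max 0 (X w) by rewrite le_max lexx.
have := laplace_tail mY Y0 s0.
rewrite (_ : (\int[_]_(t in _) _ = \int[@lebesgue_measure R]_(t in `[0%R, +oo[)
    (expR (- ((s + c) * t)))%:E)%E); last first.
  apply: eq_integral => t; rewrite inE/= in_itv/= andbT => t0.
  rewrite (_ : [set w | _] = [set w | t < X w]).
    by rewrite h// -EFinM -expRD; congr (expR _)%:E; rewrite mulrDl opprD.
  by apply/seteqP; split=> w /=; rewrite lt_max ltNge t0.
rewrite integral_expR_itv0y ?addr_gt0// => e'; have e := EFin_inj e'; clear e'.
have sc : s + c != 0 by rewrite gt_eqF// addr_gt0.
have s0' : s != 0 by rewrite gt_eqF.
set E := Ex _ _ in e *; have -> : E = 1 - s * (s + c)^-1.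
  by rewrite e mulrC mulfVK// opprB addrC subrK.
by rewrite [c + s]addrC; field.
Qed.

End tail_transform.

(** * Termwise Laplace transform of the Mittag-Leffler series *)

Section gamma.
Context (R : realType).
Local Notation mu := (@lebesgue_measure R).
Implicit Types (b s u t : R).

Lemma Gamma_integrand_ge0 b u : 0 <= Gamma_integrand b u.
Proof. by rewrite mulr_ge0 ?powR_ge0 ?expR_ge0. Qed.

Lemma measurable_Gamma_integrand b : measurable_fun setT (Gamma_integrand b).
Proof.
apply: measurable_funM; first exact: measurable_powR.
by apply: measurableT_comp => //; exact: measurable_expR.
Qed.

Lemma continuous_powR_pos e u : 0 < u -> {for u, continuous (fun x : R => x `^ e)}.
Proof.
move=> u0; apply: differentiable_continuous; apply/derivable1_diffP.
by apply: derivable_powR; rewrite in_itv/= u0.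
Qed.

(** The range [1 <= b] keeps the integrand continuous up to 0 and contains every exponent
    [tail_exponent q r j]. At [b = 1] the power is the constant 1, also at 0; for [b > 1] it
    vanishes at 0. *)
Lemma within_continuous_Gamma_integrand b : 1 <= b ->
  {within `[0, +oo[, continuous (Gamma_integrand b)}.
Proof.
move=> b1; apply/continuous_within_itvcyP; split.
  move=> u; rewrite in_itv/= andbT => u0.
  apply: (@continuousM _ _ (fun x => x `^ (b - 1)) (fun x => expR (- x))).
    exact: continuous_powR_pos.
  by apply: continuous_comp; [exact: continuousN|exact: continuous_expR].
rewrite /Gamma_integrand; apply: cvgM; last first.
  apply: cvg_at_right_filter.
  by apply: continuous_comp; [exact: continuousN|exact: continuous_expR].
have [->|b1'] := eqVneq b 1.
  rewrite subrr; under eq_fun do rewrite powRr0; rewrite powRr0; exact: cvg_cst.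
rewrite powR0 ?subr_eq0//; apply: powR_cvg0.
by rewrite subr_gt0 lt_neqAle eq_sym b1'.
Qed.

Lemma Gamma_integral_scaled b s : 1 <= b -> 0 < s ->
  (\int[mu]_(u in `[0%R, +oo[) (Gamma_integrand b u)%:E =
   \int[mu]_(t in `[0%R, +oo[) (s `^ b * (t `^ (b - 1) * expR (- (s * t))))%R%:E)%E.
Proof.
move=> b1 s0.
have ds : ((fun x : R => s * x)^`())%classic = cst s.
  by apply/funext => x; rewrite derive1Ml// derive1_id mulr1.
have := @increasing_ge0_integration_by_substitutiony R (fun x => s * x)
  (Gamma_integrand b) 0.
rewrite ds mulr0 => ->.
- apply: eq_integral => t; rewrite inE/= in_itv/= andbT => t0.
  congr EFin; transitivity ((s * t) `^ (b - 1) * expR (- (s * t)) * s); first by [].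
  rewrite powRM ?(ltW s0)// -(@mulr_powRB1 _ s b) ?(ltW s0)//; first by ring.
  exact: lt_le_trans b1.
- by move=> x y _ _; rewrite ltr_pM2l.
- by move=> x _; exact: cst_continuous.
- exact: is_cvg_cst.
- exact: is_cvg_cst.
- split; first by move=> x _; exact: derivableM.
  apply: cvg_at_right_filter; apply: cvgMr; exact: cvg_id.
- exact: gt0_cvgMry.
- exact: within_continuous_Gamma_integrand.
- by move=> x _; exact: Gamma_integrand_ge0.
Qed.

Lemma Gamma_integral_fin b : 1 <= b ->
  (\int[mu]_(u in `[0%R, +oo[) (Gamma_integrand b u)%:E < +oo)%E.
Proof.
move=> b1; have b0 : 0 <= b - 1 by rewrite subr_ge0.
pose n := Num.bound (b - 1).
have bn : b - 1 < n.+1%:R.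
  by apply: lt_trans (archi_boundP b0) _; rewrite ltr_nat.
(* From [u^(b - 1) <= 1 + u^(n + 1)] and the exponential series at [u / 2], which gives [u^(n + 1)
   <= (n + 1)! 2^(n + 1) e^(u / 2)]; the integrand is then at most [C e^(- u / 2)]. *)
pose C : R := 1 + n.+1`!%:R * 2 ^+ n.+1.
have C0 : 0 <= C by rewrite addr_ge0// mulr_ge0// exprn_ge0.
have half0 : 0 < 2^-1 :> R by rewrite invr_gt0.
apply: (@le_lt_trans _ _
  (\int[mu]_(u in `[0%R, +oo[) (C%:E * (expR (- (2^-1 * u)))%:E))%E).
  apply: ge0_le_integral => //.
  - by move=> u _; rewrite lee_fin Gamma_integrand_ge0.
  - apply/measurable_funTS/measurable_EFinP; exact: measurable_Gamma_integrand.
  - apply: measurable_funeM; apply/measurable_funTS/measurable_EFinP.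
    apply: measurableT_comp; first exact: measurable_expR.
    by apply: measurableT_comp => //; exact: measurable_funM.
  - move=> u; rewrite /= in_itv/= andbT => u0; rewrite -EFinM lee_fin.
    have e11 : 1 `^ (b - 1) = 1 :> R by rewrite powR1.
    have h1 : u `^ (b - 1) <= 1 + u ^+ n.+1.
      have [u1|u1] := leP u 1.
        apply: (@le_trans _ _ 1); last by rewrite lerDl exprn_ge0.
        by rewrite -[leRHS]e11 ge0_ler_powR ?nnegrE.
      apply: (@le_trans _ _ (u ^+ n.+1)); last by rewrite lerDr.
      by rewrite -powR_mulrn// ler_powR ?ltW.
    have h2 : u ^+ n.+1 <= n.+1`!%:R * 2 ^+ n.+1 * expR (2^-1 * u).
      have := @expR_ge1Dxn R (2^-1 * u) n; rewrite mulr_ge0// ?(ltW half0)//.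
      move=> /(_ isT) h; have {}h : (2^-1 * u) ^+ n.+1 / n.+1`!%:R <= expR (2^-1 * u).
        by apply: le_trans h; rewrite lerDr.
      rewrite ler_pdivrMr ?ltr0n ?fact_gt0// exprMn exprVn in h.
      by rewrite mulrAC -ler_pdivrMr ?exprn_gt0// mulrC [leRHS]mulrC.
    have h3 : 1 <= expR (2^-1 * u).
      by rewrite -[leLHS]expR0 ler_expR mulr_ge0// ltW.
    have e1 : expR (- (2^-1 * u)) = expR (2^-1 * u) * expR (- u).
      by rewrite -expRD; congr expR; lra.
    rewrite /Gamma_integrand e1 mulrA ler_wpM2r ?expR_ge0//.
    apply: le_trans h1 _; rewrite /C mulrDl mul1r; exact: lerD.
rewrite ge0_integralZl//.
- by rewrite integral_expR_itv0y// -EFinM ltry.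
- apply/measurable_funTS/measurable_EFinP.
  apply: measurableT_comp; first exact: measurable_expR.
  by apply: measurableT_comp => //; exact: measurable_funM.
Qed.

Lemma Gamma_integral_gt0 b : 1 <= b ->
  (0 < \int[mu]_(u in `[0%R, +oo[) (Gamma_integrand b u)%:E)%E.
Proof.
move=> b1; have b0 : 0 <= b - 1 by rewrite subr_ge0.
(* On [[1, 2]] the power is at least 1 and the exponential at least [e^(-2)], so this interval of
   length one already contributes [e^(-2)]. *)
apply: (@lt_le_trans _ _ (expR (- 2))%:E); first by rewrite lte_fin expR_gt0.
apply: (@le_trans _ _ (\int[mu]_(u in `[1%R, 2%R]) (Gamma_integrand b u)%:E)%E).
  apply: (@le_trans _ _ (\int[mu]_(u in `[1%R, 2%R]) (cst (expR (- 2))%:E u))%E).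
    rewrite integral_cst//= lebesgue_measure_itv/= lte_fin ltr1n -EFinB.
    by rewrite (_ : 2 - 1 = 1 :> R) ?mule1//; lra.
  apply: ge0_le_integral => //.
  - by move=> u _; rewrite lee_fin expR_ge0.
  - apply/measurable_funTS/measurable_EFinP; exact: measurable_Gamma_integrand.
  - move=> u; rewrite /= in_itv/= => /andP[u1 u2]; rewrite lee_fin.
    rewrite -[leLHS]mul1r ler_pM ?expR_ge0//.
      have e11 : 1 `^ (b - 1) = 1 :> R by rewrite powR1.
      by rewrite -[leLHS]e11 ge0_ler_powR ?nnegrE// (le_trans _ u1).
    by rewrite ler_expR lerN2.
apply: ge0_subset_integral => //.
- apply/measurable_funTS/measurable_EFinP; exact: measurable_Gamma_integrand.
- by move=> u _; rewrite lee_fin Gamma_integrand_ge0.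
- move=> u /=; rewrite !in_itv/= andbT => /andP[u1 _]; exact: le_trans u1.
Qed.

Lemma GammaE b : 1 <= b ->
  (\int[mu]_(u in `[0%R, +oo[) (Gamma_integrand b u)%:E = (Gamma b)%:E)%E.
Proof.
move=> b1; rewrite /Gamma.
rewrite (_ : [set u : R | (0 < u)%R] = `]0%R, +oo[%classic); last first.
  by apply/seteqP; split=> u /=; rewrite in_itv/= andbT.
rewrite integral_itv_obnd_cbnd; last first.
  apply/measurable_funTS/measurable_EFinP; exact: measurable_Gamma_integrand.
rewrite fineK// ge0_fin_numE; first exact: Gamma_integral_fin.
by apply: integral_ge0 => u _; rewrite lee_fin Gamma_integrand_ge0.
Qed.

Lemma Gamma_gt0 b : 1 <= b -> 0 < Gamma b.
Proof. by move=> b1; rewrite -lte_fin -GammaE// Gamma_integral_gt0. Qed.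

Lemma laplace_powR_Gamma b s : 1 <= b -> 0 < s ->
  (\int[mu]_(t in `[0%R, +oo[) (t `^ (b - 1) / Gamma b * expR (- (s * t)))%R%:E =
   (s `^ (- b))%:E)%E.
Proof.
move=> b1 s0; have G0 := Gamma_gt0 b1.
have mp : measurable_fun (`[0, +oo[%classic : set R)
    (fun t => (t `^ (b - 1) * expR (- (s * t)))%:E).
  apply/measurable_funTS/measurable_EFinP.
  apply: measurable_funM; first exact: measurable_powR.
  apply: measurableT_comp; first exact: measurable_expR.
  by apply: measurableT_comp => //; exact: measurable_funM.
have p0 t : (0 <= (t `^ (b - 1) * expR (- (s * t)))%:E)%E.
  by rewrite lee_fin mulr_ge0 ?powR_ge0 ?expR_ge0.
have sb0 : 0 < s `^ b by exact: powR_gt0.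
transitivity (((Gamma b)^-1)%:E * \int[mu]_(t in `[0%R, +oo[)
    (t `^ (b - 1) * expR (- (s * t)))%R%:E)%E.
  rewrite -ge0_integralZl//; last by rewrite lee_fin invr_ge0 ltW.
  by apply: eq_integral => t _; rewrite -EFinM mulrAC mulrC.
have := GammaE b1; rewrite (Gamma_integral_scaled b1 s0).
under eq_integral do rewrite EFinM.
rewrite ge0_integralZl//; last by rewrite lee_fin ltW.
move=> /(congr1 (fun x => ((s `^ b)^-1)%:E * x)%E).
rewrite muleA -EFinM mulVf ?gt_eqF// mul1e => ->.
by rewrite -!EFinM powRN mulrCA mulVf ?mulr1// gt_eqF.
Qed.

End gamma.

(** * Series with real terms: limits, right continuity, negative binomial expansion *)

Section real_series.
Context (R : realType).
Implicit Types (u v : nat -> R) (f : nat -> R -> R).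

Lemma eseries_EFin u (l : R) : series u @ \oo --> l ->
  (\sum_(n <oo) (u n)%:E = l%:E)%E.
Proof.
move=> ul; apply/cvg_lim => //.
rewrite (_ : (fun n => \sum_(0 <= i < n) (u i)%:E)%E = EFin \o series u).
  by apply: cvg_EFin => //; exact: nearW.
by apply/funext => n; rewrite /= /series/= sumEFin.
Qed.

Lemma eseries_fin_cvg u : (forall n, 0 <= u n) ->
  (\sum_(n <oo) (u n)%:E < +oo)%E ->
  cvgn (series u) /\ (\sum_(n <oo) (u n)%:E = (limn (series u))%:E)%E.
Proof.
move=> u0 fin; set S := (X in (X < _)%E) in fin.
have S0 : (0 <= S)%E by apply: nneseries_ge0 => n _ _; rewrite lee_fin.
have Sfin : S \is a fin_num by rewrite ge0_fin_numE.
have cu : cvgn (series u).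
  apply: nondecreasing_is_cvgn; first exact/nondecreasing_series.
  exists (fine S) => _ [n _ <-]; rewrite -lee_fin fineK// /series/= -sumEFin.
  by apply: nneseries_lim_ge => i _ _; rewrite lee_fin.
by split => //; apply: eseries_EFin.
Qed.

Lemma series_scale u (a : R) : series (fun n => a * u n) = (fun N => a * series u N).
Proof. by apply/funext => N; rewrite /series/= mulr_sumr. Qed.

Lemma cvg_series_scale u (a : R) : cvgn (series u) ->
  series (fun n => a * u n) @ \oo --> a * limn (series u).
Proof. by move=> cu; rewrite series_scale; apply: cvgMr. Qed.

Lemma cvg_series_sub u v : cvgn (series u) -> cvgn (series v) ->
  series (fun n => u n - v n) @ \oo --> limn (series u) - limn (series v).
Proof.
move=> cu cv; rewrite (_ : series _ = fun N => series u N - series v N).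
  exact: cvgB.
by apply/funext => N; rewrite /series/= sumrB.
Qed.

Lemma limn_series_ge0 u : (forall n, 0 <= u n) -> cvgn (series u) ->
  0 <= limn (series u).
Proof.
move=> u0 cu; apply: limr_ge => //; apply: nearW => N.
by rewrite /series/=; apply: sumr_ge0.
Qed.

Lemma limn_series_le u v : (forall n, u n <= v n) -> cvgn (series u) ->
  cvgn (series v) -> limn (series u) <= limn (series v).
Proof.
move=> uv cu cv; apply: ler_lim => //; apply: nearW => N.
by rewrite /series/=; apply: ler_sum.
Qed.

(* Tails of a series of nonnegative nondecreasing functions are nondecreasing,
   so they are controlled on a right neighbourhood by their value at one point. *)
Lemma series_right_continuous f :
  (forall n t, 0 <= t -> 0 <= f n t) ->
  (forall n s t, 0 <= s -> s <= t -> f n s <= f n t) ->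
  (forall n t, 0 <= t -> f n x @[x --> t^'+] --> f n t) ->
  (forall t, 0 <= t -> cvgn (series (f^~ t))) ->
  forall t, 0 <= t ->
    limn (series (f^~ x)) @[x --> t^'+] --> limn (series (f^~ t)).
Proof.
move=> f0 fnd fc cf t0 t00.
pose g t := limn (series (f^~ t)).
pose t1 := t0 + 1.
have t10 : 0 <= t1 by rewrite addr_ge0.
have tail N s t : 0 <= s -> s <= t ->
    g s - series (f^~ s) N <= g t - series (f^~ t) N.
  move=> s0 st; have t0' := le_trans s0 st.
  have cvd : (fun M => (series (f^~ t) M - series (f^~ t) N) -
      (series (f^~ s) M - series (f^~ s) N)) @ \oo -->
      (g t - series (f^~ t) N) - (g s - series (f^~ s) N).
    apply: cvgB; apply: cvgB; try exact: cvg_cst; exact: cf.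
  rewrite -subr_ge0 -(cvg_lim _ cvd)//; apply: limr_ge; first exact: cvgP cvd.
  near=> M; have NM : (N <= M)%N by near: M; exact: nbhs_infty_ge.
  rewrite subr_ge0 !sub_series_geq// ler_sum// => n _; exact: fnd.
have partial_cvg N : series (f^~ x) N @[x --> t0^'+] --> series (f^~ t0) N.
  elim: N => [|N IH].
    by rewrite /series/= big_geq//; under eq_fun do rewrite big_geq//; exact: cvg_cst.
  rewrite seriesSr; under eq_fun do rewrite seriesSr.
  by apply: cvgD => //; exact: fc.
have gap t N : 0 <= t -> 0 <= g t - series (f^~ t) N.
  move=> tp; rewrite subr_ge0; apply: nondecreasing_cvgn_le; last exact: cf.
  by apply/nondecreasing_series => n _ _; exact: f0.
apply/cvgrPdist_lt => e e0.
have e3 : 0 < e / 3 by rewrite divr_gt0.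
have [N _ hN] : \forall N \near \oo, `|g t1 - series (f^~ t1) N| < e / 3.
  by move/cvgrPdist_lt : (cf _ t10); exact.
have {}hN := hN N (leqnn N).
rewrite ger0_norm ?gap// in hN.
have hc : \forall x \near t0^'+, `|series (f^~ t0) N - series (f^~ x) N| < e / 3.
  by move/cvgrPdist_lt : (partial_cvg N); exact.
near=> t.
have t0t : t0 < t by near: t; exact: nbhs_right_gt.
have tt1 : t <= t1 by near: t; apply: nbhs_right_le; rewrite ltrDl.
have h1 : `|series (f^~ t0) N - series (f^~ t) N| < e / 3 by near: t.
have tp : 0 <= t := le_trans t00 (ltW t0t).
have h2 := tail N _ _ tp tt1.
have h3 := tail N _ _ t00 (le_trans (ltW t0t) tt1).
have h4 := gap t N tp.
have h5 := gap t0 N t00.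
move: h1; rewrite !ltr_norml -/(g t0) -/(g t) => /andP[h6 h7].
by apply/andP; split; lra.
Unshelve. all: by end_near. Qed.

(** Induction on [r] through a Pascal rule for the coefficients: the partial sums satisfy
    [T (r+1) (n+1) = T r (n+1) + x T (r+1) n], which bounds them and, in the limit, divides by
    [1 - x]. At [r = 0] only the term [j = 0] survives. *)
Lemma neg_binomial_series (r : nat) (x : R) : 0 <= x < 1 ->
  series (fun j => poch r%:R j / j`!%:R * x ^+ j) @ \oo --> ((1 - x)^-1) ^+ r.
Proof.
move=> /andP[x0 x1].
have x1' : 0 < 1 - x by rewrite subr_gt0.
pose a (r j : nat) : R := poch r%:R j / j`!%:R.
have a0 r' j : 0 <= a r' j.
  by rewrite divr_ge0// /poch prodr_ge0// => i _; rewrite addr_ge0.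
have pascal r' j : a r'.+1 j.+1 = a r' j.+1 + a r'.+1 j.
  rewrite /a /poch big_ord_recr/= [in X in _ = X + _]big_ord_recl/=.
  have -> : \prod_(i < j) (r'%:R + (bump 0 i)%:R) = \prod_(i < j) (r'.+1%:R + i%:R) :> R.
    apply: eq_bigr => i _; rewrite /bump/= -!natrD; congr (_%:R); lia.
  set p := \prod_(_ < _) _.
  rewrite factS natrM; field.
  by rewrite [1 + _]addrC natr1 !pnatr_eq0 -!lt0n fact_gt0.
pose T r' n := series (fun j => a r' j * x ^+ j) n.
have Trec r' n : T r'.+1 n.+1 = T r' n.+1 + x * T r'.+1 n.
  rewrite /T /series/= !big_nat_recl//= mulr_sumr.
  rewrite (_ : a r'.+1 0%N = a r' 0%N); last by rewrite /a /poch !big_ord0.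
  rewrite -addrA; congr (_ + _); rewrite -big_split/=; apply: eq_bigr => j _.
  by rewrite pascal exprS; ring.
have Tnd r' : nondecreasing_seq (T r').
  by apply/nondecreasing_series => j _ _; rewrite mulr_ge0// exprn_ge0.
elim: r => [|r IH].
  rewrite expr0; apply: cvg_near_cst; exists 1%N => // n /= n1.
  rewrite /series/= -(prednK n1) big_nat_recl//= /poch big_ord0 fact0 divr1 mul1r expr0.
  rewrite big1 ?addr0// => j _; rewrite /poch big_ord_recl/= addr0.
  by rewrite mul0r mul0r mul0r.
have bnd n : T r.+1 n <= ((1 - x)^-1) ^+ r.+1.
  have h1 : T r n.+1 <= ((1 - x)^-1) ^+ r.
    have := nondecreasing_cvgn_le (Tnd r) (cvgP _ IH) n.+1.
    by rewrite (cvg_lim _ IH).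
  have h2 : T r.+1 n.+1 * (1 - x) <= T r n.+1.
    rewrite mulrBr mulr1 lerBlDr [leLHS]Trec lerD2l mulrC ler_wpM2r//.
    exact: Tnd.
  apply: le_trans (Tnd r.+1 _ _ (leqnSn n)) _.
  rewrite exprS mulrC ler_pdivlMr//; exact: le_trans h1.
have cT : cvgn (T r.+1).
  apply: nondecreasing_is_cvgn; first exact: Tnd.
  by exists (((1 - x)^-1) ^+ r.+1) => _ [n _ <-].
have e : limn (T r.+1) = ((1 - x)^-1) ^+ r + x * limn (T r.+1).
  apply/cvg_lim => //; rewrite -cvg_shiftS.
  rewrite (_ : (fun n => T r.+1 n.+1) = fun n => T r n.+1 + x * T r.+1 n).
    apply: cvgD; last exact: cvgMr.
    by move: IH; rewrite -cvg_shiftS.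
  by apply/funext => n; exact: Trec.
have -> : ((1 - x)^-1) ^+ r.+1 = limn (T r.+1).
  apply: (mulIf (lt0r_neq0 x1')).
  rewrite exprSr mulfVK ?gt_eqF//; move: e; set L := limn _ => e.
  by rewrite mulrBr mulr1 {1}e mulrC addrK.
exact: cT.
Qed.

End real_series.

(** Nonnegative exponents make the rule valid at [x = 0] as well, where a power is 1 for exponent 0
    and 0 otherwise; the series is treated down to [t = 0]. *)
Lemma powRD_ge0 (R : realType) (x a b : R) : 0 <= a -> 0 <= b ->
  x `^ (a + b) = x `^ a * x `^ b.
Proof.
move=> a0 b0; have [ab|ab] := eqVneq (a + b) 0; last by rewrite powRD// (negbTE ab).
move/eqP : ab; rewrite paddr_eq0// => /andP[/eqP -> /eqP ->].
by rewrite addr0 !powRr0 mulr1.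
Qed.

Lemma nneseries_term_le (R : realType) (u : nat -> \bar R) n :
  (forall n, 0 <= u n)%E -> (u n <= \sum_(k <oo) u k)%E.
Proof.
move=> u0; apply: le_trans (nneseries_lim_ge n.+1 _); last by move=> i _ _.
by rewrite big_nat_recr//= leeDr// sume_ge0.
Qed.

(** * The triple series with nonnegative terms *)

Section tail_series.
Context (R : realType).
Variables (theta alpha c : R).
Hypotheses (theta0 : 0 < theta) (alpha0 : 0 < alpha) (c0 : 0 < c).
Local Notation mu := (@lebesgue_measure R).

Definition tail_coef (q r j : nat) : R :=
  theta ^+ q * c ^+ r * (poch r%:R j / j`!%:R) * (theta `^ alpha) ^+ j.

Definition tail_exponent (q r j : nat) : R :=
  alpha * j%:R + (r%:R * alpha + q%:R + 1).

(** The term of index [(q, r, j)] of the expanded tail without its sign and without the factor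
    [e^(- theta t)], with [c] for [k mu]. It is normalised as a multiple of [t^(b - 1) / Gamma b],
    whose transform is [s^(- b)]; [tail_termE] recovers the Mittag-Leffler shape. *)
Definition tail_term (q r j : nat) (t : R) : R :=
  tail_coef q r j *
  (t `^ (tail_exponent q r j - 1) / Gamma (tail_exponent q r j)).

Let poch_ge0 (r j : nat) : 0 <= poch (r%:R : R) j.
Proof. by apply: prodr_ge0 => i _; rewrite addr_ge0. Qed.

Lemma tail_coef_ge0 q r j : 0 <= tail_coef q r j.
Proof.
rewrite /tail_coef !mulr_ge0 ?exprn_ge0 ?powR_ge0 ?invr_ge0 ?(ltW theta0) ?(ltW c0)//.
Qed.

Lemma tail_exponent_ge1 q r j : 1 <= tail_exponent q r j.
Proof.
rewrite /tail_exponent addrA lerDr addr_ge0 ?mulr_ge0 ?addr_ge0 ?mulr_ge0//; exact: ltW.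
Qed.

Let Gam0 q r j : 0 < Gamma (tail_exponent q r j).
Proof. by apply: Gamma_gt0; exact: tail_exponent_ge1. Qed.

Lemma tail_term_ge0 q r j t : 0 <= tail_term q r j t.
Proof.
rewrite /tail_term mulr_ge0 ?tail_coef_ge0// divr_ge0 ?powR_ge0//.
exact: ltW.
Qed.

Lemma tail_term_nd q r j s t : 0 <= s -> s <= t ->
  tail_term q r j s <= tail_term q r j t.
Proof.
move=> s0 st; rewrite /tail_term ler_wpM2l ?tail_coef_ge0//.
rewrite ler_pM2r ?invr_gt0//.
apply: ge0_ler_powR; rewrite ?nnegrE ?subr_ge0 ?tail_exponent_ge1//.
exact: le_trans st.
Qed.

Lemma tail_term_right_continuous q r j t : 0 <= t ->
  tail_term q r j x @[x --> t^'+] --> tail_term q r j t.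
Proof.
rewrite le_eqVlt => /orP[/eqP <-|t0]; rewrite /tail_term; apply: cvgMr; apply: cvgMl.
  have [e|e] := eqVneq (tail_exponent q r j - 1) 0.
    by rewrite e; under eq_fun do rewrite powRr0; rewrite powRr0; exact: cvg_cst.
  rewrite powR0//; apply: powR_cvg0.
  by rewrite lt_neqAle eq_sym e subr_ge0 tail_exponent_ge1.
by apply: cvg_at_right_filter; exact: continuous_powR_pos.
Qed.

Lemma tail_termE q r j t : 0 <= t ->
  tail_term q r j t = ((theta * t) ^+ q * (c * t `^ alpha) ^+ r) *
    (poch r%:R j * (theta `^ alpha * t `^ alpha) ^+ j /
      (j`!%:R * Gamma (tail_exponent q r j))).
Proof.
move=> t0; rewrite /tail_term /tail_coef.
have -> : tail_exponent q r j - 1 = alpha * j%:R + (alpha * r%:R + q%:R).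
  by rewrite /tail_exponent; ring.
have a0 := ltW alpha0.
rewrite !powRD_ge0 ?addr_ge0 ?mulr_ge0//.
rewrite 2!powRrM !powR_mulrn ?powR_ge0// !exprMn invfM; ring.
Qed.

Section transform.
Variables (s : R).
Hypotheses (s_theta : theta < s) (s_c : c < s `^ alpha - theta `^ alpha).

Let s0 : 0 < s. Proof. exact: lt_trans s_theta. Qed.
Let sa0 : 0 < s `^ alpha. Proof. exact: powR_gt0. Qed.
Let z : R := c / (s `^ alpha - theta `^ alpha).

Let term_exp (e : nat -> R) q r j t : \bar R :=
  (e r * tail_term q r j t * expR (- (s * t)))%:E.

Let integral_term (e : nat -> R) q r j : 0 <= e r ->
  (\int[mu]_(t in `[0%R, +oo[) term_exp e q r j t =
   (e r * tail_coef q r j * s `^ (- tail_exponent q r j))%R%:E)%E.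
Proof.
move=> e0; rewrite EFinM -laplace_powR_Gamma//; last exact: tail_exponent_ge1.
rewrite -ge0_integralZl//.
- by apply: eq_integral => t _; rewrite -EFinM; congr EFin; rewrite /tail_term; ring.
- apply/measurable_funTS/measurable_EFinP; apply: measurable_funM.
    by apply: measurable_funM => //; exact: measurable_powR.
  apply: measurableT_comp; first exact: measurable_expR.
  by apply: measurableT_comp => //; exact: measurable_funM.
- by move=> t _; rewrite lee_fin mulr_ge0 ?expR_ge0// divr_ge0 ?powR_ge0// ltW.
- by rewrite lee_fin mulr_ge0 ?tail_coef_ge0.
Qed.

Let coef_split (e : nat -> R) q r j :
  e r * tail_coef q r j * s `^ (- tail_exponent q r j) =
  (e r * (theta / s) ^+ q / s * (c / s `^ alpha) ^+ r) *
  (poch r%:R j / j`!%:R * (theta `^ alpha / s `^ alpha) ^+ j).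
Proof.
have a0 := ltW alpha0.
rewrite powRN /tail_exponent addrA !powRD_ge0 ?addr_ge0 ?mulr_ge0//.
rewrite powRr1 ?(ltW s0)// [r%:R * _]mulrC !powRrM !powR_mulrn ?powR_ge0 ?(ltW s0)//.
rewrite /tail_coef !invfM !exprMn !exprVn; ring.
Qed.

(** The sum over [j] is negative binomial and turns [(c / s^alpha)^r] into [z^r]; the sum over [r]
    is then [S] by hypothesis. The sum over [q] is geometric in [theta / s] and moves the
    denominator from [s] to [s - theta]. The weights [e] will select a parity of [r]. *)
Lemma laplace_tail_series (e : nat -> R) (S : R) : (forall r, 0 <= e r) ->
  series (fun r => e r * z ^+ r) @ \oo --> S ->
  (\int[mu]_(t in `[0%R, +oo[) (\sum_(q <oo) \sum_(r <oo) \sum_(j <oo)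
     (e r * tail_term q r j t * expR (- (s * t)))%R%:E) = (S / (s - theta))%R%:E)%E.
Proof.
move=> e0 eS.
have t0 q r j t : (0 <= term_exp e q r j t)%E.
  rewrite lee_fin; apply: mulr_ge0; last exact: expR_ge0.
  by apply: mulr_ge0 => //; exact: tail_term_ge0.
have mt q r j : measurable_fun (`[0, +oo[%classic : set R) (term_exp e q r j).
  apply/measurable_funTS/measurable_EFinP; apply: measurable_funM.
    apply: measurable_funM => //; apply: measurable_funM => //.
    by apply: measurable_funM => //; exact: measurable_powR.
  apply: measurableT_comp; first exact: measurable_expR.
  by apply: measurableT_comp => //; exact: measurable_funM.
have mj q r : measurable_fun (`[0, +oo[%classic : set R)
    (fun t => \sum_(j <oo) term_exp e q r j t)%E.
  by apply: ge0_emeasurable_sum => // j t _ _; exact: t0.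
have j0 q r t : (0 <= \sum_(j <oo) term_exp e q r j t)%E.
  by apply: nneseries_ge0 => j _ _; exact: t0.
have mr q : measurable_fun (`[0, +oo[%classic : set R)
    (fun t => \sum_(r <oo) \sum_(j <oo) term_exp e q r j t)%E.
  by apply: ge0_emeasurable_sum => // r t _ _; exact: j0.
have r0 q t : (0 <= \sum_(r <oo) \sum_(j <oo) term_exp e q r j t)%E.
  by apply: nneseries_ge0 => r _ _; exact: j0.
have ths : theta `^ alpha / s `^ alpha < 1.
  rewrite ltr_pdivrMr// mul1r gt0_ltr_powR ?nnegrE ?(ltW theta0) ?(ltW s0)//.
have ths0 : 0 <= theta `^ alpha / s `^ alpha by rewrite divr_ge0 ?powR_ge0.
have dts : theta / s < 1 by rewrite ltr_pdivrMr// mul1r.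
transitivity (\sum_(q <oo) \int[mu]_(t in `[0%R, +oo[)
    \sum_(r <oo) \sum_(j <oo) term_exp e q r j t)%E.
  apply: integral_nneseries; [exact: measurable_itv|exact: mr|move=> q t _; exact: r0].
transitivity (\sum_(q <oo) (S / s * (theta / s) ^+ q)%R%:E)%E.
  apply: eq_eseriesr => q _.
  transitivity (\sum_(r <oo) \int[mu]_(t in `[0%R, +oo[)
      \sum_(j <oo) term_exp e q r j t)%E.
    apply: integral_nneseries; [exact: measurable_itv|exact: mj|move=> r t _; exact: j0].
  transitivity (\sum_(r <oo) ((theta / s) ^+ q / s * (e r * z ^+ r))%R%:E)%E.
    apply: eq_eseriesr => r _.
    transitivity (\sum_(j <oo) \int[mu]_(t in `[0%R, +oo[) term_exp e q r j t)%E.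
      apply: integral_nneseries; [exact: measurable_itv|exact: mt|move=> j t _; exact: t0].
    under eq_eseriesr do rewrite integral_term// coef_split.
    have nb := @neg_binomial_series R r (theta `^ alpha / s `^ alpha).
    have {}nb := nb (introT andP (conj ths0 ths)).
    rewrite (eseries_EFin (l := (e r * (theta / s) ^+ q / s * (c / s `^ alpha) ^+ r) *
      ((1 - theta `^ alpha / s `^ alpha)^-1) ^+ r)); last first.
      by rewrite series_scale; apply: cvgMr.
    congr EFin; rewrite -mulrA -exprMn.
    have -> : c / s `^ alpha / (1 - theta `^ alpha / s `^ alpha) = z.
      rewrite /z; field; rewrite !gt_eqF// ?subr_gt0// .
      by rewrite -subr_gt0; exact: lt_trans s_c.
    by ring.
  rewrite (eseries_EFin (l := (theta / s) ^+ q / s * S)).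
    by congr EFin; ring.
  by rewrite series_scale; apply: cvgMr.
apply: eseries_EFin.
have -> : S / (s - theta) = (S / s) * (1 - theta / s)^-1.
  by field; rewrite !gt_eqF// subr_gt0.
apply: cvg_geometric_series.
by rewrite ger0_norm// divr_ge0 ?(ltW theta0) ?(ltW s0).
Qed.

End transform.

(** Convergence is recorded at all three levels because [limn] of a divergent sequence is only a
    default value. *)
Definition summable_at (t : R) : Prop :=
  [/\ forall q r, cvgn (series (fun j => tail_term q r j t)),
      forall q, cvgn (series (fun r => limn (series (fun j => tail_term q r j t)))) &
      cvgn (series (fun q => limn (series (fun r =>
        limn (series (fun j => tail_term q r j t))))))].

(** The factor [a] stands for [e^(- s t)], present in every term of the integrated series; being
    positive, it can be divided out level by level. *)
Lemma summable_at_of_fin (a t : R) : 0 < a ->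
  (\sum_(q <oo) \sum_(r <oo) \sum_(j <oo) (tail_term q r j t * a)%R%:E < +oo)%E ->
  summable_at t.
Proof.
move=> a0 fin.
have unscale (u : nat -> R) : cvgn (series (fun n => u n * a)) -> cvgn (series u) /\
    limn (series (fun n => u n * a)) = limn (series u) * a.
  move=> cu.
  have cu' : cvgn (series u).
    rewrite (_ : series u = series (fun n => a^-1 * (u n * a))).
      by apply: cvgP; exact: cvg_series_scale.
    by congr series; apply/funext => n; rewrite mulrCA mulVf ?mulr1// gt_eqF.
  split => //; rewrite mulrC.
  rewrite (_ : (fun n => u n * a) = fun n => a * u n).
    by apply/cvg_lim => //; exact: cvg_series_scale.
  by apply/funext => n; rewrite mulrC.
have t0 q r j : 0 <= tail_term q r j t * a by rewrite mulr_ge0 ?tail_term_ge0// ltW.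
have j0 q r : (0 <= \sum_(j <oo) (tail_term q r j t * a)%R%:E)%E.
  by apply: nneseries_ge0 => j _ _; rewrite lee_fin.
have r0 q : (0 <= \sum_(r <oo) \sum_(j <oo) (tail_term q r j t * a)%R%:E)%E.
  by apply: nneseries_ge0 => r _ _.
have finr q : (\sum_(r <oo) \sum_(j <oo) (tail_term q r j t * a)%R%:E < +oo)%E.
  by apply: le_lt_trans fin; exact: (nneseries_term_le q r0).
have finj q r : (\sum_(j <oo) (tail_term q r j t * a)%R%:E < +oo)%E.
  by apply: le_lt_trans (finr q); exact: (nneseries_term_le r (j0 q)).
have cj q r : cvgn (series (fun j => tail_term q r j t)) /\
    (\sum_(j <oo) (tail_term q r j t * a)%R%:E =
     (limn (series (fun j => tail_term q r j t)) * a)%R%:E)%E.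
  have [h1 h2] := eseries_fin_cvg (t0 q r) (finj q r).
  by have [h3 h4] := unscale _ h1; split => //; rewrite h2 h4.
have lj0 q r : 0 <= limn (series (fun j => tail_term q r j t)) * a.
  by rewrite -lee_fin -(cj q r).2.
have cr q : cvgn (series (fun r => limn (series (fun j => tail_term q r j t)))) /\
    (\sum_(r <oo) \sum_(j <oo) (tail_term q r j t * a)%R%:E =
     (limn (series (fun r => limn (series (fun j => tail_term q r j t)))) * a)%R%:E)%E.
  have := finr q; under eq_eseriesr do rewrite (cj q _).2; move=> f.
  have [h1 h2] := eseries_fin_cvg (lj0 q) f.
  by have [h3 h4] := unscale _ h1; split => //; rewrite h2 h4.
have lr0 q : 0 <= limn (series (fun r => limn (series (fun j => tail_term q r j t)))) * a.
  by rewrite -lee_fin -(cr q).2.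
split => [q r|q|]; [exact: (cj q r).1|exact: (cr q).1|].
move: fin; under eq_eseriesr do rewrite (cr _).2; move=> f.
have [h1 _] := eseries_fin_cvg lr0 f.
exact: (unscale _ h1).1.
Qed.

Definition tail_sum (e : nat -> R) (q : nat) (t : R) : R :=
  limn (series (fun r => e r * limn (series (fun j => tail_term q r j t)))).

Lemma measurable_tail_sums (e : nat -> R) (s : R) (B : set R) :
  (forall r, 0 <= e r) -> measurable_fun B (fun t => \sum_(q <oo) \sum_(r <oo)
    \sum_(j <oo) (e r * tail_term q r j t * expR (- (s * t)))%R%:E)%E.
Proof.
move=> e0.
have t0 q r j t : (0 <= (e r * tail_term q r j t * expR (- (s * t)))%R%:E)%E.
  by rewrite lee_fin; apply: mulr_ge0; rewrite ?expR_ge0// mulr_ge0 ?tail_term_ge0.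
have j0 q r t : (0 <= \sum_(j <oo) (e r * tail_term q r j t * expR (- (s * t)))%R%:E)%E.
  by apply: nneseries_ge0 => j _ _; exact: t0.
apply: ge0_emeasurable_sum => [q t _ _|q _].
  by apply: nneseries_ge0 => r _ _; exact: j0.
apply: ge0_emeasurable_sum => [r t _ _|r _]; first exact: j0.
apply: ge0_emeasurable_sum => [j t _ _|j _]; first exact: t0.
apply/measurable_funTS/measurable_EFinP; apply: measurable_funM.
  apply: measurable_funM => //; apply: measurable_funM => //.
  by apply: measurable_funM => //; exact: measurable_powR.
apply: measurableT_comp; first exact: measurable_expR.
by apply: measurableT_comp => //; exact: measurable_funM.
Qed.

Lemma dominating_rate : exists s, theta < s /\ c < s `^ alpha - theta `^ alpha.
Proof.
(* Chosen so that [s^alpha - theta^alpha = c + 1]; the summand 1 provides strictness, and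
   [theta < s] follows by monotonicity of the power. *)
pose s := (theta `^ alpha + c + 1) `^ alpha^-1.
have base0 : 0 <= theta `^ alpha + c + 1.
  by rewrite !addr_ge0 ?powR_ge0// ltW.
have sE : s `^ alpha = theta `^ alpha + c + 1.
  by rewrite -powRrM mulVf ?gt_eqF// powRr1.
have sc : c < s `^ alpha - theta `^ alpha by rewrite sE; lra.
have s0 : 0 <= s by exact: powR_ge0.
have sth : theta < s.
  rewrite ltNge; apply/negP => sth.
  have : s `^ alpha <= theta `^ alpha.
    by apply: ge0_ler_powR; rewrite ?nnegrE// ltW.
  by rewrite sE => h; have cp := c0; lra.
by exists s.
Qed.

(* The transform of the triple series is finite, so the series converges almost
   everywhere; the terms being nondecreasing in [t], it converges everywhere. *)
Lemma summable_at_all t : 0 <= t -> summable_at t.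
Proof.
move=> t0.
suff [t' [tt' [h1 h2 h3]]] : exists t', t <= t' /\ summable_at t'.
  have le1 q r j := tail_term_nd q r j t0 tt'.
  have c1 q r : cvgn (series (fun j => tail_term q r j t)).
    apply: (@series_le_cvg R (fun j => tail_term q r j t)
      (fun j => tail_term q r j t') _ _ _ (h1 q r)) => j; rewrite ?tail_term_ge0//.
  have p1 x q r : cvgn (series (fun j => tail_term q r j x)) ->
      0 <= limn (series (fun j => tail_term q r j x)).
    by apply: limn_series_ge0 => j; exact: tail_term_ge0.
  have le2 q r : limn (series (fun j => tail_term q r j t)) <=
      limn (series (fun j => tail_term q r j t')).
    exact: limn_series_le.
  have c2 q : cvgn (series (fun r => limn (series (fun j => tail_term q r j t)))).
    apply: (@series_le_cvg R (fun r => limn (series (fun j => tail_term q r j t)))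
      (fun r => limn (series (fun j => tail_term q r j t'))) _ _ _ (h2 q)) => r.
    - exact/p1/c1.
    - exact/p1/h1.
    - exact: le2.
  split; [exact: c1|exact: c2|].
  apply: (@series_le_cvg R
    (fun q => limn (series (fun r => limn (series (fun j => tail_term q r j t)))))
    (fun q => limn (series (fun r => limn (series (fun j => tail_term q r j t')))))
    _ _ _ h3) => q.
  - by apply: limn_series_ge0 => // r; exact: p1.
  - by apply: limn_series_ge0 => // r; exact: p1.
  - exact: limn_series_le.
have [s [sth sc]] := dominating_rate.
have z1 : `|c / (s `^ alpha - theta `^ alpha)| < 1.
  have d0 : 0 < s `^ alpha - theta `^ alpha := lt_trans c0 sc.
  by rewrite ger0_norm ?divr_ge0 ?(ltW c0) ?(ltW d0)// ltr_pdivrMr// mul1r.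
have hS := @cvg_geometric_series R 1 _ z1.
have := @laplace_tail_series s sth sc (fun=> 1) _ (fun=> ler01) hS.
pose H t := (\sum_(q <oo) \sum_(r <oo) \sum_(j <oo)
     (1 * tail_term q r j t * expR (- (s * t)))%R%:E)%E.
rewrite -/(H _) => intH.
have H0 x : (0 <= H x)%E.
  do 3 (apply: nneseries_ge0 => ? _ _).
  by rewrite lee_fin mul1r mulr_ge0 ?expR_ge0 ?tail_term_ge0.
have mH : measurable_fun (`[0, +oo[%classic : set R) H.
  by apply: measurable_tail_sums.
have iH : mu.-integrable `[0, +oo[ H.
  apply/integrableP; split => //.
  under eq_integral do rewrite gee0_abs//.
  by rewrite intH ltry.
have [N [mN N0 Nsub]] : {ae mu, forall x, `[0%R, +oo[%classic x ->
    H x \is a fin_num}.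
  by apply: (integrable_ae _ iH).
(* The exceptional set is null, so it cannot contain the interval [[t, t + 1]] of length one. *)
have [t' tt' Nt'] : exists2 t', t <= t' & ~ N t'.
  apply: contrapT => no.
  have : (mu `[t, (t + 1)%R] <= mu N)%E.
    apply: le_measure; rewrite ?inE//.
    move=> x; rewrite /= in_itv/= => /andP[tx _]; apply: contrapT => Nx.
    by apply: no; exists x.
  rewrite N0 lebesgue_measure_itv/= lte_fin ltrDl ltr01 -EFinB lee_fin.
  by rewrite addrAC subrr add0r ler10.
exists t'; split => //; apply: (summable_at_of_fin (expR_gt0 (- (s * t')))).
have Ht' : H t' \is a fin_num.
  apply: contrapT => h; apply: Nt'; apply: Nsub => /= h'; apply: h; apply: h'.
  by rewrite in_itv/= andbT (le_trans t0).
move: Ht'; rewrite ge0_fin_numE// /H.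
by under eq_eseriesr do (under eq_eseriesr do (under eq_eseriesr do rewrite mul1r)).
Qed.

Section weights.
Variable e : nat -> R.
Hypothesis e01 : forall r, 0 <= e r <= 1.

Let e0 r : 0 <= e r. Proof. by have /andP[] := e01 r. Qed.

Lemma cvg_tail_inner q t : 0 <= t ->
  cvgn (series (fun r => e r * limn (series (fun j => tail_term q r j t)))).
Proof.
move=> /summable_at_all[h1 h2 _].
have p r : 0 <= limn (series (fun j => tail_term q r j t)).
  by apply: limn_series_ge0 => // j; exact: tail_term_ge0.
apply: (@series_le_cvg R (fun r => e r * limn (series (fun j => tail_term q r j t)))
  (fun r => limn (series (fun j => tail_term q r j t))) _ _ _ (h2 q)) => r //.
  exact: mulr_ge0.
by rewrite ler_piMl//; have /andP[] := e01 r.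
Qed.

Lemma tail_sum_ge0 q t : 0 <= t -> 0 <= tail_sum e q t.
Proof.
move=> t0; apply: limn_series_ge0; last exact: cvg_tail_inner.
move=> r; apply: mulr_ge0 => //; apply: limn_series_ge0.
  by move=> j; exact: tail_term_ge0.
by have [h _ _] := summable_at_all t0.
Qed.

Lemma cvg_tail_outer t : 0 <= t -> cvgn (series (fun q => tail_sum e q t)).
Proof.
move=> t0; have [h1 h2 h3] := summable_at_all t0.
apply: (@series_le_cvg R (fun q => tail_sum e q t)
  (fun q => limn (series (fun r => limn (series (fun j => tail_term q r j t)))))
  _ _ _ h3) => q.
- exact: tail_sum_ge0.
- apply: limn_series_ge0 => // r; apply: limn_series_ge0 => // j.
  exact: tail_term_ge0.
- apply: limn_series_le => //; last exact: cvg_tail_inner.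
  move=> r; rewrite ler_piMl//; last by have /andP[] := e01 r.
  by apply: limn_series_ge0 => // j; exact: tail_term_ge0.
Qed.

(** [series_right_continuous] is applied from the innermost sum outwards, once per level; each level
    hands on nonnegativity, monotonicity and right continuity to the next. *)
Lemma tail_total_right_continuous t : 0 <= t ->
  limn (series (fun q => tail_sum e q x)) @[x --> t^'+] -->
  limn (series (fun q => tail_sum e q t)).
Proof.
have s1 q r x : 0 <= x -> cvgn (series (fun j => tail_term q r j x)).
  by move=> x0; have [] := summable_at_all x0.
have nd1 q r x y : 0 <= x -> x <= y ->
    e r * limn (series (fun j => tail_term q r j x)) <=
    e r * limn (series (fun j => tail_term q r j y)).
  move=> x0 xy; apply: ler_wpM2l => //; apply: limn_series_le.
  - by move=> j; exact: tail_term_nd.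
  - exact: s1.
  - exact/s1/(le_trans x0).
have rc1 q r x : 0 <= x -> e r * limn (series (fun j => tail_term q r j y))
    @[y --> x^'+] --> e r * limn (series (fun j => tail_term q r j x)).
  move=> x0; apply: cvgMr.
  exact: (@series_right_continuous R (fun j t => tail_term q r j t)
    (fun j y _ => tail_term_ge0 q r j y) (fun j y y' => @tail_term_nd q r j y y')
    (fun j y => @tail_term_right_continuous q r j y) (s1 q r) x x0).
have p1 q r x : 0 <= x -> 0 <= e r * limn (series (fun j => tail_term q r j x)).
  move=> x0; apply: mulr_ge0 => //; apply: limn_series_ge0; last exact: s1.
  by move=> j; exact: tail_term_ge0.
have nd2 q x y : 0 <= x -> x <= y -> tail_sum e q x <= tail_sum e q y.
  move=> x0 xy; apply: limn_series_le; first by move=> r; exact: nd1.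
    exact: cvg_tail_inner.
  exact/cvg_tail_inner/(le_trans x0).
have rc2 q x : 0 <= x -> tail_sum e q y @[y --> x^'+] --> tail_sum e q x.
  exact: (@series_right_continuous R
    (fun r t => e r * limn (series (fun j => tail_term q r j t)))
    (fun r y => @p1 q r y) (fun r y y' => @nd1 q r y y') (fun r y => @rc1 q r y)
    (fun y => @cvg_tail_inner q y)).
exact: (@series_right_continuous R (fun q t => tail_sum e q t)
  (fun q y => @tail_sum_ge0 q y) nd2 rc2 cvg_tail_outer).
Qed.

Lemma tail_totalE (a t : R) : 0 <= t ->
  (\sum_(q <oo) \sum_(r <oo) \sum_(j <oo) (e r * tail_term q r j t * a)%R%:E =
   (limn (series (fun q => tail_sum e q t)) * a)%R%:E)%E.
Proof.
move=> t0; have [h1 h2 h3] := summable_at_all t0.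
have scale (u : nat -> R) b : cvgn (series u) ->
    (\sum_(n <oo) (u n * b)%R%:E = (limn (series u) * b)%R%:E)%E.
  move=> cu; apply: eseries_EFin; rewrite mulrC.
  rewrite (_ : (fun n => u n * b) = fun n => b * u n); first exact: cvg_series_scale.
  by apply/funext => n; rewrite mulrC.
transitivity (\sum_(q <oo) (tail_sum e q t * a)%R%:E)%E.
  apply: eq_eseriesr => q _; rewrite -scale; last exact: cvg_tail_inner.
  apply: eq_eseriesr => r _; rewrite mulrAC [RHS](_ : _ =
    (limn (series (fun j => tail_term q r j t)) * (e r * a))%R%:E); last first.
    by congr EFin; ring.
  rewrite -scale//; apply: eq_eseriesr => j _; congr EFin; ring.
by apply: scale; exact: cvg_tail_outer.
Qed.

End weights.

End tail_series.

(** * From equal transforms on the half-line to equality at every point *)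

Section half_line.
Context (R : realType).
Local Notation mu := (@lebesgue_measure R).
Implicit Types f : R -> R.

Lemma laplace_density_unique f1 f2 :
  measurable_fun (`[0, +oo[%classic : set R) f1 ->
  measurable_fun (`[0, +oo[%classic : set R) f2 ->
  (forall x, 0 <= x -> 0 <= f1 x) -> (forall x, 0 <= x -> 0 <= f2 x) ->
  (\int[mu]_(x in `[0%R, +oo[) (f1 x)%:E < +oo)%E ->
  (forall n : nat,
    (\int[mu]_(x in `[0%R, +oo[) (expR (- (n%:R * x)) * f1 x)%R%:E =
     \int[mu]_(x in `[0%R, +oo[) (expR (- (n%:R * x)) * f2 x)%R%:E)%E) ->
  {ae mu, forall x, 0 <= x -> f1 x = f2 x}.
Proof.
move=> mf1 mf2 f10 f20 fin fE.
pose I := `[0%R : R, +oo[%classic.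
have Ipos (x : R) : (x \in I) = (0 <= x).
  by apply/idP/idP; rewrite inE /I /= in_itv/= andbT.
pose W f x := \1_I x * f x.
have mW f : measurable_fun (I : set R) f -> measurable_fun (setT : set R) (W f).
  move=> mf; rewrite (_ : W f = f \_ I).
    by apply/(measurable_restrictT _ _).1 => //; exact: measurable_itv.
  apply/funext => x; rewrite /W patchE indicE.
  by case: ifPn => _; rewrite ?mul1r ?mul0r.
have W0 f : (forall x, 0 <= x -> 0 <= f x) -> forall x, 0 <= W f x.
  move=> f0 x; rewrite /W indicE Ipos; case: (leP 0 x) => [/f0 h|_].
    by rewrite mul1r.
  by rewrite mul0r.
have WI f (g : R -> R) : (\int[mu]_x (g x * W f x)%R%:E =
    \int[mu]_(x in `[0%R, +oo[) (g x * f x)%R%:E)%E.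
  rewrite [RHS]integral_mkcond; apply: eq_integral => x _; rewrite patchE /W indicE.
  by case: ifPn => _; rewrite ?mul1r ?mul0r ?mulr0.
have [nu1 [nu1E nu1I]] := density_measure mu (mW _ mf1) (W0 _ f10).
have [nu2 [nu2E nu2I]] := density_measure mu (mW _ mf2) (W0 _ f20).
have e1 f : (\int[mu]_x (W f x)%:E = \int[mu]_(x in `[0%R, +oo[) (f x)%:E)%E.
  have := WI f (cst 1) => h; transitivity (\int[mu]_x (cst 1 x * W f x)%R%:E)%E.
    by apply: eq_integral => x _; rewrite /= mul1r.
  by rewrite h; apply: eq_integral => x _; rewrite /= mul1r.
have fin2 : (\int[mu]_(x in `[0%R, +oo[) (f2 x)%:E < +oo)%E.
  have := fE 0%N.
  rewrite (_ : (\int[mu]_(x in _) (_ * f1 x)%R%:E =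
    \int[mu]_(x in `[0%R, +oo[) (f1 x)%:E)%E); last first.
    by apply: eq_integral => x _; rewrite mul0r oppr0 expR0 mul1r.
  rewrite (_ : (\int[mu]_(x in _) (_ * f2 x)%R%:E =
    \int[mu]_(x in `[0%R, +oo[) (f2 x)%:E)%E); last first.
    by apply: eq_integral => x _; rewrite mul0r oppr0 expR0 mul1r.
  by move=> <-.
have mexp (n : nat) : measurable_fun setT (fun x : R => expR (- (n%:R * `|x|))).
  apply: measurableT_comp; first exact: measurable_expR.
  by apply: measurableT_comp => //; apply: measurable_funM => //; exact: normr_measurable.
(* The uniqueness lemma asks for a variable that is nonnegative everywhere. The absolute value is
   one, and the densities vanish on the negative axis, so the reflected part of a preimage has no
   mass. *)
have uniq := @laplace_measure_unique _ _ R nu1 nu2 (fun x : R => `|x|).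
have {}uniq B : measurable B -> nu1 ((fun x : R => `|x|) @^-1` B) =
    nu2 ((fun x : R => `|x|) @^-1` B).
  apply: uniq.
  - by rewrite nu1E// e1.
  - by rewrite nu2E// e1.
  - exact: normr_measurable.
  - by move=> x; exact: normr_ge0.
  - move=> n; rewrite nu1I ?nu2I//; try exact: mexp; try by move=> x; exact: expR_ge0.
    have ab f : (\int[mu]_x (expR (- (n%:R * `|x|)) * W f x)%R%:E =
        \int[mu]_(x in `[0%R, +oo[) (expR (- (n%:R * x)) * f x)%R%:E)%E.
      rewrite (WI f (fun x => expR (- (n%:R * `|x|)))).
      apply: eq_integral => x; rewrite inE/= in_itv/= andbT => x0.
      by rewrite ger0_norm.
    by rewrite !ab.
have mI : measurable (I : set R) by exact: measurable_itv.
have eqE (E : set R) : E `<=` I -> measurable E ->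
    (\int[mu]_(x in E) (f1 x)%:E = \int[mu]_(x in E) (f2 x)%:E)%E.
  move=> EI mE.
  pose nE := (fun x : R => `|x|) @^-1` E.
  have mN : measurable nE.
    by rewrite -[X in measurable X]setTI; exact: (normr_measurable measurableT mE).
  have restr f : (\int[mu]_(x in nE) (W f x)%:E =
      \int[mu]_(x in E) (f x)%:E)%E.
    rewrite integral_mkcond [RHS]integral_mkcond; apply: eq_integral => x _.
    rewrite !patchE /W indicE Ipos; have [x0|x0] := leP 0 x.
      rewrite mul1r (_ : (x \in nE) = (x \in E))//.
      by apply/idP/idP; rewrite !inE /nE /= ger0_norm.
    rewrite mul0r [X in _ = if X then _ else _]memNset; first by case: ifP.
    by move=> /EI; rewrite /I /= in_itv/= andbT leNgt x0.
  by rewrite -!restr -nu1E// -nu2E//; exact: uniq.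
have int1 : mu.-integrable I (EFin \o f1).
  apply/integrableP; split; first exact/measurable_EFinP.
  rewrite (_ : (\int[mu]_(x in I) _ = \int[mu]_(x in `[0%R, +oo[) (f1 x)%:E)%E)//.
  apply: eq_integral => x; rewrite Ipos => x0.
  by rewrite /= ger0_norm// f10.
have ae : ae_eq mu I (EFin \o f1) (EFin \o f2).
  apply: integral_ae_eq => //; first exact/measurable_EFinP.
apply: filterS ae => x h x0.
by have := h; rewrite /I /= in_itv/= x0 => /(_ isT) [].
Qed.

(** If the values differed at [t], right continuity would make them differ on an open interval to
    the right of [t], and a null set would contain an interval of positive length. *)
Lemma ae_eq_right_continuous f1 f2 t : 0 <= t ->
  {ae mu, forall x, 0 <= x -> f1 x = f2 x} ->
  f1 x @[x --> t^'+] --> f1 t -> f2 x @[x --> t^'+] --> f2 t -> f1 t = f2 t.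
Proof.
move=> t0 [N [mN N0 Nsub]] c1 c2.
apply/eqP; rewrite -subr_eq0; apply/negPn/negP => ne.
have c : (f1 x - f2 x) @[x --> t^'+] --> f1 t - f2 t by exact: cvgB.
have : \forall x \near t^'+, f1 x - f2 x != 0.
  have ne0 : 0 < `|f1 t - f2 t| by rewrite normr_gt0.
  move/cvgrPdist_lt : c => /(_ _ ne0).
  apply: filterS => x; apply: contraTN => /eqP ->.
  by rewrite subr0 ltxx.
move=> [e /= e0 he].
have sub : `]t, (t + e)[%classic `<=` N.
  move=> x /=; rewrite in_itv/= => /andP[tx xe]; apply: Nsub => /= h.
  have /eqP : f1 x - f2 x != 0.
    apply: he => //=; rewrite ltr0_norm ?subr_lt0// opprB.
    by rewrite ltrBlDr addrC.
  by apply; rewrite h ?subrr// (le_trans t0)// ltW.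
have : (mu `](t : R), (t + e)%R[ <= mu N)%E by apply: le_measure; rewrite ?inE.
rewrite N0 lebesgue_measure_itv/= lte_fin ltrDl e0 -EFinB lee_fin.
by rewrite addrAC subrr add0r leNgt e0.
Qed.

End half_line.

(** * Return to the Mittag-Leffler form with signs *)

Section mittag_leffler_form.
Context (R : realType).
Variables (theta alpha c : R).
Hypotheses (theta0 : 0 < theta) (alpha0 : 0 < alpha) (c0 : 0 < c).

Definition even_weight (r : nat) : R := (~~ odd r)%:R.
Definition odd_weight (r : nat) : R := (odd r)%:R.

Lemma even_weight01 r : 0 <= even_weight r <= 1.
Proof. by rewrite /even_weight; case: (odd r); rewrite /= ?lexx ?ler01. Qed.

Lemma odd_weight01 r : 0 <= odd_weight r <= 1.
Proof. by rewrite /odd_weight; case: (odd r); rewrite /= ?lexx ?ler01. Qed.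

Lemma sign_weights (x : R) r :
  (- x) ^+ r = even_weight r * x ^+ r - odd_weight r * x ^+ r.
Proof.
rewrite exprNn -signr_odd /even_weight /odd_weight; case: (odd r) => /=.
  by rewrite expr1; ring.
by rewrite expr0; ring.
Qed.

Local Notation term := (tail_term theta alpha c).
Local Notation total e t := (limn (series (fun q => tail_sum theta alpha c e q t))).

Let ml_term (q r j : nat) (t : R) : R :=
  poch r%:R j * (theta `^ alpha * t `^ alpha) ^+ j /
    (j`!%:R * Gamma (alpha * j%:R + (r%:R * alpha + q%:R + 1))).

Let ml (q r : nat) (t : R) : R :=
  ML3 alpha (r%:R * alpha + q%:R + 1) r%:R (theta `^ alpha * t `^ alpha).

Let mlE q r t : ml q r t = limn (series (fun j => ml_term q r j t)).
Proof. by []. Qed.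

Let Gam_gt0 q r j : 0 < Gamma (alpha * j%:R + (r%:R * alpha + q%:R + 1)).
Proof. apply: Gamma_gt0; exact: (tail_exponent_ge1 alpha0 q r j). Qed.

Let poch_ge0 (r j : nat) : 0 <= poch (r%:R : R) j.
Proof. by apply: prodr_ge0 => i _; rewrite addr_ge0. Qed.

Let ml_term_ge0 q r j t : 0 <= ml_term q r j t.
Proof.
apply: divr_ge0; last by rewrite mulr_ge0// ltW.
by apply: mulr_ge0 => //; rewrite exprn_ge0// mulr_ge0// powR_ge0.
Qed.

Let ml_term_nd q r j s t : 0 <= s -> s <= t -> ml_term q r j s <= ml_term q r j t.
Proof.
move=> s0 st; rewrite /ml_term ler_pM2r ?invr_gt0 ?mulr_gt0 ?ltr0n ?fact_gt0//.
apply: ler_wpM2l => //; apply: lerXn2r; rewrite ?nnegrE ?mulr_ge0 ?powR_ge0//.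
apply: ler_wpM2l; first exact: powR_ge0.
apply: ge0_ler_powR; rewrite ?nnegrE ?(ltW alpha0)//; exact: le_trans st.
Qed.

Let unscale (u : nat -> R) (b : R) : b != 0 ->
  cvgn (series (fun n => b * u n)) -> cvgn (series u).
Proof.
move=> b0 cu; rewrite (_ : series u = series (fun n => b^-1 * (b * u n))).
  by apply: cvgP; exact: cvg_series_scale.
by congr series; apply/funext => n; rewrite mulKf.
Qed.

Let scale_gt0 q r t : 0 < t -> (theta * t) ^+ q * (c * t `^ alpha) ^+ r != 0.
Proof.
move=> t0; apply: lt0r_neq0; apply: mulr_gt0; apply: exprn_gt0; apply: mulr_gt0 => //.
exact: powR_gt0.
Qed.

Let cvg_ml q r t : 0 <= t -> cvgn (series (fun j => ml_term q r j t)).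
Proof.
(* At [t = 0] the prefactor [(theta t)^q (c t^alpha)^r] may vanish and cannot be divided out of
   [tail_term]. Convergence is obtained at [t + 1] and brought back to [t] by monotonicity. *)
move=> t0; have t1 : 0 < t + 1 by rewrite ltr_wpDl.
have c1 : cvgn (series (fun j => ml_term q r j (t + 1))).
  apply: (unscale (scale_gt0 q r t1)).
  have [h _ _] := summable_at_all theta0 alpha0 c0 (ltW t1).
  rewrite (_ : (fun n => _) = fun j => term q r j (t + 1)); first exact: h.
  by apply/funext => j; rewrite tail_termE// ltW.
apply: (@series_le_cvg R (fun j => ml_term q r j t)
  (fun j => ml_term q r j (t + 1)) _ _ _ c1) => j.
- exact: ml_term_ge0.
- exact: ml_term_ge0.
- by apply: ml_term_nd => //; rewrite lerDl.
Qed.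

Let ml_ge0 q r t : 0 <= t -> 0 <= ml q r t.
Proof.
move=> t0; rewrite mlE; apply: limn_series_ge0; last exact: cvg_ml.
by move=> j; exact: ml_term_ge0.
Qed.

Let inner_abs (q r : nat) (t : R) : R := (c * t `^ alpha) ^+ r * ml q r t.

Let limn_term q r t : 0 <= t ->
  limn (series (fun j => term q r j t)) = (theta * t) ^+ q * inner_abs q r t.
Proof.
move=> t0; rewrite /inner_abs mulrA mlE; apply/cvg_lim => //.
rewrite (_ : (fun j => _) = fun j =>
  ((theta * t) ^+ q * (c * t `^ alpha) ^+ r) * ml_term q r j t).
  by apply: cvg_series_scale; exact: cvg_ml.
by apply/funext => j; rewrite tail_termE.
Qed.

Let inner_abs_ge0 q r t : 0 <= t -> 0 <= inner_abs q r t.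
Proof.
move=> t0; apply: mulr_ge0; last exact: ml_ge0.
by apply: exprn_ge0; rewrite mulr_ge0 ?powR_ge0// ltW.
Qed.

Let cvg_inner_abs q t : 0 <= t -> cvgn (series (fun r => inner_abs q r t)).
Proof.
(* The same detour through [t + 1], here to divide by [(theta t)^q]. *)
move=> t0; have t1 : 0 < t + 1 by rewrite ltr_wpDl.
have tt1 : t <= t + 1 by rewrite lerDl.
have c1 : cvgn (series (fun r => inner_abs q r (t + 1))).
  apply: (@unscale _ ((theta * (t + 1)) ^+ q)).
    by apply: lt0r_neq0; apply: exprn_gt0; exact: mulr_gt0.
  have [_ h _] := summable_at_all theta0 alpha0 c0 (ltW t1).
  rewrite (_ : (fun n => _) = fun r => limn (series (fun j => term q r j (t + 1)))).
    exact: h.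
  by apply/funext => r; rewrite limn_term// ltW.
apply: (@series_le_cvg R (fun r => inner_abs q r t)
  (fun r => inner_abs q r (t + 1)) _ _ _ c1) => r.
- exact: inner_abs_ge0.
- exact/inner_abs_ge0/ltW.
- apply: ler_pM; [|exact: ml_ge0| |].
  + by apply: exprn_ge0; rewrite mulr_ge0 ?powR_ge0// ltW.
  + apply: lerXn2r; rewrite ?nnegrE ?mulr_ge0 ?powR_ge0 ?(ltW c0)//.
    apply: ler_wpM2l; first exact: ltW.
    by apply: ge0_ler_powR; rewrite ?nnegrE ?(ltW alpha0) ?(ltW t1).
  + rewrite !mlE; apply: limn_series_le.
    * by move=> j; exact: ml_term_nd.
    * exact: cvg_ml.
    * exact/cvg_ml/ltW.
Qed.

Let cvg_weighted (e : nat -> R) q t : (forall r, 0 <= e r <= 1) -> 0 <= t ->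
  cvgn (series (fun r => e r * inner_abs q r t)).
Proof.
move=> e01 t0; have c1 : cvgn (series (fun r => inner_abs q r t)) by exact: cvg_inner_abs.
have e0 r : 0 <= e r by have /andP[] := e01 r.
have e1 r : e r <= 1 by have /andP[] := e01 r.
apply: (@series_le_cvg R (fun r => e r * inner_abs q r t)
  (fun r => inner_abs q r t) _ _ _ c1) => r.
- by apply: mulr_ge0 => //; exact: inner_abs_ge0.
- exact: inner_abs_ge0.
- by rewrite ler_piMl// inner_abs_ge0.
Qed.

Let tail_sumE (e : nat -> R) q t : (forall r, 0 <= e r <= 1) -> 0 <= t ->
  tail_sum theta alpha c e q t =
  (theta * t) ^+ q * limn (series (fun r => e r * inner_abs q r t)).
Proof.
move=> e01 t0; rewrite /tail_sum; apply/cvg_lim => //.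
rewrite (_ : (fun r => _) = fun r => (theta * t) ^+ q * (e r * inner_abs q r t)).
  by apply: cvg_series_scale; exact: cvg_weighted.
by apply/funext => r; rewrite limn_term// mulrCA.
Qed.

Lemma mittag_leffler_series_cvg (t : R) : 0 <= t ->
  let inner (q r : nat) : R := (- (c * t `^ alpha)) ^+ r *
    ML3 alpha (r%:R * alpha + q%:R + 1) r%:R (theta `^ alpha * t `^ alpha) in
  let outer (q : nat) : R := (theta * t) ^+ q * limn (series (inner q)) in
  (forall q, cvgn (series (inner q))) /\
  series outer @ \oo --> total even_weight t - total odd_weight t.
Proof.
move=> t0 inner outer.
have innerE q : inner q = fun r =>
    even_weight r * inner_abs q r t - odd_weight r * inner_abs q r t.
  by apply/funext => r; rewrite /inner sign_weights /inner_abs /ml; ring.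
have ci q : series (inner q) @ \oo -->
    limn (series (fun r => even_weight r * inner_abs q r t)) -
    limn (series (fun r => odd_weight r * inner_abs q r t)).
  rewrite innerE; apply: cvg_series_sub; apply: cvg_weighted => //.
  - exact: even_weight01.
  - exact: odd_weight01.
split=> [q|]; first exact: cvgP (ci q).
rewrite (_ : outer = fun q => tail_sum theta alpha c even_weight q t -
    tail_sum theta alpha c odd_weight q t).
  apply: cvg_series_sub; apply: cvg_tail_outer => //.
  - exact: even_weight01.
  - exact: odd_weight01.
apply/funext => q; rewrite /outer (cvg_lim _ (ci q))// mulrBr.
by rewrite !tail_sumE//; [exact: odd_weight01|exact: even_weight01].
Qed.

End mittag_leffler_form.

(** * The law of an inter-phase time *)

Section tail_identity.
Context d (Omega : measurableType d) (R : realType) (P : probability Omega R).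
Variables (theta alpha c : R) (X : Omega -> R).
Hypotheses (theta0 : 0 < theta) (alpha0 : 0 < alpha) (c0 : 0 < c).
Hypotheses (mX : measurable_fun setT X) (X0 : forall w, 0 <= X w).
Local Notation mu := (@lebesgue_measure R).
Local Notation phi := (laplace_exponent theta alpha).
Local Notation total e t := (limn (series (fun q => tail_sum theta alpha c e q t))).
Local Notation ev := (@even_weight R).
Local Notation od := (@odd_weight R).

Let tail (t : R) : R := fine (P [set w | t < X w]).

Let tailE t : P [set w | t < X w] = (tail t)%:E.
Proof. by rewrite /tail fineK// fin_num_measure//; exact: measurable_gt_event. Qed.

Let tail_ge0 t : 0 <= tail t. Proof. exact: fine_ge0. Qed.

Let measurable_tail : measurable_fun setT tail.
Proof.
pose A := [set z : R * Omega | z.1 < X z.2].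
have mXs : measurable_fun setT (fun z : R * Omega => X z.2).
  exact: (measurableT_comp mX measurable_snd).
have mA : measurable A.
  rewrite (_ : A = (fun z => X z.2 - z.1) @^-1` `]0, +oo[).
    rewrite -[X in measurable X]setTI.
    exact: ((measurable_funB mXs measurable_fst) measurableT _
      (measurable_itv `]0, +oo[)).
  by apply/seteqP; split=> z; rewrite /A /= in_itv/= andbT subr_gt0.
have := measurable_fun_xsection P mA.
have -> : P \o xsection A = EFin \o tail.
  apply/funext => t /=; rewrite -tailE; congr (P _).
  by apply/seteqP; split=> w; rewrite /xsection /= inE.
by move=> /measurable_EFinP.
Qed.

(** As [u n] decreases to [t], the indicators of [u n < X] converge pointwise to that of [t < X],
    because the inequality is strict; bounded convergence concludes. *)
Lemma tail_right_continuous t : tail x @[x --> t^'+] --> tail t.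
Proof.
apply/cvg_at_rightP => u [ut cu].
have fin : (P setT < +oo)%E by rewrite probability_setT ltry.
have mI x : measurable_fun setT (\1_[set w | x < X w] : Omega -> R).
  by apply: measurable_indic; exact: measurable_gt_event.
have tI x : (tail x)%:E = (\int[P]_w (\1_[set w | x < X w] w)%:E)%E.
  by rewrite integral_indic ?setIT -?tailE//; exact: measurable_gt_event.
have := @bounded_cvg_integral _ _ _ P (fun n => \1_[set w | u n < X w])
  \1_[set w | t < X w] 1 fin (fun n => mI (u n)) (mI t).
rewrite -tI (_ : (fun n => _) = fun n => (tail (u n))%:E); last first.
  by apply/funext => n; rewrite tI.
move=> h; apply: (@fine_cvg R nat (nbhs \oo) _ (fun n => (tail (u n))%:E) (tail t)).
apply: h.
- apply: aeW => w; have [tw|wt] := ltP t (X w).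
    apply: cvg_near_cst.
    have : \forall n \near \oo, u n < X w by exact: (cvgr_lt t).
    apply: filterS => n h; rewrite !indicE !mem_set//.
  apply: cvg_near_cst; apply: nearW => n; rewrite !indicE !memNset//=.
    by apply/negP; rewrite -leNgt.
  by apply/negP; rewrite -leNgt (le_trans wt)// ltW.
- by move=> n w; rewrite indicE; case: (_ \in _); rewrite ?normr1 ?normr0.
Qed.

Hypothesis laplaceX : forall u, 0 <= u ->
  Ex P (fun w => expR (- (u * X w))) = c / (c + phi u).

Section rate.
Variable s : R.
Hypotheses (s_theta : theta < s) (s_c : c < s `^ alpha - theta `^ alpha).
Let z : R := c / (s `^ alpha - theta `^ alpha).
Let den0 : 0 < s `^ alpha - theta `^ alpha. Proof. exact: lt_trans s_c. Qed.

Let integral_total (e : nat -> R) (S : R) : (forall r, 0 <= e r <= 1) ->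
  series (fun r => e r * z ^+ r) @ \oo --> S ->
  (\int[mu]_(t in `[0%R, +oo[) (total e t * expR (- (s * t)))%R%:E =
   (S / (s - theta))%R%:E)%E.
Proof.
move=> e01 eS; rewrite -(laplace_tail_series theta0 alpha0 c0 s_theta s_c _ eS).
  apply: eq_integral => t; rewrite inE/= in_itv/= andbT => t0.
  by rewrite (tail_totalE theta0 alpha0 c0 e01).
by move=> r; have /andP[] := e01 r.
Qed.

Let z01 : 0 <= z < 1.
Proof.
rewrite /z divr_ge0 ?(ltW c0) ?(ltW den0)//=.
by rewrite ltr_pdivrMr// mul1r.
Qed.

Let cvg_weight (e : nat -> R) : (forall r, 0 <= e r <= 1) ->
  cvgn (series (fun r => e r * z ^+ r)).
Proof.
have /andP[z0 z1] := z01.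
move=> e01; apply: (@series_le_cvg R (fun r => e r * z ^+ r) (fun r => z ^+ r)) => [r|r|r|].
- by apply: mulr_ge0; [have /andP[] := e01 r|exact: exprn_ge0].
- exact: exprn_ge0.
- by rewrite ler_piMl ?exprn_ge0//; have /andP[] := e01 r.
- have zn : `|z| < 1 by rewrite ger0_norm.
  have := cvgP _ (@cvg_geometric_series R 1 z zn).
  by rewrite (_ : geometric 1 z = fun r => z ^+ r)//; apply/funext => r; rewrite /= mul1r.
Qed.

Lemma laplace_tail_balance :
  (\int[mu]_(t in `[0%R, +oo[) (expR (- (s * t)) * (tail t * expR (theta * t)))%R%:E +
   \int[mu]_(t in `[0%R, +oo[) (total od t * expR (- (s * t)))%R%:E =
   \int[mu]_(t in `[0%R, +oo[) (total ev t * expR (- (s * t)))%R%:E)%E /\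
  (\int[mu]_(t in `[0%R, +oo[) (total ev t * expR (- (s * t)))%R%:E < +oo)%E.
Proof.
have /andP[z0 z1] := z01.
have ceS := cvg_weight (@even_weight01 R).
have coS := cvg_weight (@odd_weight01 R).
rewrite (integral_total (@even_weight01 R) ceS) (integral_total (@odd_weight01 R) coS).
split; last exact: ltry.
set Se := limn (series (fun r => ev r * z ^+ r)).
set So := limn (series (fun r => od r * z ^+ r)).
(* Even part minus odd part is the geometric series at [- z]. Its sum is the factor
   [1 - c / (c + phi (s - theta))] of the tail transform, since
   [phi (s - theta) = s^alpha - theta^alpha]. *)
have SeSo : Se - So = (1 + z)^-1.
  have zn : `|- z| < 1 by rewrite normrN ger0_norm.
  have h1 := @cvg_geometric_series R 1 (- z) zn.
  have h2 := cvg_series_sub ceS coS.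
  have e : geometric 1 (- z) = fun n => ev n * z ^+ n - od n * z ^+ n.
    by apply/funext => r; rewrite /= mul1r sign_weights.
  rewrite e opprK mul1r in h1.
  by rewrite -(cvg_lim _ h1)// -(cvg_lim _ h2).
have st0 : 0 < s - theta by rewrite subr_gt0.
rewrite (_ : (\int[mu]_(t in _) _ = ((1 - Ex P (fun w =>
    expR (- ((s - theta) * X w)))) / (s - theta))%R%:E)%E); last first.
  rewrite -laplace_tail//; apply: eq_integral => t _.
  rewrite tailE -EFinM; congr EFin.
  rewrite mulrCA -expRD mulrC; congr (expR _ * _); ring.
rewrite laplaceX ?(ltW st0)// /laplace_exponent subrK -EFinD; congr EFin.
rewrite -mulrDl; congr (_ / _).
have -> : Se = So + (1 + z)^-1 by rewrite -SeSo addrC subrK.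
rewrite addrC; congr (_ + _); rewrite /z; field.
have d0 := den0; have cc := c0.
by rewrite !gt_eqF//; lra.
Qed.

End rate.

Lemma tail_balance t : 0 <= t ->
  tail t * expR (theta * t) + total od t = total ev t.
Proof.
have [s0 [s0t s0c]] := dominating_rate theta0 alpha0 c0.
have rate (n : nat) : theta < s0 + n%:R /\
    c < (s0 + n%:R) `^ alpha - theta `^ alpha.
  have s00 : 0 <= s0 by apply: ltW; exact: lt_trans s0t.
  have n0 : 0 <= n%:R :> R by [].
  split; first by apply: lt_le_trans s0t _; rewrite lerDl.
  apply: lt_le_trans s0c _; rewrite lerD2r.
  by apply: ge0_ler_powR; rewrite ?nnegrE ?addr_ge0 ?lerDl// ltW.
have evb := @even_weight01 R; have odb := @odd_weight01 R.
have ge0_total e : (forall r, 0 <= e r <= 1) -> forall x, 0 <= x -> 0 <= total e x.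
  move=> e01 x x0; apply: limn_series_ge0; last exact: (cvg_tail_outer theta0 alpha0 c0 e01).
  by move=> q; exact: (tail_sum_ge0 theta0 alpha0 c0 e01).
have m_total e u : (forall r, 0 <= e r <= 1) ->
    measurable_fun (`[0, +oo[%classic : set R) (fun x => total e x * expR (- (u * x))).
  move=> e01; apply/measurable_EFinP.
  apply: (@eq_measurable_fun _ _ _ _ _ (fun x => \sum_(q <oo) \sum_(r <oo)
      \sum_(j <oo) (e r * tail_term theta alpha c q r j x * expR (- (u * x)))%R%:E)%E).
    move=> x; rewrite inE/= in_itv/= andbT => x0.
    by rewrite (tail_totalE theta0 alpha0 c0 e01).
  by apply: measurable_tail_sums => // r; have /andP[] := e01 r.
have m_exp (u : R) : measurable_fun (`[0, +oo[%classic : set R) (fun x => expR (u * x)).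
  apply: measurable_funTS; apply: measurableT_comp; first exact: measurable_expR.
  exact: measurable_funM.
have m_tail u : measurable_fun (`[0, +oo[%classic : set R)
    (fun x => expR (- (u * x)) * (tail x * expR (theta * x))).
  apply: measurable_funM.
    rewrite (_ : (fun x => _) = fun x => expR ((- u) * x)); first exact: m_exp.
    by apply/funext => x; rewrite mulNr.
  apply: measurable_funM; last exact: m_exp.
  exact: measurable_funTS.
pose f1 x := expR (- (s0 * x)) * (tail x * expR (theta * x)) +
  total od x * expR (- (s0 * x)).
pose f2 x := total ev x * expR (- (s0 * x)).
have fE n : (\int[mu]_(x in `[0%R, +oo[) (expR (- (n%:R * x)) * f1 x)%R%:E =
    \int[mu]_(x in `[0%R, +oo[) (expR (- (n%:R * x)) * f2 x)%R%:E)%E.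
  have [sn cn] := rate n.
  have [balance _] := laplace_tail_balance sn cn.
  have expE x : expR (- (n%:R * x)) * expR (- (s0 * x)) = expR (- ((s0 + n%:R) * x)).
    by rewrite -expRD; congr expR; ring.
  transitivity (\int[mu]_(t in `[0%R, +oo[)
      (total ev t * expR (- ((s0 + n%:R) * t)))%R%:E)%E; last first.
    by apply: eq_integral => x _; rewrite /f2 mulrCA expE.
  rewrite -balance -ge0_integralD//.
  - apply: eq_integral => x _; rewrite -EFinD; congr EFin.
    rewrite /f1 -(expE x); ring.
  - by move=> x _; rewrite lee_fin mulr_ge0// mulr_ge0.
  - by apply: (measurable_EFinP _ _).2; exact: m_tail.
  - move=> x; rewrite /= in_itv/= andbT => x0.
    by rewrite lee_fin mulr_ge0//; exact: ge0_total.
  - by apply: (measurable_EFinP _ _).2; exact: m_total.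
have fin : (\int[mu]_(x in `[0%R, +oo[) (f2 x)%:E < +oo)%E.
  have [sn cn] := rate 0%N; have [_] := laplace_tail_balance sn cn.
  by rewrite addr0.
have fin1 : (\int[mu]_(x in `[0%R, +oo[) (f1 x)%:E < +oo)%E.
  have e f : (\int[mu]_(x in `[0%R, +oo[) (expR (- (0%:R * x)) * f x)%R%:E =
      \int[mu]_(x in `[0%R, +oo[) (f x)%:E)%E.
    by apply: eq_integral => x _; rewrite mul0r oppr0 expR0 mul1r.
  by rewrite -e (fE 0%N) e.
have mf1 : measurable_fun (`[0, +oo[%classic : set R) f1.
  by apply: measurable_funD; [exact: m_tail|exact: m_total].
have mf2 : measurable_fun (`[0, +oo[%classic : set R) f2 by exact: m_total.
have f10 x : 0 <= x -> 0 <= f1 x.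
  by move=> x0; rewrite addr_ge0// !mulr_ge0//; exact: ge0_total.
have f20 x : 0 <= x -> 0 <= f2 x.
  by move=> x0; rewrite mulr_ge0//; exact: ge0_total.
have ae := laplace_density_unique mf1 mf2 f10 f20 fin1 fE.
move=> t0; apply: (@ae_eq_right_continuous R
  (fun x => tail x * expR (theta * x) + total od x) (fun x => total ev x) t t0).
- have [N [mN N0 subN]] := ae; exists N; split=> // x ne; apply: subN => fx.
  apply: ne => x0; have e0 : expR (- (s0 * x)) != 0 by rewrite gt_eqF// expR_gt0.
  by apply: (mulIf e0); have := fx x0; rewrite /f1 /f2 mulrC -mulrDl.
- apply: cvgD; last exact: tail_total_right_continuous.
  apply: cvgM; first exact: tail_right_continuous.
  apply: cvg_at_right_filter; apply: continuous_cvg; first exact: continuous_expR.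
  exact: mulrl_continuous.
- exact: tail_total_right_continuous.
Qed.

End tail_identity.

(** * From real-valued to extended-real inter-phase times *)

Section transfer.
Context d (Omega : measurableType d) (R : realType) (P : probability Omega R).

(** Independence depends on events only up to null sets. With [EFin] for [f] it carries the result
    for the real versions over to the Lebesgue measures, which could be infinite on a null event. *)
Lemma indep_events_ae_eq (I : eqType) d' (T T' : measurableType d')
  (f : T' -> T) (X : I -> Omega -> T') (Y : I -> Omega -> T) :
  measurable_fun setT f ->
  (forall i, measurable_fun setT (X i)) -> (forall i, measurable_fun setT (Y i)) ->
  {ae P, forall w i, Y i w = f (X i w)} ->
  indep_events P (fun i => rv_events (X i)) ->
  indep_events P (fun i => rv_events (Y i)).
Proof.
move=> mf mX mY ae ind J A uJ FA.
have mpreX i C : measurable C -> measurable (X i @^-1` C).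
  by move=> mC; rewrite -[Z in measurable Z]setTI; exact: mX.
have mpreY i C : measurable C -> measurable (Y i @^-1` C).
  by move=> mC; rewrite -[Z in measurable Z]setTI; exact: mY.
have /choice[B hB] : forall i, exists B, measurable B /\
    (i \in J -> Y i @^-1` B = A i).
  move=> i; have [iJ|nJ] := boolP (i \in J).
    by have [B mB e] := FA i iJ; exists B.
  by exists setT.
have mB i : measurable (B i) by have [] := hB i.
have mC i : measurable (f @^-1` B i).
  by rewrite -[Z in measurable Z]setTI; exact: mf.
have AE i : i \in J -> P (A i) = P (X i @^-1` (f @^-1` B i)).
  move=> iJ; have [_ /(_ iJ) <-] := hB i; apply: ae_eq_event => //.
  - exact: mpreY.
  - exact: mpreX.
  - by apply: filterS ae => w h; rewrite /= h.
rewrite (eq_big_seq (fun i => P (X i @^-1` (f @^-1` B i)))); last exact: AE.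
rewrite -(ind J (fun i => X i @^-1` (f @^-1` B i)))//; last first.
  by move=> i _; exists (f @^-1` B i).
rewrite (_ : \bigcap_(i in _) A i =
    \bigcap_(i in [set i | i \in J]) (Y i @^-1` B i)); last first.
  by apply: eq_bigcapr => i /= iJ; have [_ ->] := hB i.
apply: ae_eq_event.
- by apply: measurable_bigcap_seq => i; exact: mpreY.
- by apply: measurable_bigcap_seq => i; exact: mpreX.
- apply: filterS ae => w h; split=> H i iJ; have := H i iJ; by rewrite /= h.
Qed.

End transfer.

Section inter_phase_law.
Context d (Omega : measurableType d) (R : realType) (P : probability Omega R).
Variables (k n0 : nat) (lam c theta alpha : R).
Variables (Arr Ph : nat -> Omega -> R) (D : R -> Omega -> R).
Hypotheses (c0 : 0 < c) (theta0 : 0 < theta) (alpha01 : 0 < alpha < 1).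
Hypotheses (hArr : forall j, exp_distributed P lam (Arr j))
  (hPh : forall n, exp_distributed P c (Ph n)).
Hypothesis hD : tempered_subordinator P theta alpha D.
Hypothesis ind : indep_events P (fun i : src =>
  match i with
  | SArr j => rv_events (Arr j)
  | SPh n => rv_events (Ph n)
  | SSub => proc_events D
  end).
Local Notation phi := (laplace_exponent theta alpha).
Local Notation X := (inter_phase_real k n0 Arr Ph D).

Let alpha0 : 0 < alpha. Proof. by have /andP[] := alpha01. Qed.
Let mArr j : measurable_fun setT (Arr j). Proof. by have [] := hArr j. Qed.
Let mPh n : measurable_fun setT (Ph n). Proof. by have [] := hPh n. Qed.

Let reg_ae : {ae P, forall w, regular_path Arr Ph D w}.
Proof.
have aeA : {ae P, forall w j, 0 < Arr j w}.
  by apply/ae_foralln => j; exact: exp_distributed_pos (hArr j).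
have aeP : {ae P, forall w n, 0 < Ph n w}.
  by apply/ae_foralln => n; exact: exp_distributed_pos (hPh n).
have aeD := subordinator_unbounded theta0 alpha01 hD.
by apply: filterS3 aeA aeP aeD => w a p u; split.
Qed.

Let mX n : measurable_fun setT (X n).
Proof. exact: (measurable_inter_phase_real k n0 mArr mPh hD n). Qed.

Let X0 n w : 0 <= X n w. Proof. exact: inter_phase_real_ge0. Qed.

Lemma inter_phase_realE : {ae P, forall w n, inter_phase k n0 Arr Ph D n w = (X n w)%:E}.
Proof.
apply: filterS reg_ae => w reg n.
by rewrite /inter_phase_real (inter_phase_regular _ _ hD).
Qed.

Lemma laplace_inter_phase_prod (J : seq nat) (u : nat -> R) : uniq J ->
  (forall i, 0 <= u i) ->
  Ex P (fun w => \prod_(i <- J) expR (- (u i * X i w))) =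
  \prod_(i <- J) (c / (c + phi (u i))).
Proof.
move=> uJ u0.
pose N := (\max_(i <- J) i).+1.
have JN i : i \in J -> (i < N)%N.
  by move=> iJ; rewrite ltnS; exact: leq_bigmax_seq.
(* A zero rate makes the factor equal to 1 on both sides, as [phi 0 = 0]; an arbitrary list of
   indices is thus embedded in an initial segment of the phases. *)
pose u' i := if i \in J then u i else 0.
have u'0 i : 0 <= u' i by rewrite /u'; case: ifP.
have prodE (v : nat -> R) (g : nat -> R) : v =1 (fun i => if i \in J then g i else 1) ->
    \prod_(i < N) v i = \prod_(i <- J) g i.
  move=> vE; rewrite -(big_mkord xpredT v).
  rewrite (eq_bigr (fun i => if i \in J then g i else 1)); last by move=> i _; exact: vE.
  rewrite -big_mkcond -[LHS]big_filter; apply: perm_big; apply: uniq_perm => //.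
    by rewrite filter_uniq// iota_uniq.
  move=> i; rewrite mem_filter mem_index_iota /=.
  by case: (boolP (i \in J)) => //= /JN ->.
have := laplace_inter_phase k n0 theta0 alpha01 mArr mPh hD ind reg_ae N u'0.
rewrite (_ : (fun w => \prod_(i < N) expR (- (u' i * X i w))) =
    fun w => \prod_(i <- J) expR (- (u i * X i w))); last first.
  apply/funext => w; apply: (prodE (fun i => expR (- (u' i * X i w)))) => i.
  by rewrite /u'; case: ifP => // _; rewrite mul0r oppr0 expR0.
rewrite (_ : (fun w => \prod_(i < N) expR (- (phi (u' i) * Num.max 0 (Ph i w)))) =
    fun w => \prod_(i <- J) expR (- (phi (u i) * Num.max 0 (Ph i w)))); last first.
  apply/funext => w.
  apply: (prodE (fun i => expR (- (phi (u' i) * Num.max 0 (Ph i w))))) => i.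
  by rewrite /u'; case: ifP => // _; rewrite laplace_exponent0 mul0r oppr0 expR0.
move=> ->.
have phi0 i : 0 <= phi (u i) by exact: laplace_exponent_ge0.
have indPh : indep_events P (fun n => rv_events (Ph n)).
  by apply: (@indep_events_sub _ _ _ P _ _ SPh _ _ ind) => a b [].
pose f i x := expR (- (phi (u i) * Num.max 0 x)).
have mf i : measurable_fun setT (f i).
  apply: measurableT_comp; first exact: measurable_expR.
  by apply: measurableT_comp => //; apply: measurable_funM => //; exact: measurable_maxr.
have f1 i x : f i x <= 1.
  by rewrite -[leRHS]expR0 ler_expR oppr_le0 mulr_ge0// le_max lexx.
rewrite (@indep_product_rule _ _ _ P _ Ph f J)//; last first.
  by move=> i x; exact: expR_ge0.
by apply: eq_bigr => i _; exact: laplace_exp_distributed.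
Qed.

Lemma laplace_inter_phase_real n u : 0 <= u ->
  Ex P (fun w => expR (- (u * X n w))) = c / (c + phi u).
Proof.
move=> u0; have := @laplace_inter_phase_prod [:: n] (fun=> u) isT (fun=> u0).
rewrite big_seq1 => <-; congr Ex; apply/funext => w; by rewrite big_seq1.
Qed.

Lemma indep_inter_phase :
  indep_events P (fun n => rv_events (inter_phase k n0 Arr Ph D n)).
Proof.
apply: (@indep_events_ae_eq _ _ _ P _ _ _ _ EFin X) => //.
- by move=> n; exact: (measurable_inter_phase k n0 mArr mPh hD n).
- exact: inter_phase_realE.
- apply: laplace_indep => // J u uJ; rewrite laplace_inter_phase_prod//.
  by apply: eq_bigr => i _; rewrite laplace_inter_phase_real.
Qed.

Lemma inter_phase_tail n t :
  P [set w | (t%:E < inter_phase k n0 Arr Ph D n w)%E] = P [set w | t < X n w].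
Proof.
apply: ae_eq_event.
- have m := measurable_inter_phase k n0 mArr mPh hD n.
  have := m measurableT _ (emeasurable_itv `]t%:E, +oo[); rewrite setTI.
  congr measurable; apply/seteqP; split=> w; rewrite /= in_itv/= andbT//.
- exact: measurable_gt_event.
- by apply: filterS inter_phase_realE => w h; rewrite /= h lte_fin.
Qed.

End inter_phase_law.

Theorem theorem4p4 (d : measure_display) (Omega : measurableType d)
  (R : realType) (P : probability Omega R)
  (k : nat) (lam mu theta alpha : R) (n0 : nat)
  (Arr Ph : nat -> Omega -> R) (D : R -> Omega -> R) :
  (1 <= k)%N -> 0 < lam -> 0 < mu -> 0 < theta -> 0 < alpha < 1 ->
  (forall j, exp_distributed P lam (Arr j)) ->
  (forall n, exp_distributed P (k%:R * mu) (Ph n)) ->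
  tempered_subordinator P theta alpha D ->
  indep_events P (fun i : src =>
    match i with
    | SArr j => rv_events (Arr j)
    | SPh n => rv_events (Ph n)
    | SSub => proc_events D
    end) ->
  let Pc := inter_phase k n0 Arr Ph D in
  indep_events P (fun n : nat => rv_events (Pc n)) /\
  (forall (n : nat) (t : R), 0 <= t ->
    let inner (q r : nat) : R :=
      (- (k%:R * mu * t `^ alpha)) ^+ r *
        ML3 alpha (r%:R * alpha + q%:R + 1) r%:R (theta `^ alpha * t `^ alpha) in
    let outer (q : nat) : R :=
      (theta * t) ^+ q * limn (series (inner q)) in
    (forall q, cvgn (series (inner q))) /\
    cvgn (series outer) /\
    P [set w | (t%:E < Pc n w)%E] =
      (expR (- (theta * t)) * limn (series outer))%:E).
Proof.
move=> k1 lam0 mu0 theta0 alpha01 hArr hPh hD ind Pc.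
have c0 : 0 < k%:R * mu by rewrite mulr_gt0// ltr0n.
have alpha0 : 0 < alpha by have /andP[] := alpha01.
split; first exact: (indep_inter_phase c0 theta0 alpha01 hArr hPh hD ind).
move=> n t t0 inner outer.
have [cinner couter] := mittag_leffler_series_cvg theta0 alpha0 c0 t0.
split; first exact: cinner.
split; first exact: cvgP couter.
pose X := inter_phase_real k n0 Arr Ph D n.
have mArr j : measurable_fun setT (Arr j) by have [] := hArr j.
have mPh j : measurable_fun setT (Ph j) by have [] := hPh j.
have mX : measurable_fun setT X by exact: (measurable_inter_phase_real k n0 mArr mPh hD n).
have X0 w : 0 <= X w by exact: inter_phase_real_ge0.
have laplaceX u : 0 <= u ->
    Ex P (fun w => expR (- (u * X w))) = k%:R * mu / (k%:R * mu + laplace_exponent theta alpha u).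
  exact: laplace_inter_phase_real.
have bal := tail_balance theta0 alpha0 c0 mX X0 laplaceX t0.
rewrite /Pc (inter_phase_tail k n0 theta0 alpha01 hArr hPh hD).
rewrite -[LHS]fineK; last by rewrite fin_num_measure//; exact: measurable_gt_event.
congr EFin; rewrite (cvg_lim _ couter)// -bal addrK mulrCA.
by rewrite -expRD addrC subrr expR0 mulr1.
Qed.
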